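(* Let $\Gamma$ be a finitely generated residually finite group. Then $\Gamma$ is uniformly HS-stable if and only if $\Gamma$ is virtually abelian.
   Context: All groups $\Gamma$ are discrete (no topology is considered on them). For $n\in\mathbb{N}$, $n\geq 1$, the normalized Hilbert Schmidt norm on $M_n(\mathbb{C})$ is $\Vert A\Vert_{HS,n}=\left(\frac1n \mathrm{Tr}(AA^* )\right)^{1/2}=\left(\frac1n\sum_{i,j}|a_{i,j}|^2\right)^{1/2}$, and it induces the bi-invariant metric $d_{HS,n}(U,V)=\Vert U-V\Vert_{HS,n}$ on the unitary group $U(n)$ of $n\times n$ unitary matrices. For $\epsilon>0$, a map $\varphi:\Gamma\to U(n)$ is an $\epsilon$-homomorphism (with respect to $d_{HS,n}$) if $\Vert\varphi(g)\varphi(h)-\varphi(gh)\Vert_{HS,n}<\epsilon$ for all $g,h\in\Gamma$. A group $\Gamma$ is uniformly HS-stable if for every $\delta>0$ there exists $\epsilon>0$ such that for every $n\geq 1$ and every $\epsilon$-homomorphism $\varphi:\Gamma\to U(n)$ there is a group homomorphism $\pi:\Gamma\to U(n)$ with $\Vert\varphi(g)-\pi(g)\Vert_{HS,n}<\delta$ for all $g\in\Gamma$ (here $\epsilon$ depends only on $\delta$ and $\Gamma$, not on $n$). A group is virtually abelian if it has an abelian subgroup of finite index. *)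

(* Defs.v *)
From HB Require Import structures.
From mathcomp Require Import all_boot all_order all_algebra fingroup.
From mathcomp Require Import spectral complex.
From mathcomp Require Import boolp classical_sets functions cardinality reals.

Set Implicit Arguments.
Unset Strict Implicit.
Unset Printing Implicit Defensive.

Import Order.TTheory GRing.Theory Num.Theory.

Local Open Scope classical_set_scope.
Local Open Scope sesquilinear_scope.
Local Open Scope ring_scope.

Section Groups.
Variable Gamma : groupType.
Implicit Type H : set Gamma.

Definition subgroup H := group_closed [in H].

Definition finitely_generated :=
  exists2 S : set Gamma, finite_set S & smallest subgroup S = setT.

Definition residually_finite :=
  forall g : Gamma, g != 1%g ->
    exists (Q : finGroupType) (f : {multiplicative Gamma -> Q}), f g != 1%g.

Definition left_coset H (x : Gamma) : set Gamma := [set (x * h)%g | h in H].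

Definition finite_index H := finite_set (range (left_coset H)).

Definition virtually_abelian :=
  exists H, [/\ subgroup H,
                {in [in H] &, forall x y, commute x y} & finite_index H].

End Groups.

Section UnitaryGroup.
Variables (R : realType) (n : nat).

Record unitary := Unitary {
  unitary_val :> 'M[R[i]]_n;
  unitaryP : unitary_val \is unitarymx }.

HB.instance Definition _ := [isSub for unitary_val].
HB.instance Definition _ := [Choice of unitary by <:].

Implicit Types U V W : unitary.

Fact unitary_one_subproof : (1%:M : 'M[R[i]]_n) \is unitarymx.
Proof. by apply/unitarymxP; rewrite mul1mx trmx1 map_mx1. Qed.

Fact unitary_mul_subproof U V : (U : 'M_n) *m (V : 'M_n) \is unitarymx.
Proof. exact: mul_unitarymx (unitaryP U) (unitaryP V). Qed.

Fact unitary_inv_subproof U : (U : 'M_n)^t* \is unitarymx.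
Proof. by rewrite trmxC_unitary unitaryP. Qed.

Definition unitary_one := Unitary unitary_one_subproof.
Definition unitary_mul U V := Unitary (unitary_mul_subproof U V).
Definition unitary_inv U := Unitary (unitary_inv_subproof U).

Fact unitary_mulA : associative unitary_mul.
Proof. by move=> U V W; apply/val_inj/mulmxA. Qed.

Fact unitary_mul1 : left_id unitary_one unitary_mul.
Proof. by move=> U; apply/val_inj/mul1mx. Qed.

Fact unitary_mulr1 : right_id unitary_one unitary_mul.
Proof. by move=> U; apply/val_inj/mulmx1. Qed.

Fact unitary_mulV : left_inverse unitary_one unitary_inv unitary_mul.
Proof.
move=> U; apply/val_inj => /=.
by rewrite -invmx_unitary ?unitaryP// mulVmx ?unitarymx_unit ?unitaryP.
Qed.

Fact unitary_mulrV : right_inverse unitary_one unitary_inv unitary_mul.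
Proof. by move=> U; apply/val_inj/unitarymxP/unitaryP. Qed.

HB.instance Definition _ := isGroup.Build unitary
  unitary_mulA unitary_mul1 unitary_mulr1 unitary_mulV unitary_mulrV.

End UnitaryGroup.

Notation "''U[' R ]_ n" := (unitary R n)
  (at level 8, n at level 2, format "''U[' R ]_ n") : type_scope.

Section HilbertSchmidt.
Variable R : realType.

Section Norm.
Variable n : nat.

(* The trace of A A^* is a nonnegative real, so taking its real part, which
   only serves to land in R, loses nothing (see HSnormE). *)
Definition HSnorm (A : 'M[R[i]]_n) : R :=
  Num.sqrt (n%:R^-1 * complex.Re (\tr (A *m A^t* ))).

Lemma mxtrace_mulmxtC (A : 'M[R[i]]_n) :
  \tr (A *m A^t* ) = \sum_i \sum_j `|A i j| ^+ 2.
Proof.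
apply: eq_bigr => i _; rewrite mxE; apply: eq_bigr => j _.
by rewrite !mxE normCK.
Qed.

Lemma HSnormE (A : 'M[R[i]]_n) :
  (HSnorm A)%:C%C = sqrtC (n%:R^-1 * \tr (A *m A^t* )).
Proof.
have tr0 : 0 <= \tr (A *m A^t* ).
  by rewrite mxtrace_mulmxtC !sumr_ge0// => i _; rewrite sumr_ge0// => j _;
    rewrite exprn_ge0.
have trE : (complex.Re (\tr (A *m A^t* )))%:C%C = \tr (A *m A^t* ).
  by apply: RRe_real; exact: ger0_real.
have Re0 : 0 <= complex.Re (\tr (A *m A^t* )).
  by rewrite -(@lecR R) trE.
apply/eqP; rewrite -(@eqrXn2 _ 2%N) ?sqrtC_ge0 ?lecR ?sqrtr_ge0//; last first.
  by rewrite mulr_ge0 ?invr_ge0 ?ler0n.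
rewrite sqrtCK -rmorphXn/= sqr_sqrtr ?mulr_ge0 ?invr_ge0 ?ler0n//.
by rewrite rmorphM/= trE fmorphV/= rmorph_nat.
Qed.

Definition HSdist (U V : 'U[R]_n) : R := HSnorm (\val U - \val V).

End Norm.

Variable Gamma : groupType.

Definition HS_approx_hom n (eps : R) (phi : Gamma -> 'U[R]_n) :=
  forall g h : Gamma, HSdist (phi g * phi h)%g (phi (g * h)%g) < eps.

Definition uniformly_HS_stable :=
  forall delta : R, 0 < delta ->
    exists2 eps : R, 0 < eps &
      forall n : nat, (0 < n)%N ->
        forall phi : Gamma -> 'U[R]_n, HS_approx_hom eps phi ->
          exists pi : {multiplicative Gamma -> 'U[R]_n},
            forall g : Gamma, HSdist (phi g) (pi g) < delta.

End HilbertSchmidt.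

(* Main.v *)
From HB Require Import structures.
From mathcomp Require Import all_boot all_order all_algebra fingroup.
From mathcomp Require Import spectral complex.
From mathcomp Require Import boolp classical_sets functions cardinality filter reals.
From mathcomp Require Import lra ring zify.
Require Import Defs.

Set Implicit Arguments.
Unset Strict Implicit.
Unset Printing Implicit Defensive.

Import Order.TTheory GRing.Theory Num.Theory.

Local Open Scope sesquilinear_scope.
Local Open Scope ring_scope.

(** Why the theorem is true.

Stable implies virtually abelian.  Let pi be a unitary representation of dimension
p + 1.  Multiplying each pi g by a reflection makes it fix the last basis vector, and
deleting that vector gives a map into U(p) whose defect has bounded Frobenius norm, hence
normalized norm of order 1 / sqrt p (compressed_representation).  If p is large,
stability provides a representation rho near this map, and averaging the inclusion of
p-space into (p + 1)-space, in the form of the centre of the smallest ball containing its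
orbit (isometric_action_fixed_point), provides a nonzero intertwiner of rho and pi.  Thus
pi is reducible, and all irreducible representations have dimension at most some d
(stable_intertwiner).  By residual finiteness every nontrivial element is detected by a
regular representation of a finite quotient, hence by one of dimension at most d
(small_representation_detects).  Jordan's theorem makes the image of each of these abelian
on a subgroup of index bounded in terms of d (jordan_bounded_index), and since the group is
finitely generated all these subgroups contain a single subgroup of finite index
(finite_index_in_bounded_index).  Its commutators are killed by every representation of
dimension at most d with finite image, so it is abelian.

Virtually abelian implies stable.  Such a group has finite families of elements whose
counting measures become asymptotically invariant (virtually_abelian_reiter).  Let phi be
an approximate homomorphism with defect e sqrt n in Frobenius norm.  Its left translates,
as functions on such a family, span nearly equal spaces of dimension n; the average M of
the projections onto them is a positive contraction of trace n that almost commutes with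
translations and satisfies tr (V M V') >= n - 2 e n, where V is phi itself and V' its adjoint
(mean_projection_spectrum, overlap_large).  Eigenvalue counting (spectral_counting) and
a spectral gap (exists_gap) give a spectral subspace of M of dimension within 6 e n of n
that is almost invariant under translations and almost contains phi (spectral_part).
The eigenvectors extend from the finite family to the whole group by the eigenvalue
equation (eigenfunction), translation acts on them by almost unitary and almost
multiplicative matrices (dilation_mul, dilation_trmxC), and phi is almost a compression of
this action (dilation_compression).  A limit along an ultrafilter removes the errors due to
the failure of invariance and leaves a genuine representation rho, of dimension m within
6 e n of n, of which phi is a compression up to an error of order sqrt (e n)
(exact_dilation).  It remains to change the dimension from m to n.  As the group is
virtually abelian, rho has invariant subspaces of every dimension up to a bounded error
(stable_subspace_near_dim); a polar decomposition turns the compression into an isometry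
(isometry_near_contraction), and missing dimensions are filled by the trivial
representation (representation_of_right_dim). *)

(** * The Frobenius norm on complex matrices *)

Section ConjugateTranspose.
Variable C : numClosedFieldType.

Lemma trmxC_mul m n p (A : 'M[C]_(m, n)) (B : 'M[C]_(n, p)) :
  (A *m B)^t* = B^t* *m A^t*.
Proof. by rewrite trmx_mul map_mxM. Qed.

Lemma trmxCD m n (A B : 'M[C]_(m, n)) : (A + B)^t* = A^t* + B^t*.
Proof. by rewrite linearD map_mxD. Qed.

Lemma trmxCN m n (A : 'M[C]_(m, n)) : (- A)^t* = - A^t*.
Proof. by rewrite linearN map_mxN. Qed.

Lemma trmxCB m n (A B : 'M[C]_(m, n)) : (A - B)^t* = A^t* - B^t*.
Proof. by rewrite trmxCD trmxCN. Qed.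

Lemma trmxC1 n : (1%:M : 'M[C]_n)^t* = 1%:M.
Proof. by rewrite trmx1 map_mx1. Qed.

Lemma trmxC0 m n : (0 : 'M[C]_(m, n))^t* = 0.
Proof. by rewrite trmx0 map_mx0. Qed.

Lemma trmxCZ m n c (A : 'M[C]_(m, n)) : (c *: A)^t* = c^* *: A^t*.
Proof. by rewrite linearZ /= map_mxZ. Qed.

Lemma trmxC_sum m n I (r : seq I) (P : pred I) (F : I -> 'M[C]_(m, n)) :
  (\sum_(i <- r | P i) F i)^t* = \sum_(i <- r | P i) (F i)^t*.
Proof.
by elim/big_rec2: _ => [|i A B _ <-]; rewrite ?trmxC0 ?trmxCD.
Qed.

Lemma unitarymxPr n (U : 'M[C]_n) : U \is unitarymx -> U^t* *m U = 1%:M.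
Proof. by move=> /unitarymxP/mulmx1C. Qed.

Lemma unitarymx_trmxC n (U : 'M[C]_n) : U \is unitarymx -> U^t* \is unitarymx.
Proof. by rewrite trmxC_unitary. Qed.

End ConjugateTranspose.

Section Frobenius.
Variable R : realType.
Local Notation C := R[i].

Definition mxdot m n (A B : 'M[C]_(m, n)) : R := complex.Re (\tr (A *m B^t*)).
Definition frob m n (A : 'M[C]_(m, n)) : R := Num.sqrt (mxdot A A).

Lemma mxdot_trE m n (A B : 'M[C]_(m, n)) : mxdot A B = complex.Re (\tr (A *m B^t*)).
Proof. by []. Qed.

Lemma ReD (x y : C) : complex.Re (x + y) = complex.Re x + complex.Re y.
Proof. by case: x; case: y. Qed.
Lemma ReN (x : C) : complex.Re (- x) = - complex.Re x.
Proof. by case: x. Qed.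
Lemma Re_sum I (r : seq I) (P : pred I) (F : I -> C) :
  complex.Re (\sum_(i <- r | P i) F i) = \sum_(i <- r | P i) complex.Re (F i).
Proof. by elim/big_rec2: _ => [|i x y _ <-]; rewrite ?ReD. Qed.
Lemma Re_scale (c : R) (x : C) : complex.Re (c%:C%C * x) = c * complex.Re x.
Proof. by case: x => a b /=; rewrite mul0r subr0. Qed.
Lemma conj_real (c : R) : (c%:C%C : C)^* = c%:C%C.
Proof. by apply/eqP; rewrite eq_complex /= oppr0 !eqxx. Qed.
Lemma Re_mulconj (x y : C) : complex.Re (x * y^*) =
  complex.Re x * complex.Re y + complex.Im x * complex.Im y.
Proof. by case: x => a b; case: y => c d /=; rewrite mulrN opprK. Qed.

Section Space.
Variables m n : nat.
Implicit Types A B D : 'M[C]_(m, n).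

Lemma mxdotE A B : mxdot A B =
  \sum_i \sum_j (complex.Re (A i j) * complex.Re (B i j)
                 + complex.Im (A i j) * complex.Im (B i j)).
Proof.
rewrite /mxdot /mxtrace Re_sum; apply: eq_bigr => i _.
by rewrite mxE Re_sum; apply: eq_bigr => j _; rewrite !mxE Re_mulconj.
Qed.

Lemma mxdotC A B : mxdot A B = mxdot B A.
Proof.
rewrite !mxdotE; apply: eq_bigr => i _; apply: eq_bigr => j _.
by rewrite mulrC [_ (B i j) * _]mulrC -[X in _ + X]mulrC.
Qed.

Lemma mxdotDl A B D : mxdot (A + B) D = mxdot A D + mxdot B D.
Proof. by rewrite /mxdot mulmxDl linearD ReD. Qed.
Lemma mxdotNl A D : mxdot (- A) D = - mxdot A D.
Proof. by rewrite /mxdot mulNmx linearN ReN. Qed.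
Lemma mxdotDr A B D : mxdot D (A + B) = mxdot D A + mxdot D B.
Proof. by rewrite mxdotC mxdotDl !(mxdotC D). Qed.
Lemma mxdotNr A D : mxdot D (- A) = - mxdot D A.
Proof. by rewrite mxdotC mxdotNl (mxdotC D). Qed.
Lemma mxdotZl (c : R) A D : mxdot (c%:C%C *: A) D = c * mxdot A D.
Proof. by rewrite /mxdot -scalemxAl linearZ /= Re_scale. Qed.
Lemma mxdotZr (c : R) A D : mxdot D (c%:C%C *: A) = c * mxdot D A.
Proof. by rewrite mxdotC mxdotZl mxdotC. Qed.
Lemma mxdot0l D : mxdot 0 D = 0.
Proof. by rewrite -[0]subr0 mxdotDl mxdotNl subrr. Qed.
Lemma mxdot0r D : mxdot D 0 = 0.
Proof. by rewrite mxdotC mxdot0l. Qed.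
Lemma mxdot_suml I (r : seq I) (P : pred I) (F : I -> 'M[C]_(m, n)) D :
  mxdot (\sum_(i <- r | P i) F i) D = \sum_(i <- r | P i) mxdot (F i) D.
Proof. by elim/big_rec2: _ => [|i x y _ <-]; rewrite ?mxdot0l ?mxdotDl. Qed.

Lemma mxdot_ge0 A : 0 <= mxdot A A.
Proof.
rewrite mxdotE; apply: sumr_ge0 => i _; apply: sumr_ge0 => j _.
by rewrite addr_ge0// -expr2 sqr_ge0.
Qed.
Hint Resolve mxdot_ge0 : core.

Lemma mxdot_eq0 A : mxdot A A = 0 -> A = 0.
Proof.
rewrite mxdotE => /eqP; rewrite psumr_eq0; last first.
  by move=> i _; apply: sumr_ge0 => j _; rewrite addr_ge0// -expr2 sqr_ge0.
move=> /allP A0; apply/matrixP => i j; rewrite mxE.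
have /eqP := A0 i (mem_index_enum _); move/eqP; rewrite psumr_eq0; last first.
  by move=> k _; rewrite addr_ge0// -expr2 sqr_ge0.
move=> /allP/(_ j (mem_index_enum _)); rewrite /= paddr_eq0 -?expr2 ?sqr_ge0//.
rewrite !sqrf_eq0 => /andP[/eqP a0 /eqP b0].
by apply/eqP; rewrite eq_complex a0 b0 !eqxx.
Qed.

Lemma frob_ge0 A : 0 <= frob A. Proof. exact: sqrtr_ge0. Qed.
Hint Resolve frob_ge0 : core.
Lemma frob_sqr A : frob A ^+ 2 = mxdot A A. Proof. exact: sqr_sqrtr. Qed.
Lemma frob_eq0 A : frob A = 0 -> A = 0.
Proof. by move=> A0; apply: mxdot_eq0; rewrite -frob_sqr A0 expr0n. Qed.
Lemma frob0 : frob (0 : 'M[C]_(m, n)) = 0.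
Proof. by rewrite /frob mxdot0l sqrtr0. Qed.
Lemma frobN A : frob (- A) = frob A.
Proof. by rewrite /frob mxdotNl mxdotNr opprK. Qed.
Lemma frobC A B : frob (A - B) = frob (B - A).
Proof. by rewrite -frobN opprB. Qed.
Lemma frobZ (c : R) A : 0 <= c -> frob (c%:C%C *: A) = c * frob A.
Proof.
move=> c0; rewrite /frob mxdotZl mxdotZr mulrA -expr2 sqrtrM ?sqr_ge0//.
by rewrite sqrtr_sqr ger0_norm.
Qed.

Lemma frob_le A (c : R) : 0 <= c -> mxdot A A <= c ^+ 2 -> frob A <= c.
Proof. by move=> c0 Ac; rewrite -ler_sqr ?nnegrE// frob_sqr. Qed.
Lemma mxdot_frob_le A (c : R) : frob A <= c -> mxdot A A <= c ^+ 2.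
Proof.
by move=> Ac; rewrite -frob_sqr ler_sqr ?nnegrE// (le_trans _ Ac).
Qed.

Lemma mxdot_CS A B : mxdot A B <= frob A * frob B.
Proof.
have [/frob_eq0 ->|B0] := eqVneq (frob B) 0; first by rewrite mxdot0r frob0 mulr0.
have Bpos : 0 < frob B by rewrite lt_neqAle eq_sym B0 frob_ge0.
have [/frob_eq0 ->|A0] := eqVneq (frob A) 0; first by rewrite mxdot0l frob0 mul0r.
have Apos : 0 < frob A by rewrite lt_neqAle eq_sym A0 frob_ge0.
have := mxdot_ge0 ((frob B)%:C%C *: A - (frob A)%:C%C *: B).
rewrite mxdotDl !mxdotDr !mxdotNl !mxdotNr !mxdotZl !mxdotZr -!frob_sqr (mxdotC B).
set a := frob A; set b := frob B; set x := mxdot A B => h.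
have : 0 <= (2 * (a * b)) * (a * b - x) by move: h; rewrite (_ : _ + _ + _ = (2 * (a * b)) * (a * b - x)); [|ring].
by rewrite pmulr_rge0 ?mulr_gt0// subr_ge0.
Qed.

Lemma frob_triangle A B : frob (A + B) <= frob A + frob B.
Proof.
apply: frob_le; first exact: addr_ge0.
rewrite mxdotDl !mxdotDr -!frob_sqr (mxdotC B).
have := mxdot_CS A B; nra.
Qed.

Lemma frob_triangleB A B : frob (A - B) <= frob A + frob B.
Proof. by rewrite -[frob B]frobN frob_triangle. Qed.

Lemma frob_dist_trans D A B : frob (A - B) <= frob (A - D) + frob (D - B).
Proof. by rewrite (_ : A - B = (A - D) + (D - B)) ?frob_triangle// addrA subrK. Qed.

Lemma frob_le_add A B : frob A <= frob B + frob (A - B).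
Proof. by rewrite -{1}(subrK B A) addrC frob_triangle. Qed.

Lemma frob_sum I (r : seq I) (P : pred I) (F : I -> 'M[C]_(m, n)) :
  frob (\sum_(i <- r | P i) F i) <= \sum_(i <- r | P i) frob (F i).
Proof.
elim/big_rec2: _ => [|i x y _ IH]; first by rewrite frob0.
by apply: le_trans (frob_triangle _ _) _; rewrite lerD2l.
Qed.

End Space.
Hint Resolve mxdot_ge0 : core.
Hint Resolve frob_ge0 : core.

Lemma mxdot_mull m n p (A : 'M[C]_(m, n)) (B : 'M[C]_(n, p)) D :
  mxdot (A *m B) D = mxdot A (D *m B^t*).
Proof. by rewrite /mxdot trmxC_mul trmxCK mulmxA. Qed.

Lemma mxdot_mulr m n p (A : 'M[C]_(m, n)) (B : 'M[C]_(n, p)) D :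
  mxdot (A *m B) D = mxdot B (A^t* *m D).
Proof. by rewrite /mxdot trmxC_mul trmxCK mulmxA -mulmxA mxtrace_mulC. Qed.

Lemma mxdot_trmxC m n (A B : 'M[C]_(m, n)) : mxdot (A^t*) (B^t*) = mxdot A B.
Proof. by rewrite [RHS]mxdotC /mxdot trmxCK mxtrace_mulC. Qed.

Lemma frob_trmxC m n (A : 'M[C]_(m, n)) : frob (A^t*) = frob A.
Proof. by rewrite /frob mxdot_trmxC. Qed.

Lemma mxdot_isomr m n p (A B : 'M[C]_(m, n)) (U : 'M[C]_(n, p)) :
  U \is unitarymx -> mxdot (A *m U) (B *m U) = mxdot A B.
Proof. by move=> Uu; rewrite mxdot_mull mulmxtVK. Qed.

Lemma frob_isomr m n p (A : 'M[C]_(m, n)) (U : 'M[C]_(n, p)) :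
  U \is unitarymx -> frob (A *m U) = frob A.
Proof. by move=> Uu; rewrite /frob mxdot_isomr. Qed.

Lemma frob_isomlC m n p (A : 'M[C]_(m, n)) (U : 'M[C]_(m, p)) :
  U \is unitarymx -> frob (U^t* *m A) = frob A.
Proof. by move=> Uu; rewrite -frob_trmxC trmxC_mul trmxCK frob_isomr// frob_trmxC. Qed.

Lemma frob_unitl m n (A : 'M[C]_(m, n)) (U : 'M[C]_m) :
  U \is unitarymx -> frob (U *m A) = frob A.
Proof. by move=> Uu; rewrite -[U]trmxCK frob_isomlC// trmxC_unitary. Qed.

Lemma mxdot1 n : mxdot (1%:M : 'M[C]_n) 1%:M = n%:R.
Proof. by rewrite /mxdot mul1mx trmxC1 mxtrace1 -(rmorph_nat (real_complex R)). Qed.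

Lemma mxdot_unitary m n (U : 'M[C]_(m, n)) : U \is unitarymx -> mxdot U U = m%:R.
Proof. by move=> Uu; rewrite -[U]mul1mx mxdot_isomr// mxdot1. Qed.

Lemma frob_unitary m n (U : 'M[C]_(m, n)) : U \is unitarymx -> frob U = Num.sqrt m%:R.
Proof. by move=> Uu; rewrite /frob mxdot_unitary. Qed.

Lemma mxdot_rows m n (A B : 'M[C]_(m, n)) : mxdot A B = \sum_i mxdot (row i A) (row i B).
Proof.
rewrite mxdotE; apply: eq_bigr => i _; rewrite mxdotE big_ord1.
by apply: eq_bigr => j _; rewrite !mxE.
Qed.

(** Contractions are phrased for all left multipliers at once, so that they apply
to row vectors and to matrices alike. *)
Definition contraction n p (X : 'M[C]_(n, p)) :=
  forall m (A : 'M[C]_(m, n)), frob (A *m X) <= frob A.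

Lemma contraction_unitary n p (U : 'M[C]_(n, p)) : U \is unitarymx -> contraction U.
Proof. by move=> Uu m A; rewrite frob_isomr. Qed.

Lemma contraction_trmxC n p (X : 'M[C]_(n, p)) : contraction X -> contraction (X^t*).
Proof.
move=> cX m A; set y := frob (A *m X^t*).
have [->//|y0] := eqVneq y 0.
have ypos : 0 < y by rewrite lt_neqAle eq_sym y0 /y frob_ge0.
rewrite -(ler_pM2l ypos) -expr2 frob_sqr mxdot_mull trmxCK mxdotC.
by apply: le_trans (mxdot_CS _ _) _; rewrite ler_wpM2r.
Qed.

Lemma contraction_mul n p q (X : 'M[C]_(n, p)) (Y : 'M[C]_(p, q)) :
  contraction X -> contraction Y -> contraction (X *m Y).
Proof. by move=> cX cY m A; rewrite mulmxA (le_trans (cY _ _)). Qed.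

Lemma contraction_frob_mull n p m (X : 'M[C]_(n, p)) (A : 'M[C]_(p, m)) :
  contraction X -> frob (X *m A) <= frob A.
Proof.
move=> cX; rewrite -frob_trmxC trmxC_mul -[leRHS]frob_trmxC.
exact: contraction_trmxC.
Qed.

Lemma contraction_frob n p (X : 'M[C]_(n, p)) : contraction X -> mxdot X X <= n%:R.
Proof.
move=> /(_ _ 1%:M); rewrite mul1mx => /mxdot_frob_le.
by rewrite frob_sqr mxdot1.
Qed.

Lemma frobM m n p (A : 'M[C]_(m, n)) (B : 'M[C]_(n, p)) : frob (A *m B) <= frob A * frob B.
Proof.
apply: frob_le; first exact: mulr_ge0.
have entry (i : 'I_m) (j : 'I_p) : (A *m B) i j = \tr (row i A *m (row j (B^t*))^t*).
  rewrite mxE /mxtrace big_ord1 mxE; apply: eq_bigr => k _.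
  by rewrite !mxE conjCK.
(* The complex Cauchy-Schwarz inequality follows from the real one applied to u rotated
   by the conjugate of the inner product of u and v. *)
have CSC (u v : 'rV[C]_n) :
  complex.Re (\tr (u *m v^t*)) ^+ 2 + complex.Im (\tr (u *m v^t*)) ^+ 2 <= mxdot u u * mxdot v v.
  set z := \tr _.
  have zz : mxdot (z^* *: u) v = complex.Re z ^+ 2 + complex.Im z ^+ 2.
    by rewrite /mxdot -scalemxAl linearZ /= -/z mulrC Re_mulconj.
  have h := mxdot_CS (z^* *: u) v.
  have uu : mxdot (z^* *: u) (z^* *: u) = (complex.Re z ^+ 2 + complex.Im z ^+ 2) * mxdot u u.
    rewrite /mxdot trmxCZ conjCK -scalemxAl -scalemxAr scalerA linearZ /= mulrC.
    have -> : z^* * z = (complex.Re z ^+ 2 + complex.Im z ^+ 2)%:C%C.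
      by case: (z) => a b; apply/eqP; rewrite eq_complex/= mulNr opprK -!expr2 mulNr mulrC subrr !eqxx.
    by rewrite mulrC Re_scale.
  set t := _ + _ in zz uu *.
  have t0 : 0 <= t by rewrite addr_ge0// sqr_ge0.
  rewrite zz in h.
  have : t ^+ 2 <= t * (mxdot u u * mxdot v v).
    rewrite mulrA -uu -!frob_sqr -exprMn ler_sqr ?nnegrE ?mulr_ge0//.
  have [->|t1] := eqVneq t 0; first by rewrite !mulr_ge0.
  by rewrite expr2 ler_pM2l// lt_neqAle eq_sym t1.
rewrite mxdotE exprMn !frob_sqr (mxdot_rows A) -(mxdot_trmxC B) (mxdot_rows (B^t*)).
rewrite mulr_suml; apply: ler_sum => i _; rewrite mulr_sumr; apply: ler_sum => j _.
by rewrite entry -!expr2; exact: CSC.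
Qed.

Lemma HSnorm_frob n (A : 'M[C]_n) : HSnorm A = frob A / Num.sqrt n%:R.
Proof. by rewrite /HSnorm -/(mxdot A A) sqrtrM ?invr_ge0// sqrtrV// mulrC. Qed.

Lemma HSdist_lt n (U V : 'U[R]_n) (e : R) : (0 < n)%N ->
  (HSdist U V < e) = (frob (\val U - \val V) < e * Num.sqrt n%:R).
Proof.
by move=> n0; rewrite /HSdist HSnorm_frob ltr_pdivrMr// sqrtr_gt0 ltr0n.
Qed.

End Frobenius.
Arguments frob : simpl never.
Arguments mxdot : simpl never.
#[global] Opaque frob mxdot.

(** The arithmetic tactics compare atoms up to conversion, which is prohibitive on
matrices: norms are turned into variables first. *)
Ltac abstract_norms := repeat match goal with
  | _ : context [@frob ?R ?m ?n ?A] |- _ =>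
      let x := fresh "x" in set (x := @frob R m n A) in *; clearbody x
  | |- context [@frob ?R ?m ?n ?A] =>
      let x := fresh "x" in set (x := @frob R m n A) in *; clearbody x
  | _ : context [@mxdot ?R ?m ?n ?A ?B] |- _ =>
      let x := fresh "x" in set (x := @mxdot R m n A B) in *; clearbody x
  | |- context [@mxdot ?R ?m ?n ?A ?B] =>
      let x := fresh "x" in set (x := @mxdot R m n A B) in *; clearbody x
  end.
Ltac frob_lra := abstract_norms; lra.
#[global] Hint Resolve mxdot_ge0 : core.
#[global] Hint Resolve frob_ge0 : core.

(** * Isometries, polar decomposition and commuting unitaries *)

Section Isometries.
Variable R : realType.
Local Notation C := R[i].

Lemma mul2_le_absurd (x y : R) : 0 < x -> y < 1 -> 2 * x <= x * y -> False.
Proof. nra. Qed.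

Lemma addr_swap (V : zmodType) (x a b : V) : x - a - (b - x) = x - b - (a - x).
Proof. by rewrite !opprB addrC. Qed.

Lemma mulmx_trmxC_row n (v : 'rV[C]_n) : v *m v^t* = ((mxdot v v)%:C%C)%:M.
Proof.
rewrite [LHS]mx11_scalar; congr (_%:M); apply/eqP; rewrite eq_complex mxdot_trE /mxtrace big_ord1 /= eqxx/=.
apply/eqP; have : ((v *m v^t*) 0 0)^* = (v *m v^t*) 0 0.
  by rewrite -[in RHS](trmxCK v) -trmxC_mul !mxE trmxCK.
by case: (_ 0 0) => a b /eqP; rewrite eq_complex /= => /andP[_ /eqP]; lra.
Qed.

Lemma frob_eq1_unitarymx n (v : 'rV[C]_n) : frob v = 1 -> v \is unitarymx.
Proof. by move=> v1; apply/unitarymxP; rewrite mulmx_trmxC_row -frob_sqr v1 expr1n. Qed.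

Lemma normalize_row n (v : 'rV[C]_n) : v != 0 ->
  exists2 u : 'rV[C]_n, u \is unitarymx & v = (frob v)%:C%C *: u.
Proof.
move=> v0; have fv : 0 < frob v.
  by rewrite lt_neqAle frob_ge0 andbT eq_sym; apply: contra v0 => /eqP/frob_eq0->.
exists ((frob v)^-1%:C%C *: v).
  apply: frob_eq1_unitarymx; rewrite frobZ ?mulVf ?gt_eqF//; by rewrite invr_ge0 frob_ge0.
by rewrite scalerA -rmorphM /= mulfV ?scale1r// gt_eqF.
Qed.

Lemma ex_unit_orthogonal k n (K : 'M[C]_(k, n)) : (k < n)%N ->
  exists2 u : 'rV[C]_n, u \is unitarymx & u *m K^t* = 0.
Proof.
move=> kn; set N := kermx (K^t*).
have N0 : N != 0.
  rewrite -mxrank_eq0 mxrank_ker -lt0n subn_gt0.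
  by apply: leq_ltn_trans kn; rewrite rank_leq_col.
have [|u uu vE] := @normalize_row _ (nz_row N); first by rewrite nz_row_eq0.
exists u => //; have /sub_kermxP : (nz_row N <= N)%MS by exact: nz_row_sub.
rewrite vE -scalemxAl => /eqP; rewrite scaler_eq0 => /orP[|/eqP//].
rewrite eq_complex /= eqxx andbT => /eqP/frob_eq0/eqP.
by rewrite nz_row_eq0 (negPf N0).
Qed.

Lemma unitarymx_col m1 m2 n (A : 'M[C]_(m1, n)) (B : 'M[C]_(m2, n)) :
  A \is unitarymx -> B \is unitarymx -> A *m B^t* = 0 -> col_mx A B \is unitarymx.
Proof.
move=> Au Bu AB; apply/unitarymxP; rewrite tr_col_mx map_row_mx mul_col_row.
rewrite !(unitarymxP _)// AB -[B *m _]trmxCK trmxC_mul trmxCK AB trmxC0.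
by rewrite -scalar_mx_block.
Qed.

(** The rows of A may vanish, so the isometry cannot be obtained by normalizing
them: a zero row is replaced by a unit vector orthogonal to everything chosen so
far, which is why B is carried along the induction. *)
Lemma isometry_of_orthogonal_rows m r n (A : 'M[C]_(m, n)) (B : 'M[C]_(r, n)) :
  (m + r <= n)%N -> B \is unitarymx -> A *m B^t* = 0 ->
  (forall i j, i != j -> (A *m A^t*) i j = 0) ->
  exists S : 'M[C]_(m, n), [/\ S \is unitarymx, S *m B^t* = 0 &
     mxdot A S = \sum_i frob (row i A)].
Proof.
elim: m r A B => [|m IH] r A B mrn Bu AB Aorth.
  exists 0; split; [by apply/unitarymxP; rewrite [LHS]flatmx0 [RHS]flatmx0|by rewrite mul0mx|].
  by rewrite mxdot0r big_ord0.
move: A AB Aorth; rewrite -[m.+1]/(1 + m)%N => A.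
rewrite -[A]vsubmxK; move: (usubmx A) (dsubmx A) => v A' {A} AB Aorth.
have [vB A'B] : v *m B^t* = 0 /\ A' *m B^t* = 0.
  move: AB; rewrite mul_col_mx => /(congr1 (fun M => (usubmx M, dsubmx M))).
  by rewrite col_mxKu col_mxKd !linear0 => -[].
have AAE : col_mx v A' *m (col_mx v A')^t* =
    block_mx (v *m v^t*) (v *m A'^t*) (A' *m v^t*) (A' *m A'^t*).
  by rewrite tr_col_mx map_row_mx mul_col_row.
have A'v : A' *m v^t* = 0.
  apply/matrixP => i j; rewrite ord1 [RHS]mxE.
  have := Aorth (rshift 1 i) (lshift m 0); rewrite AAE block_mxEdl; apply.
  by rewrite eq_rlshift.
have A'orth i j : i != j -> (A' *m A'^t*) i j = 0.
  move=> ij; have := Aorth (rshift 1 i) (rshift 1 j); rewrite AAE block_mxEdr; apply.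
  by rewrite (inj_eq (@rshift_inj _ _)).
have fsum : \sum_i frob (row i (col_mx v A')) = frob v + \sum_i frob (row i A').
  rewrite (@big_split_ord _ _ _ 1 m) /=.
  rewrite big_ord1 rowKu row_id; congr (_ + _); apply: eq_bigr => i _.
  by rewrite rowKd.
(* Both cases provide a unit vector u with v = |v| u, orthogonal to the isometry S' given
   by the induction hypothesis. *)
have finish (u : 'rV_n) S' : u \is unitarymx -> u *m B^t* = 0 -> v = (frob v)%:C%C *: u ->
    S' \is unitarymx -> S' *m u^t* = 0 -> S' *m B^t* = 0 ->
    mxdot A' S' = \sum_i frob (row i A') ->
    exists S : 'M[C]_(1 + m, n), [/\ S \is unitarymx, S *m B^t* = 0 &
      mxdot (col_mx v A') S = \sum_i frob (row i (col_mx v A'))].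
  move=> uu uB vu Su Su0 SB AS; exists (col_mx u S'); split.
  - by apply: unitarymx_col => //; rewrite -[u]trmxCK -trmxC_mul Su0 trmxC0.
  - by rewrite mul_col_mx uB SB col_mx0.
  - rewrite fsum -AS mxdot_trE tr_col_mx map_row_mx mul_col_row mxtrace_block ReD.
    by rewrite -!mxdot_trE {1}vu mxdotZl mxdot_unitary// mulr1.
have [v0|v0] := eqVneq v 0.
  have [|//|//|//|S' [Su SB AS]] := IH r A' B; first by rewrite (leq_trans _ mrn)// leq_add2r.
  have SBu : col_mx S' B \is unitarymx by exact: unitarymx_col.
  have [u uu uK] := ex_unit_orthogonal (col_mx S' B) mrn.
  move: uK; rewrite tr_col_mx map_row_mx mul_mx_row => /(congr1 (fun M => (lsubmx M, rsubmx M))).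
  rewrite row_mxKl row_mxKr !linear0 => -[uS uB].
  apply: (finish u S') => //; first by rewrite v0 frob0 scale0r.
  by rewrite -[S']trmxCK -trmxC_mul uS trmxC0.
have [u uu vu] := normalize_row v0.
have fv : (frob v)%:C%C != 0 :> C.
  by rewrite eq_complex /= eqxx andbT; apply: contra v0 => /eqP/frob_eq0->.
have vcancel k (X : 'M[C]_(n, k)) : v *m X = 0 -> u *m X = 0.
  by rewrite vu -scalemxAl => /eqP; rewrite scaler_eq0 (negPf fv) => /eqP.
have uB := vcancel _ _ vB.
have A'u : A' *m u^t* = 0.
  rewrite -[A']trmxCK -trmxC_mul vcancel ?trmxC0//.
  by rewrite -[v]trmxCK -trmxC_mul A'v trmxC0.
have [||||S' [Su SB AS]] := IH (1 + r)%N A' (col_mx u B).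
- by rewrite addnCA addnA.
- exact: unitarymx_col.
- by rewrite tr_col_mx map_row_mx mul_mx_row A'u A'B row_mx0.
- by [].
move: SB; rewrite tr_col_mx map_row_mx mul_mx_row => /(congr1 (fun M => (lsubmx M, rsubmx M))).
rewrite row_mxKl row_mxKr !linear0 => -[Su0 SB].
exact: (finish u S').
Qed.

Lemma hermitian_normal n (H : 'M[C]_n) : H^t* = H -> H \is normalmx.
Proof. by move=> HH; apply/normalmxP; rewrite HH. Qed.

Lemma spectral_decomposition n (H : 'M[C]_n) : H \is normalmx ->
  exists (P : 'M[C]_n) (d : 'rV[C]_n), P \is unitarymx /\ H = P^t* *m diag_mx d *m P.
Proof.
move=> /orthomx_spectralP HE; exists (spectralmx H), (spectral_diag H).
by split; [exact: spectral_unitarymx|rewrite {1}HE invmx_unitary// spectral_unitarymx].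
Qed.

(** Polar decomposition: Z is the isometric factor of Y, and (1 - s)^2 <= 1 - s^2
for every singular value s of Y. *)
Lemma isometry_near_contraction m n (Y : 'M[C]_(m, n)) : (m <= n)%N -> contraction Y ->
  exists2 Z : 'M[C]_(m, n), Z \is unitarymx &
    mxdot (Y - Z) (Y - Z) <= m%:R - mxdot Y Y.
Proof.
move=> mn cY.
have [|P [d [Pu HE]]] := @spectral_decomposition _ (Y *m Y^t*).
  by apply: hermitian_normal; rewrite trmxC_mul trmxCK.
pose A := P *m Y.
have AA : A *m A^t* = diag_mx d.
  rewrite trmxC_mul mulmxA -[P *m Y *m _]mulmxA HE !mulmxA (unitarymxP _)// mul1mx.
  by rewrite mulmxtVK.
have [||||S [Su _ AS]] := @isometry_of_orthogonal_rows m 0 n A 0.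
- by rewrite addn0.
- by apply/unitarymxP; rewrite [LHS]flatmx0 [RHS]flatmx0.
- by rewrite trmxC0 mulmx0.
- by move=> i j ij; rewrite AA mxE (negPf ij) mulr0n.
exists (P^t* *m S); first by rewrite mul_unitarymx ?trmxC_unitary.
have YZ : mxdot Y (P^t* *m S) = \sum_i frob (row i A).
  by rewrite -AS mxdotC mxdot_mulr trmxCK mxdotC.
have rowle i : frob (row i A) <= 1.
  rewrite row_mul; apply: le_trans (cY _ _) _.
  rewrite frob_unitary ?sqrtr1//; apply/unitarymxP.
  have /unitarymxP/matrixP/(_ i i) := Pu; rewrite !mxE eqxx => PE.
  apply/matrixP => a b; rewrite !ord1 !mxE eqxx -[in RHS]PE.
  by apply: eq_bigr => k _; rewrite !mxE.
have AAY : mxdot A A = mxdot Y Y.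
  by rewrite mxdot_mulr mulmxA (unitarymxPr Pu) mul1mx.
have YYle : mxdot Y Y <= mxdot Y (P^t* *m S).
  rewrite YZ -AAY mxdot_rows; apply: ler_sum => i _.
  by rewrite -frob_sqr expr2 ler_piMl ?frob_ge0 ?rowle.
have Zu : mxdot (P^t* *m S) (P^t* *m S) = m%:R.
  by apply: mxdot_unitary; rewrite mul_unitarymx ?trmxC_unitary.
rewrite mxdotDl !mxdotDr !mxdotNl !mxdotNr Zu (mxdotC _ Y).
by move: (mxdot Y Y) (mxdot Y _) YYle; clear => x y; lra.
Qed.

(** If A commutes with the commutator [A, B] it commutes with B A B^*.  Were the two
unitaries different, they would have a common eigenvector v with different eigenvalues;
then v and v B would be eigenvectors of A for different eigenvalues, hence
orthogonal, which a B close to 1 forbids. *)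
Lemma commute_conjugate_near1 n (A B : 'M[C]_n) : A \is unitarymx -> B \is unitarymx ->
  frob (B - 1%:M) < 1 ->
  A *m (B *m A *m B^t*) = (B *m A *m B^t*) *m A -> A *m B = B *m A.
Proof.
move=> Au Bu B1.
have : B *m A *m B^t* \is unitarymx.
  have Bs : B^t* \is unitarymx by rewrite trmxC_unitary.
  exact: mul_unitarymx (mul_unitarymx Bu Au) Bs.
move A'E : (B *m A *m B^t*) => A' A'u AC; pose D := A - A'.
have cAA' : A^t* *m A' = A' *m A^t*.
  have AC' : A *m A' = A' *m A by [].
  rewrite -[A' in LHS](mulmxtVK A' Au) -AC' !mulmxA.
  by rewrite (unitarymxPr Au) mul1mx.
have [D0|D0] := eqVneq D 0.
  move/eqP: D0; rewrite subr_eq0 => /eqP {1}->; rewrite -A'E -!mulmxA.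
  by rewrite (unitarymxPr Bu) mulmx1.
have Dn : D \is normalmx.
  have cA : A'^t* *m A = A *m A'^t*.
    by rewrite -[A *m _]trmxCK trmxC_mul trmxCK -cAA' trmxC_mul trmxCK.
  apply/normalmxP; rewrite trmxCB !mulmxBl !mulmxBr cA cAA'.
  rewrite (unitarymxP Au) (unitarymxP A'u) (unitarymxPr Au) (unitarymxPr A'u).
  exact: addr_swap.
have [P [d [Pu DE]]] := spectral_decomposition Dn.
have [l dl] : exists l, d 0 l != 0.
  apply/existsP; apply: contraNT D0; rewrite negb_exists => /forallP d0.
  rewrite DE (_ : d = 0) ?linear0 ?mulmx0 ?mul0mx//.
  by apply/rowP => i; rewrite mxE; apply/eqP; have := d0 i; rewrite negbK.
pose E := eigenspace D (d 0 l).
have E0 : E != 0.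
  apply/negP => /eqP E0; have : (row l P <= E)%MS.
    apply/eigenspaceP; rewrite DE !mulmxA -row_mul (unitarymxP _)//.
    by rewrite -row_mul mul1mx row_diag_mx -scalemxAl -rowE.
  rewrite E0 submx0 => /eqP r0.
  have := mxrank_unitary Pu; have : row l P *m P^t* = 0 by rewrite r0 mul0mx.
  rewrite -row_mul (unitarymxP _)// => /rowP/(_ l); rewrite !mxE eqxx => /eqP.
  by rewrite oner_eq0.
have stE : stablemx E A.
  by apply: comm_mx_stable_eigenspace; rewrite /comm_mx mulmxBl mulmxBr AC.
have [a] : exists a, eigenvalue (restrictmx E A) a.
  by apply: eigenvalue_closed; rewrite lt0n mxrank_eq0.
case/eigenvalueP => w /eqP wa w0.
pose v := w *m row_base E.
have v0 : v != 0 by rewrite mulmx_free_eq0 ?row_base_free.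
have vA : v *m A = a *: v.
  move/eqP: wa => wa; rewrite /v -mulmxA.
  have -> : row_base E *m A = restrictmx E A *m row_base E.
    by rewrite /conjmx mulmxKpV// stablemx_row_base.
  by rewrite mulmxA wa scalemxAl.
have vD : v *m D = d 0 l *: v.
  by apply/eigenspaceP; rewrite mulmx_sub// eq_row_base.
pose c := a - d 0 l.
have vA' : v *m A' = c *: v.
  have -> : A' = A - D by rewrite /D opprB addrC subrK.
  by rewrite mulmxBr vA vD -scalerBl.
have vBA : v *m B *m A = c *: (v *m B).
  have BA : B *m A = A' *m B by rewrite -A'E -!mulmxA (unitarymxPr Bu) mulmx1.
  by rewrite -mulmxA BA mulmxA vA' scalemxAl.
have fv : 0 < frob v.
  by rewrite lt_neqAle frob_ge0 andbT eq_sym; apply: contra v0 => /eqP/frob_eq0->.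
have unitev (z : C) (u : 'rV[C]_n) : u != 0 -> u *m A = z *: u -> z * z^* = 1.
  move=> u0 uz; have : u *m A *m (u *m A)^t* = u *m u^t*.
    by rewrite trmxC_mul mulmxA (mulmxtVK _ Au).
  rewrite uz trmxCZ -scalemxAl -scalemxAr scalerA mulmx_trmxC_row => /matrixP/(_ 0 0).
  rewrite !mxE eqxx mulr1n => zu; have uu0 : (mxdot u u)%:C%C != 0 :> C.
    by rewrite eq_complex /= eqxx andbT; apply: contra u0 => /eqP/mxdot_eq0->.
  by apply: (mulIf uu0); rewrite mul1r.
have aa := unitev _ _ v0 vA.
have vB0 : v *m B != 0.
  by apply: contra v0 => /eqP vB; rewrite -[v](mulmxtVK _ Bu) vB mul0mx.
have cc := unitev _ _ vB0 vBA.
have ac : a != c by rewrite /c -subr_eq0 opprB addrC subrK.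
have orth : v *m (v *m B)^t* = 0.
  have : v *m A *m (v *m B *m A)^t* = v *m (v *m B)^t*.
    by rewrite trmxC_mul mulmxA (mulmxtVK _ Au).
  rewrite vA vBA trmxCZ -scalemxAl -scalemxAr scalerA => /eqP.
  rewrite -subr_eq0 -[X in _ - X]scale1r -scalerBl scaler_eq0 subr_eq0 => /orP[|/eqP//].
  move=> /eqP ac1; move: ac; rewrite -[a]mulr1 -cc [c * _]mulrC mulrA ac1 mul1r eqxx//.
have o : mxdot v (v *m B) = 0 by rewrite mxdot_trE orth linear0.
have h : mxdot (v *m (B - 1%:M)) (v *m (B - 1%:M)) = 2 * mxdot v v.
  rewrite mulmxBr mulmx1 mxdotDl !mxdotDr !mxdotNl !mxdotNr mxdot_isomr//.
  by rewrite (mxdotC (v *m B) v) o; ring.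
have := frobM v (B - 1%:M) => /mxdot_frob_le; rewrite h exprMn frob_sqr.
have : frob (B - 1%:M) ^+ 2 < 1 by rewrite expr_lt1 ?frob_ge0.
have : 0 < mxdot v v by rewrite -frob_sqr exprn_gt0.
by move=> v2 b2 vb; exfalso; exact: mul2_le_absurd v2 b2 vb.
Qed.

End Isometries.

(** * Limits of matrices along an ultrafilter *)

Section Ultralimits.
Variable R : realType.
Local Notation C := R[i].

Lemma exists_free_ultrafilter : exists U : set_system nat,
  UltraFilter U /\ forall N, U [set n | (N <= n)%N]%classic.
Proof.
pose F : set_system nat := [set A | exists N, forall n, (N <= n)%N -> A n]%classic.
have FF : ProperFilter F.
  split; first by case=> N /(_ N (leqnn N)).
  split.
  - by exists 0%N.
  - move=> A B [N AN] [M BM]; exists (maxn N M) => n; rewrite geq_max => /andP[Nn Mn].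
    by split; [exact: AN|exact: BM].
  - by move=> A B AB [N AN]; exists N => n /AN /AB.
have [U [Uu FU]] := ultraFilterLemma FF.
by exists U; split => // N; apply: FU; exists N.
Qed.

Variable U : set_system nat.
Context {Uu : UltraFilter U}.

Lemma ultra_bounded_witness (b : nat) (P : nat -> nat -> Prop) :
  U [set N | exists2 m, (m <= b)%N & P m N]%classic -> exists m, U [set N | P m N]%classic.
Proof.
elim: b => [|b IH] UP.
  by exists 0%N; apply: filterS UP => N [m]; rewrite leqn0 => /eqP->.
have [UB|UB] := in_ultra_setVsetC [set N | P b.+1 N]%classic Uu; first by exists b.+1.
apply: IH; apply: filterS (filterI UP UB) => N [[m mb Pm] nP].
exists m => //; move: mb; rewrite leq_eqVlt => /orP[/eqP mE|//].
by case: nP; rewrite /= -mE.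
Qed.

Lemma ultra_real_limit (u : nat -> R) (c : R) : U [set N | `|u N| <= c]%classic ->
  exists l, forall e, 0 < e -> U [set N | `|u N - l| < e]%classic.
Proof.
move=> Uc; pose S : set R := [set x | U [set N | x <= u N]]%classic.
have S0 : S (- c).
  by apply: filterS Uc => N; rewrite /= ler_norml => /andP[].
have Sub x : S x -> x <= c.
  move=> Sx; have [N [/= h1]] := filter_ex (filterI Sx Uc).
  by rewrite ler_norml => /andP[_]; apply: le_trans.
have hS : has_sup S by split; [exists (- c)|exists c => x /Sub].
exists (sup S) => e e0.
have [x Sx xs] := sup_adherent e0 hS.
have nS : ~ S (sup S + e).
  move=> /(ub_le_sup hS.2); lra.
have [//|US] := in_ultra_setVsetC [set N | sup S + e <= u N]%classic Uu.
apply: filterS (filterI Sx US) => N [/= h1 /negP]; rewrite -ltNge => h2.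
by rewrite ltr_norml; lra.
Qed.

Fact rescale (e x y : R) : x != 0 -> y * (2 * (e / (2 * x))) = e * (y / x).
Proof. by move=> x0; field. Qed.

Lemma frob_entry m n (A : 'M[C]_(m, n)) i j :
  `|complex.Re (A i j)| <= frob A /\ `|complex.Im (A i j)| <= frob A.
Proof.
have h : complex.Re (A i j) ^+ 2 + complex.Im (A i j) ^+ 2 <= frob A ^+ 2.
  rewrite frob_sqr mxdotE (bigD1 i)//= (bigD1 j)//= -!expr2.
  rewrite -addrA lerDl addr_ge0//.
    by apply: sumr_ge0 => k _; rewrite addr_ge0// -expr2 sqr_ge0.
  apply: sumr_ge0 => k _; apply: sumr_ge0 => k' _.
  by rewrite addr_ge0// -expr2 sqr_ge0.
by split; rewrite -ler_sqr ?nnegrE ?frob_ge0// real_normK ?num_real//;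
  apply: le_trans h; rewrite ?lerDl ?lerDr sqr_ge0.
Qed.

Lemma frob_entries_le m n (A : 'M[C]_(m, n)) (c : R) : 0 <= c ->
  (forall i j, `|complex.Re (A i j)| + `|complex.Im (A i j)| <= c) ->
  frob A <= (m * n)%:R * c.
Proof.
move=> c0 Ac; apply: frob_le; first by rewrite mulr_ge0.
have h i j : complex.Re (A i j) * complex.Re (A i j) +
    complex.Im (A i j) * complex.Im (A i j) <= c ^+ 2.
  rewrite -!expr2 -[complex.Re _ ^+ 2]real_normK ?num_real//.
  rewrite -[complex.Im _ ^+ 2]real_normK ?num_real//.
  have := Ac i j; have := normr_ge0 (complex.Re (A i j)).
  have := normr_ge0 (complex.Im (A i j)).
  move: `|complex.Re _| `|complex.Im _| => a b; clear -c0; nra.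
rewrite mxdotE; apply: le_trans (_ : \sum_(i < m) \sum_(j < n) c ^+ 2 <= _).
  by apply: ler_sum => i _; apply: ler_sum => j _; exact: h.
rewrite !sumr_const !card_ord -mulrnA [X in _ *+ X <= _]mulnC -[leLHS]mulr_natl exprMn ler_wpM2r ?sqr_ge0//.
rewrite -natrX ler_nat; case: (m * n)%N => [|k]; first by [].
by rewrite expnS expn1 leq_pmulr.
Qed.

Definition ultra_cvg m n (u : nat -> 'M[C]_(m, n)) (l : 'M[C]_(m, n)) :=
  forall e, 0 < e -> U [set N | frob (u N - l) < e]%classic.

Section Rules.
Variables m n : nat.
Implicit Types (u v : nat -> 'M[C]_(m, n)) (l k : 'M[C]_(m, n)).

Lemma ultra_cvg_near u v l : ultra_cvg u l -> ultra_cvg (fun N => u N - v N) 0 ->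
  ultra_cvg v l.
Proof.
move=> ul uv e e0; have e2 : 0 < e / 2 by rewrite divr_gt0.
apply: filterS (filterI (ul _ e2) (uv _ e2)) => N [/= h1]; rewrite subr0 => h2.
have := frob_dist_trans (u N) (v N) l.
by have := frobC (u N) (v N); frob_lra.
Qed.

Lemma ultra_cvg_cst l : ultra_cvg (fun=> l) l.
Proof. by move=> e e0; apply: filterS filterT => N _ /=; rewrite subrr frob0. Qed.

Lemma ultra_cvgD u v l k : ultra_cvg u l -> ultra_cvg v k ->
  ultra_cvg (fun N => u N + v N) (l + k).
Proof.
move=> ul vk e e0; have e2 : 0 < e / 2 by rewrite divr_gt0.
apply: filterS (filterI (ul _ e2) (vk _ e2)) => N [/= h1 h2].
have := frob_triangle (u N - l) (v N - k).
have -> : u N + v N - (l + k) = (u N - l) + (v N - k) by rewrite opprD addrACA.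
by frob_lra.
Qed.

Lemma ultra_cvgN u l : ultra_cvg u l -> ultra_cvg (fun N => - u N) (- l).
Proof. by move=> ul e /ul; apply: filterS => N /=; rewrite -opprD frobN. Qed.

Lemma ultra_cvgB u v l k : ultra_cvg u l -> ultra_cvg v k ->
  ultra_cvg (fun N => u N - v N) (l - k).
Proof. by move=> ul /ultra_cvgN vk; exact: ultra_cvgD. Qed.

Lemma ultra_cvg_le u l (c : R) : ultra_cvg u l ->
  (forall e, 0 < e -> U [set N | frob (u N) <= c + e]%classic) -> frob l <= c.
Proof.
move=> ul uc; apply/ler_addgt0Pr => e e0.
have e2 : 0 < e / 2 by rewrite divr_gt0.
have [N [/= h1 h2]] := filter_ex (filterI (ul _ e2) (uc _ e2)).
have := frob_le_add l (u N); have := frobC l (u N); frob_lra.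
Qed.

Lemma ultra_cvg_ge u l (c : R) : ultra_cvg u l ->
  U [set N | c <= frob (u N)]%classic -> c <= frob l.
Proof.
move=> ul uc; apply/ler_addgt0Pr => e e0.
have [N [/= h1 h2]] := filter_ex (filterI (ul _ e0) uc).
by have := frob_le_add (u N) l; frob_lra.
Qed.

Lemma ultra_cvg_unique u l k : ultra_cvg u l -> ultra_cvg u k -> l = k.
Proof.
move=> ul uk; apply/eqP; rewrite -subr_eq0; apply/eqP/frob_eq0.
apply/eqP; rewrite eq_le frob_ge0 andbT.
apply: (ultra_cvg_le (ultra_cvgB ul uk)) => e e0.
by apply: filterS filterT => N _ /=; rewrite subrr frob0; frob_lra.
Qed.

Lemma ultra_limit u (c : R) : U [set N | frob (u N) <= c]%classic ->
  exists l, ultra_cvg u l.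
Proof.
move=> Uc.
have entry N i j := frob_entry (u N) i j.
have lim_re i j : exists l : R, forall e, 0 < e ->
    U [set N | `|complex.Re (u N i j) - l| < e]%classic.
  by apply: (@ultra_real_limit _ c); apply: filterS Uc => N; apply: le_trans (entry N i j).1.
have lim_im i j : exists l : R, forall e, 0 < e ->
    U [set N | `|complex.Im (u N i j) - l| < e]%classic.
  by apply: (@ultra_real_limit _ c); apply: filterS Uc => N; apply: le_trans (entry N i j).2.
pose lr i j := projT1 (cid (lim_re i j)); pose li i j := projT1 (cid (lim_im i j)).
exists (\matrix_(i, j) Complex (lr i j) (li i j)) => e e0.
pose c1 := e / (2 * (m * n).+1%:R).
have c10 : 0 < c1 by rewrite divr_gt0// mulr_gt0// ltr0n.
pose G := [set N | forall i j, `|complex.Re (u N i j) - lr i j| < c1 /\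
                               `|complex.Im (u N i j) - li i j| < c1]%classic.
have UG : U G.
  pose H (ij : 'I_m * 'I_n) := [set N | `|complex.Re (u N ij.1 ij.2) - lr ij.1 ij.2| < c1 /\
                 `|complex.Im (u N ij.1 ij.2) - li ij.1 ij.2| < c1]%classic.
  have UH ij : U (H ij).
    case: ij => i j; apply: filterI.
      exact: (projT2 (cid (lim_re i j)) _ c10).
    exact: (projT2 (cid (lim_im i j)) _ c10).
  have UHall : U [set N | forall ij, H ij N]%classic by apply: filter_forall.
  by apply: filterS UHall => N hN i j; exact: (hN (i, j)).
apply: filterS UG => N GN /=.
apply: le_lt_trans (frob_entries_le (c := 2 * c1) _ _) _; first by rewrite mulr_ge0// ltW.
  move=> i j; rewrite !mxE; have [] := GN i j.
  by case: (u N i j) => a b /=; lra.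
rewrite /c1 rescale ?pnatr_eq0//.
by rewrite gtr_pMr// ltr_pdivrMr ?ltr0n// mul1r ltr_nat.
Qed.

End Rules.

Lemma ultra_cvgM m n p (u : nat -> 'M[C]_(m, n)) (v : nat -> 'M[C]_(n, p)) l k :
  ultra_cvg u l -> ultra_cvg v k -> ultra_cvg (fun N => u N *m v N) (l *m k).
Proof.
move=> ul vk e e0; pose K := 1 + frob k + frob l.
have K1 : 1 <= K by rewrite /K -addrA lerDl addr_ge0// frob_ge0.
pose c := Num.min 1 (e / (2 * K)).
have K0 : 0 < K by apply: lt_le_trans K1.
have c0 : 0 < c by rewrite lt_min ltr01 divr_gt0// mulr_gt0.
have c1 : c <= 1 by rewrite /c ge_min lexx.
have cK : c * K < e.
  apply: le_lt_trans (_ : e / (2 * K) * K < _); first by rewrite ler_pM2r// ge_min lexx orbT.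
  by rewrite invfM mulrA divfK ?gt_eqF//; lra.
apply: filterS (filterI (ul _ c0) (vk _ c0)) => N [/= h1 h2].
have -> : u N *m v N - l *m k =
    ((u N - l) *m (v N - k) + (u N - l) *m k) + l *m (v N - k).
  by rewrite -mulmxDr subrK mulmxBl mulmxBr addrA subrK.
apply: le_lt_trans cK.
have t1 : frob (((u N - l) *m (v N - k) + (u N - l) *m k) + l *m (v N - k)) <=
  frob ((u N - l) *m (v N - k)) + frob ((u N - l) *m k) + frob (l *m (v N - k)).
  by apply: le_trans (frob_triangle _ _) _; rewrite lerD2r frob_triangle.
have m1 : frob ((u N - l) *m (v N - k)) <= frob (u N - l) * frob (v N - k) := frobM _ _.
have m2 : frob ((u N - l) *m k) <= frob (u N - l) * frob k := frobM _ _.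
have m3 : frob (l *m (v N - k)) <= frob l * frob (v N - k) := frobM _ _.
have g1 := frob_ge0 (u N - l); have g2 := frob_ge0 (v N - k).
have g3 := frob_ge0 k; have g4 := frob_ge0 l.
have q1 : frob (u N - l) * frob (v N - k) <= c * 1.
  exact: ler_pM g1 g2 (ltW h1) (le_trans (ltW h2) c1).
have q2 : frob (u N - l) * frob k <= c * frob k by rewrite ler_wpM2r// ltW.
have q3 : frob l * frob (v N - k) <= frob l * c by rewrite ler_wpM2l// ltW.
by rewrite /K; clear -t1 m1 m2 m3 q1 q2 q3; frob_lra.
Qed.

Lemma ultra_cvg_trmxC m n (u : nat -> 'M[C]_(m, n)) l :
  ultra_cvg u l -> ultra_cvg (fun N => (u N)^t*) (l^t*).
Proof. by move=> ul e /ul; apply: filterS => N /=; rewrite -trmxCB frob_trmxC. Qed.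

End Ultralimits.

(** * Unitary representations and fixed points of isometric actions *)

Section GroupMorphisms.
Variables (G H : groupType) (f : {multiplicative G -> H}).

Lemma morph_group1 : f 1%g = 1%g.
Proof. by apply: (mulgI (f 1%g)); rewrite -gmulfM !mulg1. Qed.

Lemma morph_groupV x : f x^-1%g = (f x)^-1%g.
Proof. by apply: (mulgI (f x)); rewrite -gmulfM !mulgV morph_group1. Qed.

End GroupMorphisms.

Section Representations.
Variables (R : realType) (Gamma : groupType).
Local Notation C := R[i].

Lemma representation_of_map n (rho : Gamma -> 'M[C]_n) :
  (forall g, rho g \is unitarymx) -> (forall g h, rho (g * h)%g = rho g *m rho h) ->
  exists pi : {multiplicative Gamma -> 'U[R]_n}, forall g, \val (pi g) = rho g.
Proof.
move=> rhoU rhoM; pose f g := Unitary (rhoU g).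
have fM : {morph f : x y / (x * y)%g} by move=> x y; apply/val_inj/rhoM.
pose M := isMultiplicative.Build Gamma 'U[R]_n f fM.
by exists (HB.pack_for {multiplicative Gamma -> 'U[R]_n} f M).
Qed.

Section Fixed.
Variables (n : nat) (pi : {multiplicative Gamma -> 'U[R]_n}).

Lemma repM g h : \val (pi (g * h)%g) = \val (pi g) *m \val (pi h) :> 'M[C]_n.
Proof. by rewrite gmulfM. Qed.

Lemma repU g : \val (pi g) \is unitarymx.
Proof. exact: unitaryP. Qed.

Lemma rep1 : \val (pi 1%g) = 1%:M :> 'M[C]_n.
Proof. by rewrite morph_group1. Qed.

Lemma repV g : \val (pi g^-1%g) = (\val (pi g))^t* :> 'M[C]_n.
Proof. by rewrite morph_groupV. Qed.

End Fixed.

Lemma midpoint m n (A B D : 'M[C]_(m, n)) :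
  mxdot (D - (2^-1)%:C%C *: (A + B)) (D - (2^-1)%:C%C *: (A + B)) =
  2^-1 * mxdot (D - A) (D - A) + 2^-1 * mxdot (D - B) (D - B)
   - 4^-1 * mxdot (A - B) (A - B).
Proof.
rewrite !(mxdotDl, mxdotDr, mxdotNl, mxdotNr, mxdotZl, mxdotZr).
rewrite (mxdotC A D) (mxdotC B D) (mxdotC B A).
move: (mxdot D D) (mxdot D A) (mxdot D B) (mxdot A A) (mxdot A B) (mxdot B B).
by clear => a b c d e f; field.
Qed.

(** The fixed point is the centre of the smallest ball containing the orbit of J:
the action permutes the balls containing the orbit and the smallest one is unique by
the parallelogram identity. *)
Lemma isometric_action_fixed_point m n (act : Gamma -> 'M[C]_(m, n) -> 'M[C]_(m, n))
    (J : 'M[C]_(m, n)) (r : R) :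
  (forall g h X, act (g * h)%g X = act g (act h X)) ->
  (forall g X Y, frob (act g X - act g Y) = frob (X - Y)) ->
  (forall X, act 1%g X = X) ->
  (forall g, frob (act g J - J) <= r) ->
  exists2 X, (forall g, act g X = X) & frob (J - X) <= r.
Proof.
move=> actM actI act1 Jr.
pose D : set R := [set t | exists Y, forall g, frob (act g J - Y) <= t]%classic.
have Dr : D r by exists J.
have D0 t : D t -> 0 <= t by move=> [Y /(_ 1%g)]; apply: le_trans; rewrite frob_ge0.
have infD : has_inf D by split; [exists r|exists 0 => t /D0].
pose t0 := inf D.
have t0r : t0 <= r by apply: ge_inf => //; exact: infD.2.
have t00 : 0 <= t0 by apply: lb_le_inf; [exists r|move=> t /D0].
have approx N : exists Y, forall g, frob (act g J - Y) <= t0 + N.+1%:R^-1.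
  have [|t [Y Yt] tN] := @inf_adherent _ D (N.+1%:R^-1) _ infD; first by rewrite invr_gt0 ltr0n.
  by exists Y => g; apply: le_trans (ltW tN).
pose Y N := projT1 (cid (approx N)).
have YP N g : frob (act g J - Y N) <= t0 + N.+1%:R^-1 by exact: (projT2 (cid (approx N)) g).
have [U [Uu Uinf]] := exists_free_ultrafilter.
have invU e : 0 < e -> U [set N | N.+1%:R^-1 <= e :> R]%classic.
  move=> e0; pose M := (Num.bound e^-1).
  apply: filterS (Uinf M) => N /= MN.
  rewrite -[e]invrK lef_pV2 ?posrE ?invr_gt0 ?ltr0n//.
  apply: le_trans (ltW (archi_boundP _)) _; first by rewrite invr_ge0 ltW.
  by rewrite ler_nat -/M leqW.
have [Z YZ] : exists Z, ultra_cvg U Y Z.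
  apply: (@ultra_limit _ _ _ _ _ _ (frob J + (t0 + 1))).
  apply: filterS filterT => N _ /=.
  have h := YP N 1%g; rewrite act1 in h.
  have h4 : N.+1%:R^-1 <= 1 :> R by rewrite invf_le1 ?ltr0n ?ler1n.
  apply: le_trans (frob_le_add (Y N) J) _; rewrite lerD2l frobC.
  by apply: le_trans h _; rewrite lerD2l.
have ZP g : frob (act g J - Z) <= t0.
  apply: (ultra_cvg_le (ultra_cvgB (ultra_cvg_cst (act g J)) YZ)) => e e0.
  apply: filterS (invU e e0) => N /= h; apply: le_trans (YP N g) _.
  by rewrite lerD2l.
have unique Z' : (forall g, frob (act g J - Z') <= t0) -> Z' = Z.
  move=> Z'P; apply/eqP; rewrite -subr_eq0; apply/eqP; apply: contrapT => /eqP ZZ.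
  pose q := mxdot (Z' - Z) (Z' - Z).
  have q0 : 0 < q.
    rewrite lt_neqAle mxdot_ge0 andbT eq_sym; apply/negP => /eqP/mxdot_eq0/eqP.
    by rewrite (negPf ZZ).
  have mid g : mxdot (act g J - (2^-1)%:C%C *: (Z' + Z)) (act g J - (2^-1)%:C%C *: (Z' + Z))
       <= t0 ^+ 2 - 4^-1 * q.
    have h1 : mxdot (act g J - Z) (act g J - Z) <= t0 ^+ 2 := mxdot_frob_le (ZP g).
    have h2 : mxdot (act g J - Z') (act g J - Z') <= t0 ^+ 2 := mxdot_frob_le (Z'P g).
    by rewrite midpoint -/q; clear -h1 h2; frob_lra.
  have s0 : 0 <= t0 ^+ 2 - 4^-1 * q by apply: le_trans (mid 1%g); rewrite mxdot_ge0.
  have : D (Num.sqrt (t0 ^+ 2 - 4^-1 * q)).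
    exists ((2^-1)%:C%C *: (Z' + Z)) => g.
    by apply: frob_le; rewrite ?sqrtr_ge0// sqr_sqrtr.
  move=> /(ge_inf infD.2); rewrite -/t0 -ler_sqr ?nnegrE ?sqrtr_ge0// sqr_sqrtr//.
  by rewrite lerBrDr gerDl pmulr_rle0 ?invr_gt0// leNgt q0.
exists Z; last by have := ZP 1%g; rewrite act1 => /le_trans; apply.
move=> h; apply: unique => g.
have -> : g = (h * (h^-1 * g))%g by rewrite mulgA mulgV mul1g.
by rewrite actM actI.
Qed.

End Representations.

(** * Compressing a representation by one dimension *)

Section Compression.
Variable R : realType.
Local Notation C := R[i].

Lemma row_mul_trmxC n (u v : 'rV[C]_n) : v *m u^t* = ((u *m v^t*) 0 0)^*%:M.
Proof. by rewrite -[LHS]trmxCK trmxC_mul trmxCK {1}[u *m _]mx11_scalar tr_scalar_mx map_scalar_mx. Qed.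

(** A complex reflection: T is the identity plus a rank one matrix, and maps the
unit vector w to the unit vector e. *)
Lemma reflection_unit_vectors n (w e : 'rV[C]_n) : w \is unitarymx -> e \is unitarymx ->
  exists T : 'M[C]_n, [/\ T \is unitarymx, w *m T = e & frob (T - 1%:M) <= 2].
Proof.
move=> wu eu; have [->|we] := eqVneq w e.
  exists 1%:M; split; first by apply/unitarymxP; rewrite mul1mx trmxC1.
    by rewrite mulmx1.
  by rewrite subrr frob0.
have [|v vu vE] := @normalize_row _ _ (w - e); first by rewrite subr_eq0.
set t := (frob (w - e))%:C%C in vE.
have t0 : t != 0.
  rewrite eq_complex /= eqxx andbT; apply: contra we => /eqP/frob_eq0/eqP.
  by rewrite subr_eq0.
have tc : t^* = t by exact: conj_real.
clearbody t.
pose k := (w *m v^t*) 0 0.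
have wv : w *m v^t* = k%:M by rewrite [LHS]mx11_scalar.
have vw : v *m w^t* = (k^*)%:M by rewrite row_mul_trmxC.
have eE : e = w - t *: v by rewrite -vE opprB addrC subrK.
have kt : k + k^* = t.
  have := unitarymxP eu.
  rewrite {1 2}eE trmxCB trmxCZ tc mulmxBl !mulmxBr -!scalemxAl -!scalemxAr.
  rewrite (unitarymxP wu) (unitarymxP vu) wv vw => /matrixP/(_ 0 0).
  rewrite !mxE eqxx !mulr1n mulr1 => h.
  apply: (mulfI t0); apply/eqP; rewrite -subr_eq0 mulrDr; apply/eqP.
  by move: h; move: (1 : C) (k^*) => o k'; clear; move=> h; rewrite -(subrr o) -{2}h; ring.
have k0 : k != 0.
  by apply: contraNneq t0 => k0; rewrite -kt k0 rmorph0 addr0.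
have kc0 : k^* != 0 by rewrite conjC_eq0.
pose y := - (t / k); pose q := v^t* *m v.
have qq : q *m q = q by rewrite /q mulmxA mulmxtVK.
have qC : q^t* = q by rewrite /q trmxC_mul trmxCK.
have yy : y + y^* + y * y^* = 0.
  have -> : y^* = - (t / k^*) by rewrite /y rmorphN rmorphM /= fmorphV /= tc.
  by rewrite /y -kt; move: (k) (k^*) k0 kc0; clear => a b a0 b0; field; rewrite a0 b0.
have Tu : 1%:M + y *: q \is unitarymx.
  apply/unitarymxP; rewrite trmxCD trmxC1 trmxCZ qC mulmxDl !mulmxDr !mul1mx mulmx1.
  rewrite -scalemxAl -scalemxAr qq scalerA -addrA -!scalerDl.
  by rewrite addrA [_^* + _]addrC yy scale0r addr0.
exists (1%:M + y *: q); split => //.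
  rewrite mulmxDr mulmx1 -scalemxAr /q mulmxA wv mul_scalar_mx scalerA /y mulNr divfK//.
  by rewrite scaleNr eE.
have -> : 1%:M + y *: q - 1%:M = (1%:M + y *: q) *m q - q.
  by rewrite mulmxDl mul1mx -scalemxAl qq addrAC subrr add0r [in RHS]addrAC subrr add0r.
apply: le_trans (frob_triangleB _ _) _.
have fq : frob q = 1 by rewrite frob_isomr// frob_trmxC frob_unitary// sqrtr1.
by rewrite (frob_unitl q Tu) fq.
Qed.

End Compression.
Section StableReducible.
Variables (R : realType) (Gamma : groupType).
Local Notation C := R[i].

(** A representation of dimension p + 1 compressed to p dimensions.  Multiplying pi g by
a reflection makes it fix the last basis vector; the defect of phi is a sum of three
operators of rank one, so it does not grow with p. *)
Lemma compressed_representation p (pi : {multiplicative Gamma -> 'U[R]_(p + 1)})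
    (J := row_mx 1%:M 0 : 'M[C]_(p, p + 1)) :
  exists phi : Gamma -> 'U[R]_p,
    (forall g h, frob (\val (phi g * phi h)%g - \val (phi (g * h)%g)) <= 6) /\
    (forall g, frob (J *m \val (pi g) - \val (phi g) *m J) <= 2).
Proof.
pose e := row_mx 0 1%:M : 'M[C]_(1, p + 1).
have JC : J^t* = col_mx 1%:M 0 by rewrite tr_row_mx map_col_mx trmxC1 trmxC0.
have eC : e^t* = col_mx 0 1%:M by rewrite tr_row_mx map_col_mx trmxC1 trmxC0.
have JJ : J *m J^t* = 1%:M by rewrite JC mul_row_col mulmx1 mulmx0 addr0.
have Ju : J \is unitarymx by apply/unitarymxP.
have eu : e \is unitarymx.
  by apply/unitarymxP; rewrite eC mul_row_col mulmx1 mul0mx add0r.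
have Je : J *m e^t* = 0 by rewrite eC mul_row_col mulmx0 mul0mx addr0.
have JtJ : J^t* *m J = 1%:M - e^t* *m e.
  rewrite JC eC !mul_col_row !(mulmx1, mul1mx, mul0mx, mulmx0).
  rewrite scalar_mx_block opp_block_mx add_block_mx.
  by rewrite !oppr0 !addr0 subrr.
clearbody J e.
have cJ : contraction J by exact: contraction_unitary.
have cJt := contraction_trmxC cJ.
have reflect g : exists T : 'M[C]_(p + 1), [/\ T \is unitarymx,
    e *m \val (pi g) *m T = e & frob (T - 1%:M) <= 2].
  exact: reflection_unit_vectors (mul_unitarymx eu (repU pi g)) eu.
pose T g := projT1 (cid (reflect g)).
have Tu g : T g \is unitarymx by have [] := projT2 (cid (reflect g)).
have Te g : e *m \val (pi g) *m T g = e by have [] := projT2 (cid (reflect g)).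
have T2 g : frob (T g - 1%:M) <= 2 by have [] := projT2 (cid (reflect g)).
clearbody T.
pose G g := \val (pi g) *m T g.
have Gu g : G g \is unitarymx := mul_unitarymx (repU pi g) (Tu g).
have eG g : e *m G g = e by rewrite mulmxA.
have GE g : G g = \val (pi g) *m T g by [].
clearbody G.
have Ge g : G g *m e^t* = e^t*.
  by rewrite -{1}(eG g) trmxC_mul mulmxA (unitarymxP (Gu g)) mul1mx.
have JG g : J *m G g *m J^t* *m J = J *m G g.
  have JGe : J *m G g *m e^t* = 0 by rewrite -mulmxA Ge Je.
  rewrite -[LHS]mulmxA JtJ mulmxBr mulmx1 [X in _ - X]mulmxA.
  by rewrite [X in X *m e]JGe mul0mx subr0.
have phiU g : J *m G g *m J^t* \is unitarymx.
  apply/unitarymxP; rewrite !trmxC_mul trmxCK !mulmxA JG.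
  by rewrite -[J *m G g *m _]mulmxA (unitarymxP (Gu g)) mulmx1.
exists (fun g => Unitary (phiU g)); split => [g h|g] /=; last first.
  rewrite JG -mulmxBr; apply: le_trans (contraction_frob_mull _ cJ) _.
  have -> : \val (pi g) - G g = \val (pi g) *m (1%:M - T g) by rewrite mulmxBr mulmx1 GE.
  rewrite frob_unitl ?repU//.
  by rewrite frobC.
rewrite !mulmxA JG -mulmxBl -[J *m G g *m _]mulmxA -mulmxBr.
apply: le_trans (cJt _ _) _; apply: le_trans (contraction_frob_mull _ cJ) _.
rewrite !GE repM; have Pg := repU pi g; have Ph := repU pi h.
move: (\val (pi g)) (\val (pi h)) Pg Ph => A B Au Bu.
have -> : A *m T g *m (B *m T h) - A *m B *m T (g * h)%g =
  (A *m ((T g - 1%:M) *m (B *m T h)) + A *m (B *m (T h - 1%:M))) +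
   A *m (B *m (1%:M - T (g * h)%g)).
  by rewrite !(mulmxBr, mulmxBl, mul1mx, mulmx1) !mulmxA !addrA !subrK.
apply: le_trans (_ : 2 + 2 + 2 <= _); last by rewrite -!natrD.
apply: le_trans (frob_triangle _ _) (lerD _ _).
  apply: le_trans (frob_triangle _ _) (lerD _ _).
    by rewrite (frob_unitl _ Au) mulmxA (frob_isomr _ (Tu h)) (frob_isomr _ Bu).
  by rewrite (frob_unitl _ Au) (frob_unitl _ Bu).
by rewrite (frob_unitl _ Au) (frob_unitl _ Bu) frobC.
Qed.

(** Let rho be a representation near the compression of pi to p dimensions.  The
inclusion J almost intertwines rho and pi, with an error below its norm, the square root
of p, hence there is a nonzero intertwiner.  Having only p rows, its row space is an
invariant subspace of dimension at most p. *)
Lemma stable_intertwiner : uniformly_HS_stable R Gamma ->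
  exists d : nat, forall p, (d <= p)%N ->
    forall pi : {multiplicative Gamma -> 'U[R]_(p + 1)},
    exists2 X : 'M[C]_(p, p + 1), X != 0 & forall g, stablemx X (\val (pi g)).
Proof.
move=> /(_ 2^-1); rewrite invr_gt0 ltr0n => /(_ isT) [eps eps0 stab].
(* The error 2 + sqrt p / 2 has to be smaller than sqrt p, whence the bound 17. *)
pose d := maxn 17 (Num.bound ((6 / eps) ^+ 2)).+1.
exists d => p dp pi.
have p17 : (17 <= p)%N by apply: leq_trans dp; rewrite leq_maxl.
have p0 : (0 < p)%N by apply: leq_trans p17.
have sp4 : 4 < Num.sqrt p%:R :> R.
  rewrite -ltr_sqr ?nnegrE ?sqrtr_ge0// sqr_sqrtr// -natrX ltr_nat.
  by apply: leq_trans p17.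
have speps : 6 < eps * Num.sqrt p%:R.
  rewrite -ltr_pdivrMl// mulrC -ltr_sqr ?nnegrE ?sqrtr_ge0 ?divr_ge0 ?(ltW eps0)//.
  rewrite sqr_sqrtr//; apply: lt_le_trans (archi_boundP _) _; first exact: sqr_ge0.
  by rewrite ler_nat ltnW// (leq_trans _ dp)// leq_maxr.
have [phi [phiM phipi]] := compressed_representation pi.
have [|rho rhophi] := stab p p0 phi.
  by move=> g h; rewrite HSdist_lt//; apply: le_lt_trans speps; exact: phiM.
move: phipi; set J := row_mx 1%:M 0 => phipi.
have Ju : J \is unitarymx.
  apply/unitarymxP; rewrite tr_row_mx map_col_mx trmxC1 trmxC0 mul_row_col.
  by rewrite mulmx1 mulmx0 addr0.
clearbody J.
have piCu g : (\val (pi g))^t* \is unitarymx by rewrite trmxC_unitary repU.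
pose act g X := \val (rho g) *m X *m (\val (pi g))^t* : 'M[C]_(p, p + 1).
have [||||X Xfix XJ] := @isometric_action_fixed_point R Gamma _ _ act J (2 + 2^-1 * Num.sqrt p%:R).
- by move=> g h X; rewrite /act !repM trmxC_mul !mulmxA.
- move=> g X Y; by rewrite /act -mulmxBl -mulmxBr (frob_isomr _ (piCu g)) (frob_unitl _ (repU rho g)).
- by move=> X; rewrite /act !rep1 trmxC1 mulmx1 mul1mx.
- move=> g; have -> : frob (act g J - J) = frob (\val (rho g) *m J - J *m \val (pi g)).
    by rewrite -{2}(mulmxtVK J (repU pi g)) /act -mulmxBl (frob_isomr _ (piCu g)).
  have -> : \val (rho g) *m J - J *m \val (pi g) =
     (\val (phi g) *m J - J *m \val (pi g)) + (\val (rho g) - \val (phi g)) *m J.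
    by rewrite mulmxBl [RHS]addrC addrA subrK.
  apply: le_trans (frob_triangle _ _) (lerD _ _); first by rewrite frobC.
  by rewrite frob_isomr// frobC ltW// -HSdist_lt.
exists X.
  apply/negP => /eqP X0; move: XJ; rewrite X0 subr0 frob_unitary// => h.
  by clear -h sp4; lra.
move=> g; have := Xfix g; rewrite /act => /(congr1 (mulmx^~ (\val (pi g)))).
rewrite -[_ *m _ *m _ in LHS]mulmxA (unitarymxPr (repU pi g)) mulmx1 => XE.
by rewrite -XE submxMl.
Qed.

End StableReducible.

(** * Subgroups of finite index *)

Section Subgroups.
Variable Gamma : groupType.
Local Open Scope classical_set_scope.
Implicit Types (H : set Gamma) (S : set Gamma).

Lemma subgroupP H :
  subgroup H <-> H 1%g /\ forall x y, H x -> H y -> H (x * y^-1)%g.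
Proof.
rewrite /subgroup /group_closed /divg_closed; split => -[H1 HM].
  by split=> [|x y Hx Hy]; [rewrite -inE|rewrite -inE; apply: HM; rewrite inE].
split=> [|x y]; first by rewrite inE.
by rewrite !inE; exact: HM.
Qed.

Lemma subgroupV H x : subgroup H -> H x -> H x^-1%g.
Proof. by move=> /subgroupP[H1 HV] Hx; rewrite -[x^-1%g]mul1g; exact: HV. Qed.

Lemma subgroupM H x y : subgroup H -> H x -> H y -> H (x * y)%g.
Proof.
move=> sH Hx Hy; have [_ HV] := (subgroupP H).1 sH.
by rewrite -[y]invgK; apply: HV => //; exact: subgroupV.
Qed.

Lemma smallest_subgroup S : subgroup (smallest (@subgroup Gamma) S).
Proof.
apply/subgroupP; split=> [|x y Hx Hy] A [/= Agrp SA]; have [A1 AV] := (subgroupP A).1 Agrp => //.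
by apply: AV; [exact: Hx|exact: Hy].
Qed.

Lemma left_cosetP H x y : subgroup H -> left_coset H x = left_coset H y -> H (x^-1 * y)%g.
Proof.
move=> sH xy; have [H1 _] := (subgroupP H).1 sH.
have : left_coset H y y by exists 1%g => //; rewrite mulg1.
by rewrite -xy => -[h Hh <-]; rewrite mulgA mulVg mul1g.
Qed.

Lemma left_coset_eq H x y : subgroup H -> H (x^-1 * y)%g -> left_coset H x = left_coset H y.
Proof.
move=> sH Hxy; apply/seteqP; split=> _ [h Hh <-].
  exists ((x^-1 * y)^-1 * h)%g; first by apply: subgroupM => //; exact: subgroupV.
  by rewrite invgM invgK !mulgA mulgV mul1g.
exists (x^-1 * y * h)%g; first exact: subgroupM.
by rewrite !mulgA mulgV mul1g.
Qed.

Lemma finite_index_of_label (L : finType) (lab : Gamma -> L) H :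
  (forall x y, lab x = lab y -> left_coset H x = left_coset H y) -> finite_index H.
Proof.
move=> labH.
apply: (@sub_finite_set _ _ ((fun l => left_coset H (xget 1%g [set x | lab x = l])) @` [set: L])).
  move=> _ [x _ <-]; exists (lab x) => //; apply: labH.
  by have := @xgetPex _ 1%g [set y | lab y = lab x]; apply; exists x.
by apply: finite_image; exact: finite_finset.
Qed.

(** A finitely generated group has only finitely many actions on a given finite type,
an action being determined by the generators; the common kernel of these actions is
the subgroup below. *)
Lemma finite_index_in_bounded_index (L : finType) : finitely_generated Gamma ->
  exists2 G0 : set Gamma, subgroup G0 /\ finite_index G0 &
    forall (H : set Gamma) (lab : Gamma -> L), subgroup H ->
      (forall x y, lab x = lab y <-> H (x^-1 * y)%g) -> G0 `<=` H.
Proof.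
move=> [S finS genS].
have [s sE] := (finite_seqP S).1 finS.
(* An action on L is recorded as a function into {ffun L -> L}, so that the values on the
   generators form an element of a finite type. *)
pose action (f : Gamma -> {ffun L -> L}) :=
  (forall l, f 1%g l = l) /\ (forall x y l, f (x * y)%g l = f x (f y l)).
pose code (f : Gamma -> {ffun L -> L}) : {ffun 'I_(size s) -> {ffun L -> L}} :=
  [ffun i => f (tnth (in_tuple s) i)].
have code_inj f f' : action f -> action f' -> code f = code f' -> f =1 f'.
  move=> [f1 fM] [f'1 f'M] ff'.
  suff: smallest (@subgroup Gamma) S `<=` [set x | f x = f' x].
    by rewrite genS => h x; exact: h.
  apply: smallest_sub.
    apply/subgroupP; split=> [|x y fx fy]; first by apply/ffunP => l; rewrite f1 f'1.
    apply/ffunP => l; rewrite fM f'M fx; congr (_ _).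
    have -> : l = f y (f y^-1%g l) by rewrite -fM mulgV f1.
    by rewrite -fM mulVg f1 fy -f'M mulVg f'1.
  move=> x Sx; have xs : x \in s by rewrite sE in Sx.
  have /tnthP[i xi] : x \in in_tuple s by [].
  by have /ffunP/(_ i) := ff'; rewrite !ffunE -xi.
pose G0 := [set x | forall f, action f -> forall l, f x l = l].
have sG0 : subgroup G0.
  apply/subgroupP; split=> [f [f1 _] //|x y G0x G0y f fa l]; have [f1 fM] := fa.
  by rewrite fM -(G0y f fa (f y^-1%g l)) -(fM y) mulgV f1 G0x.
exists G0.
  split => //.
  pose act c := xget (fun _ => [ffun l => l]) [set f | action f /\ code f = c].
  pose lab x := [ffun c => act c x].
  apply: (@finite_index_of_label _ lab) => x y xy; apply: left_coset_eq => // f fa l.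
  have fxy : f x = f y.
    have [aa ac] := @xgetPex _ (fun _ => [ffun l => l]) [set f' | action f' /\ code f' = code f]
      (ex_intro _ f (conj fa erefl)).
    rewrite -!(code_inj _ _ aa fa ac).
    by have /ffunP/(_ (code f)) := xy; rewrite !ffunE.
  by have [f1 fM] := fa; rewrite fM -fxy -fM mulVg f1.
move=> H lab sH labH g G0g.
pose rep l := xget 1%g [set x | lab x = l].
have repP x : lab (rep (lab x)) = lab x by apply: (@xgetPex _ 1%g [set y | lab y = lab x]); exists x.
(* The action of Gamma on the cosets of H, transported to their labels and extended by the
   identity to the remaining elements of L. *)
pose f g : {ffun L -> L} := [ffun l => if `[< exists x, lab x = l >] then lab (g * rep l)%g else l].
have fE h x : f h (lab x) = lab (h * x)%g.
  rewrite ffunE asboolT; last by exists x.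
  apply/labH; rewrite invgM -mulgA [(h^-1 * _)%g]mulgA mulVg mul1g.
  by apply/labH; rewrite repP.
have fa : action f.
  split=> [l|x y l]; have [[z <-]|nl] := pselect (exists x, lab x = l).
  - by rewrite fE mul1g.
  - by rewrite ffunE asboolF.
  - by rewrite !fE mulgA.
  - by rewrite !ffunE asboolF// asboolF.
have := G0g f fa (lab 1%g); rewrite fE mulg1 => /esym/labH.
by rewrite invg1 mul1g.
Qed.

End Subgroups.

Lemma exists_minimum_of_finite_quotient (R : realType) (T : Type) (Q : finType)
    (f : T -> Q) (F : T -> R) (P : T -> Prop) :
  (forall x y, f x = f y -> F x = F y) -> (exists x, P x) ->
  exists2 x, P x & forall y, P y -> F x <= F y.
Proof.
move=> fF [x0 Px0].
pose W q := exists x, f x = q /\ P x.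
have x00 : W (f x0) by exists x0.
pose pt q := if pselect (W q) is left w then projT1 (cid w) else x0.
have ptP q : W q -> f (pt q) = q /\ P (pt q).
  by rewrite /pt; case: pselect => // w _; exact: (projT2 (cid w)).
pose G q := F (pt q).
have [q /asboolP/ptP[fq Pq] qmin] :=
  @arg_minP _ _ _ (f x0) [pred q | `[< W q >]] G (introT (asboolP _) x00).
exists (pt q) => // y Py; have Wy : W (f y) by exists y.
have := qmin (f y) (introT (asboolP _) Wy); rewrite /G => /le_trans; apply.
by rewrite (fF _ y)//; have [] := ptP _ Wy.
Qed.

(** * Subrepresentations *)

Section Subrepresentations.
Variables (R : realType) (Gamma : groupType).
Local Notation C := R[i].

Lemma submx_isometry m r n (A : 'M[C]_(m, n)) (E : 'M[C]_(r, n)) :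
  E \is unitarymx -> (A <= E)%MS -> A *m E^t* *m E = A.
Proof. by move=> Eu /submxP[Y ->]; rewrite mulmxtVK. Qed.

Lemma orthonormal_basis k n (V : 'M[C]_(k, n)) :
  exists2 E : 'M[C]_(\rank V, n), E \is unitarymx & (E :=: V)%MS.
Proof.
exists (schmidt (row_base V)); first by rewrite schmidt_unitarymx// rank_leq_col.
by apply: eqmx_trans (eqmx_schmidt_free (row_base_free V)) (eq_row_base V).
Qed.

Lemma orthonormal_splitting k n (V : 'M[C]_(k, n)) :
  exists (r : nat) (E : 'M[C]_(\rank V, n)) (E' : 'M[C]_(r, n)),
  [/\ (\rank V + r)%N = n, E \is unitarymx, E' \is unitarymx, (E :=: V)%MS &
      E^t* *m E + E'^t* *m E' = 1%:M /\ E *m E'^t* = 0].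
Proof.
have [E Eu EV] := orthonormal_basis V.
have [E' E'u E'V] := orthonormal_basis (kermx (V^t*)).
have VE' : E' *m V^t* = 0.
  by apply/sub_kermxP; rewrite E'V submx_refl.
have E'E : E' *m E^t* = 0.
  have /submxP[Y EY] : (E <= V)%MS by rewrite EV submx_refl.
  by rewrite EY trmxC_mul mulmxA VE' mul0mx.
have EE' : E *m E'^t* = 0 by rewrite -[LHS]trmxCK trmxC_mul trmxCK E'E trmxC0.
have rkV : \rank (V^t*) = \rank V by rewrite mxrank_map mxrank_tr.
have dimE : (\rank V + \rank (kermx (V^t*)))%N = n.
  by rewrite mxrank_ker rkV subnKC// rank_leq_col.
exists (\rank (kermx (V^t*))), E, E'; split => //; split => //.
have Uu : col_mx E E' \is unitarymx by exact: unitarymx_col.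
have := @mulmxKtV _ _ _ _ 1%:M (col_mx E E') Uu dimE.
by rewrite mul1mx tr_col_mx map_row_mx mul_row_col.
Qed.

Lemma restricted_representation n r (pi : {multiplicative Gamma -> 'U[R]_n})
    (E : 'M[C]_(r, n)) : E \is unitarymx -> (forall g, stablemx E (\val (pi g))) ->
  exists rho : {multiplicative Gamma -> 'U[R]_r},
    forall g, \val (rho g) = E *m \val (pi g) *m E^t*.
Proof.
move=> Eu Est; apply: representation_of_map => [g|g h].
  apply/unitarymxP; rewrite !trmxC_mul trmxCK !mulmxA submx_isometry ?Est//.
  by rewrite (mulmxtVK _ (repU pi g)) (unitarymxP Eu).
rewrite repM !mulmxA [X in _ = X *m _ *m _](submx_isometry Eu (Est g)).
by [].
Qed.

Lemma orthogonal_stable n r r' (pi : {multiplicative Gamma -> 'U[R]_n})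
    (E : 'M[C]_(r, n)) (E' : 'M[C]_(r', n)) : E \is unitarymx ->
    E^t* *m E + E'^t* *m E' = 1%:M -> E *m E'^t* = 0 ->
  (forall g, stablemx E (\val (pi g))) -> forall g, stablemx E' (\val (pi g)).
Proof.
move=> Eu EE1 EE' Est g.
have E'pE : E' *m \val (pi g) *m E^t* = 0.
  have := submx_isometry Eu (Est g^-1%g); rewrite repV => /(congr1 (mulmx^~ (E'^t*))).
  rewrite /= -[LHS]mulmxA EE' mulmx0 => /esym h.
  have -> : E' *m \val (pi g) *m E^t* = (E *m (\val (pi g))^t* *m E'^t*)^t*.
    by rewrite !trmxC_mul !trmxCK mulmxA.
  by rewrite h trmxC0.
rewrite -[_ *m \val _]mulmx1 -EE1 mulmxDr !mulmxA E'pE mul0mx add0r.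
exact: submxMl.
Qed.

Lemma split_representation n k (pi : {multiplicative Gamma -> 'U[R]_n}) (V : 'M[C]_(k, n)) :
  (forall g, stablemx V (\val (pi g))) ->
  exists (r : nat) (rho : {multiplicative Gamma -> 'U[R]_(\rank V)})
     (rho' : {multiplicative Gamma -> 'U[R]_r}), (\rank V + r)%N = n /\
   forall g, (\val (pi g) == 1%:M) = (\val (rho g) == 1%:M) && (\val (rho' g) == 1%:M).
Proof.
move=> Vst; have [r [E [E' [dimE Eu E'u EV [EE1 EE']]]]] := orthonormal_splitting V.
have Est g : stablemx E (\val (pi g)).
  by rewrite (eqmxMr _ EV) (submx_trans (Vst g))// EV submx_refl.
have E'st := orthogonal_stable Eu EE1 EE' Est.
have [rho rhoE] := restricted_representation Eu Est.
have [rho' rho'E] := restricted_representation E'u E'st.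
exists r, rho, rho'; split => // g; apply/idP/andP => [/eqP p1|[/eqP r1 /eqP r'1]].
  by rewrite rhoE rho'E p1 !mulmx1 (unitarymxP Eu) (unitarymxP E'u).
apply/eqP; rewrite -[LHS]mul1mx -EE1 mulmxDl -!mulmxA.
rewrite -[E *m _](submx_isometry Eu (Est g)) -rhoE r1 mul1mx.
by rewrite -[E' *m _](submx_isometry E'u (E'st g)) -rho'E r'1 mul1mx.
Qed.

(** If every representation of large dimension is reducible, a smallest representation
not killing x has small dimension. *)
Lemma small_representation_detects (d : nat) (K : Gamma -> Prop) (x : Gamma) :
  (forall p, (d <= p)%N -> forall pi : {multiplicative Gamma -> 'U[R]_(p + 1)},
    exists2 X : 'M[C]_(p, p + 1), X != 0 & forall g, stablemx X (\val (pi g))) ->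
  forall n (pi : {multiplicative Gamma -> 'U[R]_n}),
    (forall g, K g -> \val (pi g) = 1%:M) -> \val (pi x) != 1%:M ->
  exists n' (pi' : {multiplicative Gamma -> 'U[R]_n'}),
    [/\ (n' <= d)%N, forall g, K g -> \val (pi' g) = 1%:M & \val (pi' x) != 1%:M].
Proof.
move=> red n; have [m] := ubnP n; elim: m n => // m IH n nm pi Kpi pix.
have [nd|] := leqP n d; first by exists n, pi.
case: n nm pi Kpi pix => [|p] //; rewrite -[p.+1]addn1 => pm pi Kpi pix; rewrite addn1 ltnS => dp.
have [X X0 Xst] := red p dp pi.
have [r [rho [rho' [dimE split1]]]] := split_representation Xst.
have rX : (0 < \rank X)%N by rewrite lt0n mxrank_eq0.
have rXp : (\rank X <= p)%N by exact: rank_leq_row.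
move: pix; rewrite split1 negb_and => /orP[px|px].
  apply: (IH _ _ rho) => // [|g Kg]; first by lia.
  by apply/eqP; have := split1 g; rewrite Kpi// eqxx => /esym/andP[].
apply: (IH _ _ rho') => // [|g Kg]; first by lia.
by apply/eqP; have := split1 g; rewrite Kpi// eqxx => /esym/andP[].
Qed.

Lemma regular_representation (Q : finGroupType) (f : {multiplicative Gamma -> Q}) :
  exists n (pi : {multiplicative Gamma -> 'U[R]_n}),
    (forall g, f g = 1%g -> \val (pi g) = 1%:M) /\
    (forall g, \val (pi g) = 1%:M -> f g = 1%g).
Proof.
pose M (q : Q) : 'M[C]_#|Q| := \matrix_(i, j) (enum_val j == enum_val i * q)%g%:R.
have sel (F : 'I_#|Q| -> C) (a : Q) : \sum_j (enum_val j == a)%:R * F j = F (enum_rank a).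
  rewrite (bigD1 (enum_rank a))//= enum_rankK eqxx mul1r big1 ?addr0// => j ja.
  case: eqP => [ea|_]; last by rewrite mul0r.
  by rewrite -ea enum_valK eqxx in ja.
have MM q r : M q *m M r = M (q * r)%g.
  apply/matrixP => i j; rewrite !mxE.
  under eq_bigr do rewrite !mxE.
  by rewrite (sel (fun k => (enum_val j == enum_val k * r)%g%:R)) enum_rankK mulgA.
have M1 : M 1%g = 1%:M.
  by apply/matrixP => i j; rewrite !mxE mulg1 (inj_eq enum_val_inj) eq_sym.
have MC q : (M q)^t* = M q^-1%g.
  apply/matrixP => i j; rewrite !mxE rmorph_nat; congr (_%:R).
  by rewrite -(inj_eq (mulIg q^-1%g)) mulgK eq_sym.
have [||pi piE] := @representation_of_map R Gamma _ (fun g => M (f g)).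
- by move=> g; apply/unitarymxP; rewrite MC MM mulgV M1.
- by move=> g h; rewrite gmulfM MM.
exists #|Q|, pi; split => g; rewrite piE; first by move=> ->.
move=> /matrixP/(_ (enum_rank 1%g) (enum_rank (f g))).
rewrite !mxE !enum_rankK mul1g eqxx (inj_eq enum_rank_inj) => /eqP.
by rewrite eqr_nat; case: (1%g =P f g) => [<-|].
Qed.

End Subrepresentations.

(** * Jordan's theorem for unitary representations with finite image *)

Section Jordan.
Variable R : realType.
Local Notation C := R[i].

(** The compact group U(n) is covered by finitely many balls of radius 1/2: two
matrices whose entries lie in the same cells of a fine grid are close. *)
Lemma unitary_finite_cover n : exists (L : finType) (code : 'M[C]_n -> L),
  forall A B, A \is unitarymx -> B \is unitarymx -> code A = code B -> frob (A - B) < 2^-1.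
Proof.
(* Each real or imaginary part of an entry is determined up to 1 / k, and there are at
   most (n + 1)^2 entries. *)
pose k := (8 * (n.+1 * n.+1))%N.
pose cell (x : R) : 'I_(2 * k * n.+1).+1 := inord (Num.truncn (k%:R * (x + n.+1%:R))).
pose code (A : 'M[C]_n) := [ffun ij : 'I_n * 'I_n =>
  (cell (complex.Re (A ij.1 ij.2)), cell (complex.Im (A ij.1 ij.2)))].
exists {ffun 'I_n * 'I_n -> 'I_(2 * k * n.+1).+1 * 'I_(2 * k * n.+1).+1}, code.
have k0 : 0 < k%:R :> R by rewrite ltr0n.
have cellP x y : `|x| <= n.+1%:R -> `|y| <= n.+1%:R -> cell x = cell y ->
    `|x - y| <= k%:R^-1.
  move=> xn yn /(congr1 val) /=.
  have bound (z : R) : `|z| <= n.+1%:R -> 0 <= k%:R * (z + n.+1%:R) <= (2 * k * n.+1)%:R.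
    rewrite ler_norml => /andP[z1 z2]; apply/andP; split.
      by rewrite mulr_ge0 ?(ltW k0)//; lra.
    have -> : (2 * k * n.+1)%:R = k%:R * (2 * n.+1%:R) :> R by rewrite !natrM; ring.
    by rewrite ler_wpM2l ?(ltW k0)//; lra.
  have /andP[x0 x1] := bound x xn; have /andP[y0 y1] := bound y yn.
  have trle (z : R) : 0 <= z -> z <= (2 * k * n.+1)%:R -> (Num.truncn z < (2 * k * n.+1).+1)%N.
    by move=> z0 z1; rewrite ltnS -(@ler_nat R) (le_trans _ z1)// truncn_le.
  rewrite !inordK ?trle// => xy.
  have := truncn_itv x0; have := truncn_itv y0; rewrite xy.
  move: (Num.truncn _) => t /andP[y2 y3] /andP[x2 x3].
  have : k%:R * `|x - y| <= 1.
    rewrite -[k%:R]gtr0_norm// -normrM ler_norml; move: y3 x3.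
    by rewrite -natr1 => y3 x3; apply/andP; split; lra.
  by rewrite -ler_pdivlMl// mulr1.
move=> A B Au Bu AB.
have entry (M : 'M[C]_n) i j : M \is unitarymx ->
    `|complex.Re (M i j)| <= n.+1%:R /\ `|complex.Im (M i j)| <= n.+1%:R.
  move=> Mu; have [h1 h2] := frob_entry M i j.
  have fM : frob M <= n.+1%:R.
    rewrite frob_unitary//; have -> : n.+1%:R = Num.sqrt (n.+1%:R ^+ 2) :> R.
      by rewrite sqrtr_sqr ger0_norm.
    rewrite ler_wsqrtr//.
    by rewrite -natrX ler_nat (leq_trans (leqnSn n))// leq_pmulr.
  by split; apply: le_trans fM.
have h i j : `|complex.Re ((A - B) i j)| + `|complex.Im ((A - B) i j)| <= 2 * k%:R^-1.
  have /ffunP/(_ (i, j)) := AB; rewrite !ffunE /= => -[c1 c2].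
  have [a1 a2] := entry A i j Au; have [b1 b2] := entry B i j Bu.
  have := cellP _ _ a1 b1 c1; have := cellP _ _ a2 b2 c2; rewrite !mxE.
  case: (A i j) => a a'; case: (B i j) => b b' /=; lra.
have c0 : 0 <= 2 * k%:R^-1 :> R by rewrite mulr_ge0// invr_ge0 ltW.
have hf := frob_entries_le c0 h.
apply: le_lt_trans hf _; rewrite mulrA ltr_pdivrMr//.
rewrite -natrM -ltr_pdivrMl ?invr_gt0// invrK -natrM ltr_nat /k.
by nia.
Qed.

Fact commutator_expansion (V : zmodType) (x y a b o : V) :
  x - y = x - a - (b - o) - (y - b - (a - o)).
Proof.
by rewrite !opprB addrACA !addrA !subrK.
Qed.

(** A B - B A does not change when multiples of the identity are subtracted from A and
from B, which makes the commutator quadratically close to the identity. *)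
Lemma commutator_frob n (A B : 'M[C]_n) : A \is unitarymx -> B \is unitarymx ->
  frob (A *m B *m A^t* *m B^t* - 1%:M) <= 2 * frob (A - 1%:M) * frob (B - 1%:M).
Proof.
move=> Au Bu.
have cE : A *m B - B *m A = (A - 1%:M) *m (B - 1%:M) - (B - 1%:M) *m (A - 1%:M).
  rewrite 2!mulmxBl !mul1mx 2!mulmxBr !mulmx1; exact: commutator_expansion.
have E : A *m B *m A^t* *m B^t* - 1%:M =
    (((A - 1%:M) *m (B - 1%:M) - (B - 1%:M) *m (A - 1%:M)) *m A^t*) *m B^t*.
  by rewrite -cE 2!mulmxBl (mulmxtVK B Au) (unitarymxP Bu).
have Bc := unitarymx_trmxC Bu.
have Ac := unitarymx_trmxC Au.
rewrite E (frob_isomr _ Bc) (frob_isomr _ Ac).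
apply: le_trans (frob_triangleB _ _) _.
rewrite -mulrA mulr_natl mulr2n; apply: lerD; first exact: frobM.
by rewrite mulrC; exact: frobM.
Qed.

Fact twice_half_lt (s t : R) : 0 < t -> s < 2^-1 -> 2 * s * t < t.
Proof. nra. Qed.

Variable Gamma : groupType.

(** Jordan's argument: among the elements near 1 that do not commute with a, the
one closest to 1 would have its commutator with a still closer. *)
Lemma near1_commute n (pi : {multiplicative Gamma -> 'U[R]_n}) (Q : finGroupType)
    (f : {multiplicative Gamma -> Q}) (a b : Gamma) :
  (forall g, f g = 1%g -> \val (pi g) = 1%:M) ->
  frob (\val (pi a) - 1%:M) < 2^-1 -> frob (\val (pi b) - 1%:M) < 2^-1 ->
  \val (pi a) *m \val (pi b) = \val (pi b) *m \val (pi a).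
Proof.
move=> fpi a1 b1.
pose bad x := frob (\val (pi x) - 1%:M) < 2^-1 /\
  \val (pi a) *m \val (pi x) <> \val (pi x) *m \val (pi a).
apply: contrapT => ab.
have fact x y : f x = f y -> frob (\val (pi x) - 1%:M) = frob (\val (pi y) - 1%:M).
  move=> fxy; congr (frob (_ - _)).
  have : \val (pi (x * y^-1)%g) = 1%:M by apply: fpi; rewrite gmulfM morph_groupV fxy mulgV.
  rewrite repM repV => /(congr1 (mulmx^~ (\val (pi y)))).
  by rewrite /= -mulmxA (unitarymxPr (repU pi y)) mulmx1 mul1mx.
have [|x [x1 xa] xmin] := exists_minimum_of_finite_quotient fact (P := bad).
  by exists b.
have Au := repU pi a; have Xu := repU pi x.
pose c := (a * x * a^-1 * x^-1)%g.
have cE : \val (pi c) = \val (pi a) *m \val (pi x) *m (\val (pi a))^t* *m (\val (pi x))^t*.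
  by rewrite /c !repM !repV.
have X0 : 0 < frob (\val (pi x) - 1%:M).
  rewrite lt_neqAle frob_ge0 andbT eq_sym; apply/negP => /eqP/frob_eq0/eqP.
  by rewrite subr_eq0 => /eqP x1'; apply: xa; rewrite x1' mulmx1 mul1mx.
have cx : frob (\val (pi c) - 1%:M) < frob (\val (pi x) - 1%:M).
  rewrite cE; apply: le_lt_trans (commutator_frob Au Xu) _.
  exact: twice_half_lt X0 a1.
have : ~ bad c by move=> /xmin; rewrite leNgt cx.
move=> nbad; apply: xa.
have {nbad} : \val (pi a) *m \val (pi c) = \val (pi c) *m \val (pi a).
  apply: contrapT => h; apply: nbad; split; [exact: lt_trans cx x1|exact: h].
rewrite cE; move: (\val (pi a)) (\val (pi x)) Au Xu x1 {a1 ab xmin cE X0 cx} => A X Au Xu X1 h.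
apply: commute_conjugate_near1 => //; first by apply: lt_trans X1 _; lra.
have {}h : A *m (X *m A^t* *m X^t*) = (X *m A^t* *m X^t*) *m A.
  have := congr1 (mulmx (A^t*)) h.
  by rewrite !mulmxA (unitarymxPr Au) !mul1mx.
move YE : (X *m A *m X^t*) => Y.
have hY : Y *m A^t* = A^t* *m Y.
  by have := congr1 (fun M => M^t*) h; rewrite !trmxC_mul !trmxCK -YE !mulmxA.
rewrite -[Y in LHS]mulmx1 -(unitarymxPr Au) [Y *m _]mulmxA hY !mulmxA.
by rewrite (unitarymxP Au) mul1mx.
Qed.

(** H is generated by the elements that pi maps within 1/2 of the identity, which
commute.  Distinct cosets have representatives with images at distance at least 1/2, so
a finite cover of U(n) by small balls tells the cosets apart.  A label set that does not
depend on pi plays the role of a bound on the index of H. *)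
Lemma jordan_bounded_index (d : nat) : exists L : finType,
  forall n (pi : {multiplicative Gamma -> 'U[R]_n}) (Q : finGroupType)
    (f : {multiplicative Gamma -> Q}), (n <= d)%N ->
    (forall g, f g = 1%g -> \val (pi g) = 1%:M) ->
  exists (H : set Gamma) (lab : Gamma -> L), [/\ subgroup H,
    forall x y, lab x = lab y <-> H (x^-1 * y)%g &
    forall x y, H x -> H y -> \val (pi x) *m \val (pi y) = \val (pi y) *m \val (pi x)].
Proof.
pose Ln n := projT1 (cid (unitary_finite_cover n)).
pose codeP n := projT2 (cid (unitary_finite_cover n)).
exists {n : 'I_d.+1 & Ln n} => n pi Q f nd fpi.
have [code codeE] := codeP n.
pose S := [set g | frob (\val (pi g) - 1%:M) < 2^-1]%classic.
pose H := smallest (@subgroup Gamma) S.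
have sH : subgroup H := smallest_subgroup S.
have SH : (S `<=` H)%classic by exact: sub_gen_smallest.
have comm_sub (A : 'M[C]_n) :
    subgroup [set x | \val (pi x) *m A = A *m \val (pi x)]%classic.
  apply/subgroupP; split=> [|x y /= xA yA]; first by rewrite /= rep1 mul1mx mulmx1.
  rewrite repM repV -mulmxA.
  have -> : (\val (pi y))^t* *m A = A *m (\val (pi y))^t*.
    have yu := repU pi y.
    rewrite -[A in LHS](mulmxtVK A yu) -yA !mulmxA (unitarymxPr yu).
    by rewrite mul1mx.
  by rewrite !mulmxA xA.
have HS x y : H x -> S y -> \val (pi x) *m \val (pi y) = \val (pi y) *m \val (pi x).
  move=> Hx Sy; apply: (smallest_sub (comm_sub (\val (pi y))) _ Hx) => z Sz.
  exact: near1_commute fpi Sz Sy.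
have HH x y : H x -> H y -> \val (pi x) *m \val (pi y) = \val (pi y) *m \val (pi x).
  move=> Hx Hy; apply: (smallest_sub (comm_sub (\val (pi y))) _ Hx) => z Sz.
  by rewrite /= (HS y z).
pose rep x := xget 1%g [set y | H (x^-1 * y)%g].
have repP x : H (x^-1 * rep x)%g.
  apply: (@xgetPex _ 1%g [set y | H (x^-1 * y)%g]%classic); exists x.
  by rewrite /= mulVg; have [] := (subgroupP H).1 sH.
have rep_eq x y : H (x^-1 * y)%g -> rep x = rep y.
  move=> Hxy; rewrite /rep; congr (xget _ _); apply/seteqP; split=> z /= Hz.
    have -> : (y^-1 * z = (x^-1 * y)^-1 * (x^-1 * z))%g.
      by rewrite invgM invgK -!mulgA [(x * _)%g]mulgA mulgV mul1g.
    exact: (subgroupM sH (subgroupV sH Hxy) Hz).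
  have -> : (x^-1 * z = (x^-1 * y) * (y^-1 * z))%g.
    by rewrite -!mulgA [(y * _)%g]mulgA mulgV mul1g.
  exact: (subgroupM sH Hxy Hz).
have nd1 : (n < d.+1)%N by [].
exists H, (fun x => Tagged (fun k : 'I_d.+1 => Ln k) (code (\val (pi (rep x))) : Ln (Ordinal nd1))).
split => // x y; split=> [/eqP|/rep_eq-> //].
rewrite eq_Tagged /= => /eqP cxy.
have := codeE _ _ (repU pi (rep x)) (repU pi (rep y)) cxy => near.
have Srep : S ((rep x)^-1 * rep y)%g.
  rewrite /S /= repM repV.
  have <- : frob ((\val (pi (rep x)))^t* *m (\val (pi (rep y)) - \val (pi (rep x)))) =
            frob ((\val (pi (rep x)))^t* *m \val (pi (rep y)) - 1%:M).
    by rewrite mulmxBr (unitarymxPr (repU pi (rep x))).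
  by rewrite (frob_isomlC _ (repU pi (rep x))) frobC.
have -> : (x^-1 * y = (x^-1 * rep x) * ((rep x)^-1 * rep y) * (y^-1 * rep y)^-1)%g.
  by rewrite invgM invgK -!mulgA !(mulKg, mulKVg).
exact: (subgroupM sH (subgroupM sH (repP x) (SH _ Srep)) (subgroupV sH (repP y))).
Qed.

End Jordan.

(** * Stable groups are virtually abelian *)

(** Elements x, y of the common finite index subgroup commute under every representation
of dimension at most d with finite image, and these separate the commutator of x and y
from the identity if it is nontrivial. *)
Lemma virtually_abelian_of_stable (R : realType) (Gamma : groupType) :
  finitely_generated Gamma -> residually_finite Gamma ->
  uniformly_HS_stable R Gamma -> virtually_abelian Gamma.
Proof.
move=> fg rf /stable_intertwiner[d red].
have [L jordan] := jordan_bounded_index R Gamma d.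
have [G0 [sG0 fiG0] G0sub] := finite_index_in_bounded_index L fg.
exists G0; split => // x y; rewrite !inE => G0x G0y.
apply: contrapT => xy; pose c := (x * y * (y * x)^-1)%g.
have c1 : c != 1%g.
  by apply/negP => /eqP /divg1_eq.
have [Q [f fc]] := rf c c1.
have [n [pi [fpi pif]]] := regular_representation R f.
have pic : \val (pi c) != 1%:M by apply: contra fc => /eqP/pif->.
have [n' [pi' [n'd fpi' pi'c]]] := @small_representation_detects R Gamma d
  (fun g => f g = 1%g) c red n pi fpi pic.
have [H [lab [sH labH Hcomm]]] := jordan n' pi' Q f n'd fpi'.
have G0H := G0sub H lab sH labH.
move/negP: pi'c; apply; apply/eqP.
rewrite /c repM repV repM (Hcomm x y (G0H _ G0x) (G0H _ G0y)) -repM.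
exact: unitarymxP (repU pi' _).
Qed.

(** * Small invariant subspaces for virtually abelian groups *)

Section VirtuallyAbelianRepresentations.
Variables (R : realType) (Gamma : groupType).
Local Notation C := R[i].

Lemma right_transversal (H : set Gamma) : subgroup H -> finite_index H ->
  exists T : seq Gamma, forall g, exists2 t, t \in T & H (g * t^-1)%g.
Proof.
move=> sH /finite_seqP[s sE].
have inr x : left_coset H x \in s.
  by have : [set` s]%classic (left_coset H x) by rewrite -sE; exists x.
pose pt A := xget 1%g [set x | left_coset H x = A].
exists [seq (pt A)^-1%g | A <- s] => g.
exists (pt (left_coset H g^-1%g))^-1%g; first exact: map_f.
have ptE : left_coset H (pt (left_coset H g^-1%g)) = left_coset H g^-1%g.
  by apply: (@xgetPex _ 1%g [set x | left_coset H x = left_coset H g^-1%g]); exists g^-1%g.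
by have := left_cosetP sH (esym ptE); rewrite !invgK.
Qed.

Variables (H : set Gamma) (T : seq Gamma).
Hypothesis abH : {in [in H] &, forall x y, commute x y}.
Hypothesis HT : forall g, exists2 t, t \in T & H (g * t^-1)%g.

(** Either H acts on W by scalars, or some h in H has an eigenspace in W that is smaller
than W, and H preserves it. *)
Lemma abelian_common_eigenvector n (pi : {multiplicative Gamma -> 'U[R]_n}) (W : 'M[C]_n) :
  W != 0 -> (forall h, H h -> stablemx W (\val (pi h))) ->
  exists v : 'rV[C]_n, [/\ v != 0, (v <= W)%MS & forall h, H h -> stablemx v (\val (pi h))].
Proof.
have [r] := ubnP (\rank W); elim: r W => // r IH W Wr W0 Wst.
have [scal|] := pselect (forall h, H h -> exists c, W *m \val (pi h) = c *: W).
  exists (nz_row W); split; [by rewrite nz_row_eq0|exact: nz_row_sub|move=> h /scal[c hc]].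
  have /submxP[Y ->] : (nz_row W <= W)%MS by exact: nz_row_sub.
  by rewrite -mulmxA hc -scalemxAr scalemx_sub.
move=> /existsNP[h /not_implyP[Hh nscal]].
have [a] : exists a, eigenvalue (restrictmx W (\val (pi h))) a.
  by apply: eigenvalue_closed; rewrite lt0n mxrank_eq0.
case/eigenvalueP => w /eqP wa w0.
pose V := (W :&: eigenspace (\val (pi h)) a)%MS.
have wV : (w *m row_base W <= V)%MS.
  rewrite sub_capmx; apply/andP; split; first by rewrite mulmx_sub// eq_row_base.
  apply/eigenspaceP; move/eqP: wa => wa; rewrite -mulmxA.
  have -> : row_base W *m \val (pi h) = restrictmx W (\val (pi h)) *m row_base W.
    by rewrite /conjmx mulmxKpV// stablemx_row_base Wst.
  by rewrite mulmxA wa scalemxAl.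
have V0 : V != 0.
  apply: contraTneq wV => ->; rewrite submx0 mulmx_free_eq0 ?row_base_free//.
have VW : (V <= W)%MS by exact: capmxSl.
have Vr : (\rank V < \rank W)%N.
  rewrite ltn_neqAle mxrankS// andbT; apply/negP => /eqP rVW.
  have WV : (W <= V)%MS by rewrite -(geq_leqif (mxrank_leqif_sup VW)) rVW.
  apply: nscal; exists a; apply/eigenspaceP.
  by apply: submx_trans WV _; exact: capmxSr.
have Vst k : H k -> stablemx V (\val (pi k)).
  move=> Hk; rewrite sub_capmx (submx_trans (submxMr _ VW) (Wst k Hk)) /=.
  apply: submx_trans (submxMr _ (capmxSr _ _)) _.
  apply: comm_mx_stable_eigenspace.
  by rewrite /comm_mx -!repM; congr (\val (pi _)); apply: abH; rewrite inE.
have [|v [v0 vV vst]] := IH V _ V0 Vst; first by rewrite (leq_trans Vr).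
by exists v; split => //; apply: submx_trans VW.
Qed.

(** The orbit of an H-eigenvector spans an invariant subspace of dimension at most the
number of cosets. *)
Lemma small_stable_subspace n (pi : {multiplicative Gamma -> 'U[R]_n}) (W : 'M[C]_n) :
  W != 0 -> (forall g, stablemx W (\val (pi g))) ->
  exists U : 'M[C]_(size T, n), [/\ U != 0, (U <= W)%MS & forall g, stablemx U (\val (pi g))].
Proof.
move=> W0 Wst.
have [v [v0 vW vst]] := abelian_common_eigenvector W0 (fun h _ => Wst h).
pose U := \matrix_(i < size T) (v *m \val (pi (nth 1%g T i))).
have orbit g : (v *m \val (pi g) <= U)%MS.
  have [t tT Ht] := HT g.
  have tE : nth 1%g T (index t T) = t by rewrite nth_index.
  have tlt : (index t T < size T)%N by rewrite index_mem.
  have -> : g = (g * t^-1 * t)%g by rewrite -mulgA mulVg mulg1.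
  rewrite repM mulmxA; apply: submx_trans (submxMr _ (vst _ Ht)) _.
  by have := row_sub (Ordinal tlt) U; rewrite rowK /= tE.
exists U; split.
- apply/negP => /eqP U0; have := orbit 1%g.
  by rewrite rep1 mulmx1 U0 => /submx0null/eqP; rewrite (negPf v0).
- apply/row_subP => i; rewrite rowK.
  exact: submx_trans (submxMr _ vW) (Wst _).
- move=> g; apply/row_subP => i; rewrite row_mul rowK -mulmxA -repM.
  exact: orbit.
Qed.

(** Invariant subspaces of dimension at most the number of cosets are added one at a time,
each taken in the orthogonal complement of the sum of the previous ones. *)
Lemma stable_subspace_near_dim m (pi : {multiplicative Gamma -> 'U[R]_m}) (k : nat) :
  (k <= m)%N ->
  exists V : 'M[C]_m, [/\ (\rank V <= k)%N, (k < \rank V + size T)%N &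
    forall g, stablemx V (\val (pi g))].
Proof.
move=> km.
have Tpos : (0 < size T)%N by have [t + _] := HT 1%g; case: (T).
have step j : exists V : 'M[C]_m, [/\ (\rank V <= k)%N,
    ((k < \rank V + size T) || (j <= \rank V))%N & forall g, stablemx V (\val (pi g))].
  elim: j => [|j [V [Vk VT Vst]]].
    by exists 0; rewrite mxrank0; split => // [|g]; rewrite ?orbT// mul0mx sub0mx.
  have [kV|Vk2] := ltnP k (\rank V + size T); first by exists V; rewrite kV.
  have jV : (j <= \rank V)%N by move: VT; rewrite ltnNge Vk2.
  have [r [E [E' [dimE Eu E'u EV [EE1 EE']]]]] := orthonormal_splitting V.
  have Est g : stablemx E (\val (pi g)).
    by rewrite (eqmxMr _ EV) (submx_trans (Vst g))// EV submx_refl.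
  have E'st := orthogonal_stable Eu EE1 EE' Est.
  have r0 : (0 < r)%N by lia.
  have [||U [U0 UE' Ust]] := @small_stable_subspace _ pi (<<E'>>%MS).
  - by rewrite -mxrank_eq0 genmxE mxrank_unitary// -lt0n.
  - by move=> g; rewrite !(genmxE, eqmxMr _ (genmxE _)) E'st.
  have {}UE' : (U <= E')%MS by rewrite genmxE in UE'.
  exists (V + U)%MS; split.
  - apply: leq_trans (mxrank_adds_leqif _ _).1 _.
    by apply: leq_trans Vk2; rewrite leq_add2l rank_leq_row.
  - apply/orP; right; apply: leq_ltn_trans jV _.
    rewrite ltn_neqAle mxrankS ?addsmxSl// andbT; apply/negP => /eqP rVU.
    have UV : (U <= V)%MS.
      apply: submx_trans (addsmxSr V U) _.
      by rewrite -(geq_leqif (mxrank_leqif_sup (addsmxSl V U))) rVU.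
    have /submxP[Y UY] : (U <= E)%MS by rewrite EV.
    move/negP: U0; apply; apply/eqP.
    by rewrite -(submx_isometry E'u UE') UY -[Y *m E *m _]mulmxA EE' mulmx0 mul0mx.
  - by move=> g; rewrite addsmxMr addsmxS ?Vst ?Ust.
have [V [Vk /orP[kV|Vk2] Vst]] := step k.+1; first by exists V.
by move: Vk; rewrite leqNgt Vk2.
Qed.

End VirtuallyAbelianRepresentations.

(** * Adjusting the dimension of a dilation *)

Section Assembly.
Variables (R : realType) (Gamma : groupType).
Local Notation C := R[i].

Fact telescope_sub (V : zmodType) (a x y z q : V) :
  a - (q + z) = (a - x + (x - y)) + (y - z - q).
Proof. by rewrite !addrA !subrK opprD addrA addrAC. Qed.

Lemma mxdot_pythagoras m n (A B : 'M[C]_(m, n)) : mxdot A B = 0 ->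
  mxdot (A + B) (A + B) = mxdot A A + mxdot B B.
Proof. by move=> AB; rewrite mxdotDl !mxdotDr (mxdotC B A) AB addr0 add0r. Qed.

Lemma mxdot_complement r n (E : 'M[C]_(r, n)) : E \is unitarymx ->
  mxdot (1%:M - E^t* *m E) (1%:M - E^t* *m E) = n%:R - r%:R.
Proof.
move=> Eu; have EE : mxdot E E = r%:R by rewrite mxdot_unitary.
have pp : mxdot (E^t* *m E) (E^t* *m E) = r%:R.
  by rewrite mxdot_isomr// mxdot_trmxC.
have p1 : mxdot (E^t* *m E) 1%:M = r%:R.
  by rewrite mxdot_mulr trmxCK mulmx1.
rewrite mxdotDl !mxdotDr !mxdotNl !mxdotNr pp (mxdotC 1%:M (E^t* *m E)) p1 mxdot1.
by move: (n%:R) (r%:R); clear => x y; ring.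
Qed.

Lemma complement_unitarymx r n (E : 'M[C]_(r, n)) : E \is unitarymx ->
  E *m (1%:M - E^t* *m E) = 0 /\ (1%:M - E^t* *m E) *m E^t* = 0.
Proof.
move=> Eu; split.
  by rewrite mulmxBr mulmx1 mulmxA (unitarymxP Eu) mul1mx subrr.
by rewrite mulmxBl mul1mx mulmxtVK// subrr.
Qed.

(** The representation acts as rho on the range of the isometry and trivially on its
orthogonal complement. *)
Lemma extended_representation r n (rho : {multiplicative Gamma -> 'U[R]_r})
    (Z : 'M[C]_(r, n)) : Z \is unitarymx ->
  exists pi : {multiplicative Gamma -> 'U[R]_n},
    forall g, \val (pi g) = (1%:M - Z^t* *m Z) + Z^t* *m \val (rho g) *m Z.
Proof.
move=> Zu; have [Zq qZ] := complement_unitarymx Zu.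
set q := 1%:M - _ in Zq qZ *.
have qq : q *m q = q by rewrite {1}/q mulmxBl mul1mx -mulmxA Zq mulmx0 subr0.
have qC : q^t* = q by rewrite /q trmxCB trmxC1 trmxC_mul trmxCK.
have q1 : q + Z^t* *m Z = 1%:M by rewrite /q subrK.
clearbody q.
have M A B : (q + Z^t* *m A *m Z) *m (q + Z^t* *m B *m Z) = q + Z^t* *m (A *m B) *m Z.
  rewrite mulmxDl !mulmxDr qq !mulmxA qZ !mul0mx addr0 -!mulmxA Zq !mulmx0 add0r.
  by rewrite (mulmxA Z) (unitarymxP Zu) mul1mx.
apply: representation_of_map => [g|g h]; last by rewrite repM M.
apply/unitarymxP; rewrite trmxCD qC !trmxC_mul trmxCK [X in _ *m (_ + X)]mulmxA.
by rewrite M (unitarymxP (repU rho g)) mulmx1 q1.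
Qed.

(** Cutting rho down to a subrepresentation of dimension r <= n and padding with the
trivial representation changes little when n - r and m - r are small: the contraction
restricted to the subrepresentation almost preserves norms, so that its polar part Z is
a nearby isometry into the space of phi, along which the subrepresentation is moved. *)
Lemma representation_of_right_dim n m r (rho : {multiplicative Gamma -> 'U[R]_m})
    (X : 'M[C]_(n, m)) (E : 'M[C]_(r, m)) (k b c : R) (phi : Gamma -> 'M[C]_n) :
  contraction X -> n%:R - k <= mxdot X X ->
  E \is unitarymx -> (forall g, stablemx E (\val (rho g))) ->
  (r <= n)%N -> n%:R <= r%:R + b -> m%:R <= r%:R + b -> 0 <= b -> 0 <= k ->
  (forall g, frob (X *m \val (rho g) *m X^t* - phi g) <= c) ->
  exists pi : {multiplicative Gamma -> 'U[R]_n},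
    forall g, frob (phi g - \val (pi g)) <= c + 2 * Num.sqrt b + 2 * Num.sqrt (k + b).
Proof.
move=> cX Xk Eu Est rn nb mb b0 k0 Xc.
have [rho1 rho1E] := restricted_representation Eu Est.
pose p := E^t* *m E.
have fp : frob (1%:M - p) <= Num.sqrt b.
  apply: frob_le; first exact: sqrtr_ge0.
  by rewrite sqr_sqrtr// mxdot_complement// lerBlDl.
pose Y := E *m X^t*.
have cXt := contraction_trmxC cX.
have cY : contraction Y by apply: contraction_mul => //; exact: contraction_unitary.
have YY : n%:R - k - b <= mxdot Y Y.
  have -> : mxdot Y Y = mxdot (X *m p) (X *m p).
    by rewrite /p mulmxA mxdot_isomr// -mxdot_trmxC /Y trmxC_mul trmxCK.
  have XE : mxdot X X = mxdot (X *m p) (X *m p) + mxdot (X *m (1%:M - p)) (X *m (1%:M - p)).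
    have p0 : p *m (1%:M - p)^t* = 0.
      rewrite trmxCB trmxC1 /p trmxC_mul trmxCK -mulmxA.
      by rewrite (complement_unitarymx Eu).1 mulmx0.
    have Xp0 : mxdot (X *m p) (X *m (1%:M - p)) = 0.
      by rewrite mxdot_trE trmxC_mul mulmxA -(mulmxA X) p0 mulmx0 mul0mx linear0.
    by rewrite -(mxdot_pythagoras Xp0) -mulmxDr [p + _]addrC subrK mulmx1.
  have : mxdot (X *m (1%:M - p)) (X *m (1%:M - p)) <= b.
    rewrite -[b]sqr_sqrtr//; apply: mxdot_frob_le.
    by apply: le_trans fp; exact: contraction_frob_mull.
  by move: Xk; rewrite XE; move: (mxdot _ _) (mxdot (X *m p) _); clear => x y; lra.
have [Z Zu YZ] := isometry_near_contraction rn cY.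
have fYZ : frob (Y - Z) <= Num.sqrt (k + b).
  apply: frob_le; first exact: sqrtr_ge0.
  rewrite sqr_sqrtr ?addr_ge0//; apply: le_trans YZ _.
  have rn' : r%:R <= n%:R :> R by rewrite ler_nat.
  by clear -rn' YY; move: (mxdot _ _) (n%:R) (r%:R) rn' YY => x y z; lra.
have [pi piE] := extended_representation rho1 Zu.
exists pi => g; rewrite piE.
have q1 : frob (1%:M - Z^t* *m Z) <= Num.sqrt b.
  apply: frob_le; first exact: sqrtr_ge0.
  by rewrite sqr_sqrtr// mxdot_complement// lerBlDl.
have Yrho : Y^t* *m \val (rho1 g) *m Y = X *m \val (rho g) *m p *m X^t*.
  have pE k' : p *m \val (rho k') *m p = p *m \val (rho k').
    by rewrite /p -!mulmxA; congr (_ *m _); rewrite !mulmxA submx_isometry.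
  have pC : p^t* = p by rewrite /p trmxC_mul trmxCK.
  have -> : Y^t* *m \val (rho1 g) *m Y = X *m (p *m \val (rho g) *m p) *m X^t*.
    by rewrite rho1E /Y /p trmxC_mul trmxCK !mulmxA.
  have pr : p *m \val (rho g) *m p = \val (rho g) *m p.
    have := congr1 (fun M => M^t*) (pE g^-1%g).
    by clearbody p; rewrite !trmxC_mul repV trmxCK pC mulmxA.
  by rewrite pr !mulmxA.
have s2 : frob (X *m \val (rho g) *m X^t* - Y^t* *m \val (rho1 g) *m Y) <= Num.sqrt b.
  rewrite Yrho -mulmxBl -[X in frob ((X - _) *m _)]mulmx1 -mulmxBr.
  apply: le_trans (cXt _ _) _; rewrite -mulmxA.
  apply: le_trans (contraction_frob_mull _ cX) _.
  by rewrite (frob_unitl _ (repU rho g)).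
have s3 : frob (Y^t* *m \val (rho1 g) *m Y - Z^t* *m \val (rho1 g) *m Z) <= 2 * Num.sqrt (k + b).
  have -> : Y^t* *m \val (rho1 g) *m Y - Z^t* *m \val (rho1 g) *m Z =
     (Y - Z)^t* *m (\val (rho1 g) *m Y) + Z^t* *m (\val (rho1 g) *m (Y - Z)).
    by rewrite trmxCB mulmxBl !mulmxBr !mulmxA addrA subrK.
  apply: le_trans (frob_triangle _ _) _; rewrite mulr_natl mulr2n; apply: lerD.
    rewrite mulmxA; apply: le_trans (cY _ _) _.
    by rewrite (frob_isomr _ (repU rho1 g)) frob_trmxC.
  by rewrite (frob_isomlC _ Zu) (frob_unitl _ (repU rho1 g)).
have s1 : frob (phi g - X *m \val (rho g) *m X^t*) <= c by rewrite frobC.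
rewrite (telescope_sub _ (X *m \val (rho g) *m X^t*) (Y^t* *m \val (rho1 g) *m Y)).
apply: le_trans (frob_triangle _ _) _.
have t1 := le_trans (frob_triangle _ _) (lerD s1 s2).
have t2 := le_trans (frob_triangleB _ _) (lerD s3 q1).
apply: le_trans (lerD t1 t2) _.
by clear; move: (Num.sqrt b) (Num.sqrt _) => x y; lra.
Qed.

End Assembly.

(** * Averages over finite families of group elements *)

Section Averages.
Variables (R : realType) (Gamma : groupType).
Local Notation C := R[i].
Variables (I : finType) (y : I -> Gamma).
Hypothesis I0 : (0 < #|I|)%N.

Definition average m n (a : Gamma -> 'M[C]_(m, n)) : 'M[C]_(m, n) :=
  (#|I|%:R^-1)%:C%C *: \sum_i a (y i).

Definition raverage (a : Gamma -> R) : R := #|I|%:R^-1 * \sum_i a (y i).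

Let k0 : 0 < #|I|%:R :> R. Proof. by rewrite ltr0n. Qed.
Let kV0 : 0 <= #|I|%:R^-1 :> R. Proof. by rewrite invr_ge0 ltW. Qed.
Let kK : (#|I|%:R^-1)%:C%C * #|I|%:R = 1 :> C.
Proof. by rewrite -(rmorph_nat (real_complex R)) -rmorphM /= mulVf ?gt_eqF. Qed.

Let sum_const_card (c : R) : \sum_(i : I) c = #|I|%:R * c.
Proof. by rewrite sumr_const mulr_natl. Qed.

Lemma average_cst m n (A : 'M[C]_(m, n)) : average (fun=> A) = A.
Proof. by rewrite /average sumr_const -[#|xpredT|]/#|I| -scaler_nat scalerA kK scale1r. Qed.

Lemma average_mull m n p (A : 'M[C]_(p, m)) (a : Gamma -> 'M[C]_(m, n)) :
  average (fun x => A *m a x) = A *m average a.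
Proof. by rewrite /average -mulmx_sumr scalemxAr. Qed.

Lemma average_mulr m n p (A : 'M[C]_(n, p)) (a : Gamma -> 'M[C]_(m, n)) :
  average (fun x => a x *m A) = average a *m A.
Proof. by rewrite /average -mulmx_suml scalemxAl. Qed.

Lemma averageB m n (a b : Gamma -> 'M[C]_(m, n)) :
  average (fun x => a x - b x) = average a - average b.
Proof. by rewrite /average sumrB scalerBr. Qed.

Lemma average_trmxC m n (a : Gamma -> 'M[C]_(m, n)) :
  average (fun x => (a x)^t*) = (average a)^t*.
Proof. by rewrite /average trmxCZ trmxC_sum conj_real. Qed.

Lemma eq_average m n (a b : Gamma -> 'M[C]_(m, n)) : a =1 b -> average a = average b.
Proof. by move=> ab; rewrite /average; congr (_ *: _); apply: eq_bigr => i _. Qed.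

Lemma frob_average m n (a : Gamma -> 'M[C]_(m, n)) (c : R) :
  (forall x, frob (a x) <= c) -> frob (average a) <= c.
Proof.
move=> ac; rewrite /average frobZ// -[c](mulKf (lt0r_neq0 k0)) ler_wpM2l//.
apply: le_trans (frob_sum _ _ _) _; apply: le_trans (ler_sum _ (fun i _ => ac (y i))) _.
by rewrite sum_const_card.
Qed.

Lemma Re_tr_average n (a : Gamma -> 'M[C]_n) :
  complex.Re (\tr (average a)) = raverage (fun x => complex.Re (\tr (a x))).
Proof.
have E (M : 'M[C]_n) : complex.Re (\tr M) = mxdot M 1%:M.
  by rewrite mxdot_trE trmxC1 mulmx1.
rewrite E mxdotZl mxdot_suml /raverage; congr (_ * _).
by apply: eq_bigr => i _; rewrite E.
Qed.

Lemma raverage_le (a : Gamma -> R) (c : R) : (forall x, a x <= c) -> raverage a <= c.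
Proof.
move=> ac; rewrite /raverage -[c](mulKf (lt0r_neq0 k0)) ler_wpM2l//.
by apply: le_trans (ler_sum _ (fun i _ => ac (y i))) _; rewrite sum_const_card.
Qed.

Lemma raverage_ge (a : Gamma -> R) (c : R) : (forall x, c <= a x) -> c <= raverage a.
Proof.
move=> ac; rewrite /raverage -[c](mulKf (lt0r_neq0 k0)) ler_wpM2l//.
by apply: le_trans (ler_sum _ (fun i _ => ac (y i))); rewrite sum_const_card.
Qed.

(** Reiter's condition in dual form: testing against bounded matrix-valued functions
replaces the l1-distance between the counting measure of y and its translate. *)
Definition almost_invariant (h : Gamma) (eta : R) :=
  forall m n (a : Gamma -> 'M[C]_(m, n)) (c : R), (forall x, frob (a x) <= c) ->
  frob (average (fun x => a (h * x)%g) - average a) <= c * eta.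

(** A real function is a matrix-valued function of size one. *)
Lemma raverage_shift h eta (a : Gamma -> R) (c : R) : almost_invariant h eta ->
  (forall x, `|a x| <= c) -> raverage (fun x => a (h * x)%g) <= raverage a + c * eta.
Proof.
move=> inv ac; pose b x := ((a x)%:C%C)%:M : 'M[C]_1.
have bE x : complex.Re (\tr (b x)) = a x by rewrite /b mxtrace_scalar.
have bc x : frob (b x) <= c.
  apply: le_trans (ac x); apply: frob_le => //.
  rewrite mxdotE !big_ord1 /b !mxE eqxx /= mulr0 addr0 -expr2.
  by rewrite real_normK ?num_real.
have /(_ _ _ b c bc) h1 := inv.
have h2 := mxdot_CS (average (fun x => b (h * x)%g) - average b) 1%:M.
have f1 : frob (1%:M : 'M[C]_1) = 1.
  by rewrite frob_unitary ?sqrtr1//; apply/unitarymxP; rewrite mul1mx trmxC1.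
move: h2; rewrite f1 mulr1 mxdot_trE trmxC1 mulmx1 linearB /= ReD ReN !Re_tr_average => h2.
rewrite -lerBlDl; apply: le_trans h1; apply: le_trans h2.
by rewrite lerB// /raverage ler_wpM2l// ler_sum// => i _; rewrite bE.
Qed.

Variable n : nat.
Local Notation D := #|{: I * 'I_n}|.

(** The vector-valued function G restricted to the points y, written as a matrix whose
rows live in the Hilbert space of C^n-valued functions on I with normalized counting
measure. *)
Definition stack p (G : Gamma -> 'M[C]_(p, n)) : 'M[C]_(p, D) :=
  \matrix_(r, d) ((Num.sqrt #|I|%:R^-1)%:C%C * G (y (enum_val d).1) r (enum_val d).2).

Lemma stack_mul p q (G : Gamma -> 'M[C]_(p, n)) (G' : Gamma -> 'M[C]_(q, n)) :
  stack G *m (stack G')^t* = average (fun x => G x *m (G' x)^t*).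
Proof.
apply/matrixP => r s; rewrite !mxE summxE mulr_sumr.
under eq_bigr do rewrite !mxE.
rewrite (reindex (@enum_rank {: I * 'I_n})) /=; last first.
  by exists enum_val => d _; rewrite ?enum_rankK ?enum_valK.
under eq_bigr do rewrite enum_rankK.
rewrite -(pair_bigA _ (fun i a => (Num.sqrt #|I|%:R^-1)%:C%C * G (y i) r a *
   ((Num.sqrt #|I|%:R^-1)%:C%C * G' (y i) s a)^*)) /=.
apply: eq_bigr => i _; rewrite mxE mulr_sumr; apply: eq_bigr => a _.
rewrite !mxE rmorphM /= conj_real mulrACA; congr (_ * _).
by rewrite -rmorphM /= -expr2 sqr_sqrtr.
Qed.

Lemma stack_mull p q (A : 'M[C]_(q, p)) (G : Gamma -> 'M[C]_(p, n)) :
  stack (fun x => A *m G x) = A *m stack G.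
Proof.
apply/matrixP => r d; rewrite !mxE mulr_sumr; apply: eq_bigr => s _.
by rewrite !mxE mulrCA.
Qed.

Lemma stackB p (G G' : Gamma -> 'M[C]_(p, n)) :
  stack (fun x => G x - G' x) = stack G - stack G'.
Proof. by apply/matrixP => r d; rewrite !mxE mulrBr. Qed.

Lemma eq_stack p (G G' : Gamma -> 'M[C]_(p, n)) : G =1 G' -> stack G = stack G'.
Proof. by move=> GG'; apply/matrixP => r d; rewrite !mxE GG'. Qed.

Lemma mxdot_stack p (G : Gamma -> 'M[C]_(p, n)) :
  mxdot (stack G) (stack G) = raverage (fun x => mxdot (G x) (G x)).
Proof. by rewrite mxdot_trE stack_mul Re_tr_average. Qed.

Lemma frob_stack p (G : Gamma -> 'M[C]_(p, n)) (c : R) :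
  (forall x, frob (G x) <= c) -> frob (stack G) <= c.
Proof.
move=> Gc; have c0 : 0 <= c by apply: le_trans (Gc 1%g); exact: frob_ge0.
by apply: frob_le => //; rewrite mxdot_stack; apply: raverage_le => x; exact: mxdot_frob_le.
Qed.

Lemma mxdot_stack_shift h eta p (G : Gamma -> 'M[C]_(p, n)) (c : R) :
  almost_invariant h eta -> (forall x, frob (G x) <= c) ->
  mxdot (stack (fun x => G (h * x)%g)) (stack (fun x => G (h * x)%g)) <=
  mxdot (stack G) (stack G) + c ^+ 2 * eta.
Proof.
move=> inv Gc; rewrite !mxdot_stack.
apply: (@raverage_shift h eta (fun x => mxdot (G x) (G x))) => // x.
by rewrite ger0_norm ?mxdot_ge0//; exact: mxdot_frob_le.
Qed.

Lemma stack_average p (A : Gamma -> Gamma -> 'M[C]_(p, n)) :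
  stack (fun x => average (fun z => A z x)) = average (fun z => stack (A z)).
Proof.
apply/matrixP => r d; rewrite !mxE !summxE mulrCA; congr (_ * _).
by rewrite mulr_sumr; apply: eq_bigr => i _; rewrite !mxE.
Qed.

End Averages.

(** * Spectral gaps and eigenvalue counting *)

Section SpectralSelection.
Variable R : realType.

(** A spectral gap: there are at most 3 n eigenvalues above 1/3, so one of 3 n + 1
disjoint intervals between 1/3 and 2/3 contains none. *)
Lemma exists_gap (K : finType) (lam : K -> R) (n : nat) :
  (forall k, 0 <= lam k) -> \sum_k lam k = n%:R ->
  exists theta : R, [/\ 3^-1 <= theta, theta <= 2 / 3 &
    forall k, lam k < theta -> lam k <= theta - (9 * n.+1%:R)^-1].
Proof.
move=> lam0 lamn; set w := (9 * n.+1%:R)^-1.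
have w0 : 0 < w by rewrite invr_gt0 mulr_gt0// ltr0n.
(* Intervals of width w starting at 1/3: 3 n + 1 of them end before 2/3. *)
pose N := (3 * n).+1.
pose inter (j : 'I_N) := [pred k | 3^-1 + j%:R * w < lam k < 3^-1 + j.+1%:R * w].
have [j /pred0P j0] : exists j, pred0b (inter j).
  apply/existsP; apply: contraT; rewrite negb_exists => /forallP nonempty.
  have pick j : {k | k \in inter j}.
    by apply/sigW; have := nonempty j; case/pred0Pn => k kj; exists k.
  pose f j := projT1 (pick j).
  have fP (j : 'I_N) : 3^-1 + j%:R * w < lam (f j) < 3^-1 + j.+1%:R * w := projT2 (pick j).
  have finj : injective f.
    have lt_case (i j : 'I_N) : (i < j)%N -> f i = f j -> False.
      move=> ij fij; have /andP[_ h1] := fP i; have /andP[h2 _] := fP j.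
      have : (i.+1%:R : R) * w <= j%:R * w by rewrite ler_pM2r// ler_nat.
      by rewrite fij in h1; lra.
    move=> i j fij; apply/val_inj; case: (ltngtP i j) => // ij.
      by case: (lt_case _ _ ij fij).
    by case: (lt_case _ _ ij (esym fij)).
  have : N%:R * 3^-1 <= n%:R :> R.
    rewrite -lamn; apply: le_trans (_ : \sum_(k in codom f) lam k <= _); last first.
      by rewrite [leRHS](bigID (mem (codom f)))/= lerDl sumr_ge0.
    have -> : N%:R = #|codom f|%:R :> R by rewrite card_codom// card_ord.
    rewrite mulr_natl -sumr_const.
    apply: ler_sum => k /codomP[i ->]; have /andP[h _] := fP i.
    by apply: le_trans (ltW h); rewrite lerDl mulr_ge0// ltW.
  by rewrite /N -(natr1 (3 * n)%N) natrM => h; exfalso; lra.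
have jN : (j%:R : R) <= 3 * n%:R by rewrite -natrM ler_nat -ltnS.
have wE : w * (9 * n.+1%:R) = 1.
  by rewrite mulVf// mulf_neq0// ?pnatr_eq0.
have jw : j%:R * w <= 3 * n%:R * w by rewrite ler_wpM2r// ltW.
have n0 : 0 <= n%:R :> R by [].
have jw0 : 0 <= j%:R * w by rewrite mulr_ge0// ltW.
rewrite -(natr1 n) in wE.
exists (3^-1 + j.+1%:R * w); rewrite -(natr1 j); split; [lra|lra|].
move=> k kj; have := j0 k; rewrite /inter /= -(natr1 j) kj andbT => /negbT.
by rewrite -leNgt mulrDl mul1r addrA addrK.
Qed.

(** Eigenvalue counting.  With lam k the eigenvalues of a positive contraction of trace n
and c k the squared norms of the components of a projection of rank n, an almost
maximal overlap forces both the rank of the spectral part above theta and its overlap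
with the projection to be almost n. *)
Lemma spectral_counting (K : finType) (lam c : K -> R) (n tau theta : R) :
  (forall k, 0 <= lam k <= 1) -> (forall k, 0 <= c k <= 1) ->
  \sum_k lam k = n -> \sum_k c k = n -> n - tau <= \sum_k lam k * c k ->
  3^-1 <= theta -> theta <= 2 / 3 ->
  let Q := [pred k | theta <= lam k] in
  [/\ \sum_(k | ~~ Q k) c k <= 3 * tau, n - 3 * tau <= \sum_(k | Q k) c k &
      n - 3 * tau <= #|Q|%:R <= n + 3 * tau].
Proof.
move=> lam01 c01 lamn cn lc t1 t2 Q.
have outQ : \sum_(k | ~~ Q k) c k <= 3 * tau.
  apply: le_trans (_ : \sum_k 3 * ((1 - lam k) * c k) <= _).
    rewrite big_mkcond /=; apply: ler_sum => k _.
    have /andP[l0 l1] := lam01 k; have /andP[c0 c1] := c01 k.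
    case: ifP => [|_]; last by rewrite !mulr_ge0// subr_ge0.
    by rewrite -ltNge => lt; nra.
  rewrite -mulr_sumr ler_wpM2l//.
  under eq_bigr do rewrite mulrBl mul1r.
  by rewrite sumrB cn; lra.
have inQ : \sum_(k | Q k) c k = n - \sum_(k | ~~ Q k) c k.
  by rewrite -cn [X in _ = X - _](bigID Q)/= addrK.
have cardQ : #|Q|%:R = \sum_(k | Q k) c k + \sum_(k | Q k) (1 - c k).
  rewrite -big_split /= -sum1_card natr_sum; apply: eq_bigr => k _.
  by rewrite addrC subrK.
have restQ : 0 <= \sum_(k | Q k) (1 - c k) <= 3 * tau.
  apply/andP; split.
    by apply: sumr_ge0 => k _; rewrite subr_ge0; have /andP[] := c01 k.
  apply: le_trans (_ : \sum_k 3 * (lam k * (1 - c k)) <= _).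
    rewrite big_mkcond /=; apply: ler_sum => k _.
    have /andP[l0 l1] := lam01 k; have /andP[c0 c1] := c01 k.
    case: ifP => [|_]; last by rewrite !mulr_ge0// subr_ge0.
    by move=> lt; nra.
  rewrite -mulr_sumr ler_wpM2l//.
  under eq_bigr do rewrite mulrBr mulr1.
  by rewrite sumrB lamn; lra.
have out0 : 0 <= \sum_(k | ~~ Q k) c k.
  by apply: sumr_ge0 => k _; have /andP[] := c01 k.
have /andP[r1 r2] := restQ.
by split; [exact: outQ|lra|rewrite cardQ; apply/andP; split; lra].
Qed.

End SpectralSelection.

(** * The mean projection of an approximate homomorphism *)

Section ConvolutionOperator.
Variables (R : realType) (Gamma : groupType).
Local Notation C := R[i].
Variables (I : finType) (y : I -> Gamma).
Hypothesis I0 : (0 < #|I|)%N.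
Variables (n : nat) (phi : Gamma -> 'M[C]_n).
Hypothesis phiU : forall g, phi g \is unitarymx.

Local Notation D := #|{: I * 'I_n}|.
Local Notation average := (average y).
Local Notation raverage := (raverage y).
Local Notation stack := (stack y).

(** The relation phi z * translate z = phi holds up to the defect of phi, so that the
translates span nearly the same n-dimensional space of functions.  The average of the
projections onto these spans has trace n and is therefore close to one projection. *)
Definition translate (z x : Gamma) : 'M[C]_n := phi (z^-1 * x)%g.
Definition mean_projection : 'M[C]_D :=
  average (fun z => (stack (translate z))^t* *m stack (translate z)).
Local Notation M := mean_projection.
Local Notation V := (stack phi).

Lemma stack_unitary (G : Gamma -> 'M[C]_n) : (forall x, G x \is unitarymx) ->
  stack G \is unitarymx.
Proof.
move=> Gu; apply/unitarymxP; rewrite (stack_mul y I0) -[RHS](average_cst y I0).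
by apply: eq_average => x; exact: (unitarymxP (Gu x)).
Qed.

Lemma translate_unitary z : stack (translate z) \is unitarymx.
Proof. by apply: stack_unitary => x; exact: phiU. Qed.

Lemma mulmx_mean_projection p (X : 'M[C]_(p, D)) :
  X *m M = average (fun z => X *m (stack (translate z))^t* *m stack (translate z)).
Proof. by rewrite -average_mull; apply: eq_average => z; rewrite mulmxA. Qed.

Lemma mean_projection_hermitian : M^t* = M.
Proof.
rewrite -average_trmxC; apply: eq_average => z.
by rewrite trmxC_mul trmxCK.
Qed.

Lemma mxdot_mean_projection p (X : 'M[C]_(p, D)) :
  mxdot (X *m M) X = raverage (fun z =>
    mxdot (X *m (stack (translate z))^t*) (X *m (stack (translate z))^t*)).
Proof.
rewrite mxdot_trE mulmx_mean_projection -average_mulr Re_tr_average.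
rewrite /raverage; congr (_ * _); apply: eq_bigr => i _.
by rewrite mxdot_trE trmxC_mul trmxCK !mulmxA.
Qed.

(** The eigenvalue of a unit vector u is the average of the squared norms of its
projections on the translates; summed over an orthonormal basis these give the trace. *)
Lemma mean_projection_spectrum : exists (U : 'M[C]_D) (lam : 'I_D -> R),
  [/\ U \is unitarymx, U *m M = diag_mx (\row_k (lam k)%:C%C) *m U,
      forall k, 0 <= lam k <= 1 & \sum_k lam k = n%:R].
Proof.
have [U [d [Uu ME]]] := spectral_decomposition (hermitian_normal mean_projection_hermitian).
have UM : U *m M = diag_mx d *m U by rewrite ME !mulmxA (unitarymxP Uu) mul1mx.
have rowU k : row k U \is unitarymx.
  apply/unitarymxP/matrixP => a b; rewrite !ord1.
  have /unitarymxP/matrixP/(_ k k) := Uu; rewrite !mxE !eqxx => <-.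
  by apply: eq_bigr => j _; rewrite !mxE.
pose A k z := row k U *m (stack (translate z))^t*.
pose lam k := raverage (fun z => mxdot (A k z) (A k z)).
have rowUM k : row k U *m M = d 0 k *: row k U.
  by rewrite -row_mul UM row_mul row_diag_mx -scalemxAl -rowE.
have dE k : d 0 k = (lam k)%:C%C.
  have : row k U *m M *m (row k U)^t* = ((lam k)%:C%C)%:M.
    rewrite mulmx_mean_projection -average_mulr.
    have -> : ((lam k)%:C%C)%:M = average (fun z => ((mxdot (A k z) (A k z))%:C%C)%:M) :> 'M[C]_1.
      rewrite /average /lam /raverage rmorphM rmorph_sum /= -scale_scalar_mx.
      by congr (_ *: _); rewrite rmorph_sum.
    apply: eq_average => z; rewrite -mulmx_trmxC_row /A trmxC_mul trmxCK.
    by rewrite !mulmxA.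
  rewrite rowUM -scalemxAl (unitarymxP (rowU k)) => /matrixP/(_ 0 0).
  by rewrite !mxE eqxx mulr1.
exists U, lam; split => //.
- by rewrite UM; congr (diag_mx _ *m _); apply/rowP => k; rewrite !mxE dE.
- move=> k; apply/andP; split.
    by apply: raverage_ge => // z; exact: mxdot_ge0.
  apply: raverage_le => // z; rewrite -[1](expr1n _ 2); apply: mxdot_frob_le.
  apply: le_trans (contraction_trmxC (contraction_unitary (translate_unitary z)) _) _.
  by rewrite frob_unitary// sqrtr1.
- rewrite /lam /raverage -mulr_sumr exchange_big /=.
  rewrite -[RHS](mulKf (lt0r_neq0 (_ : 0 < #|I|%:R))) ?ltr0n//; congr (_ * _).
  have -> : #|I|%:R * n%:R = \sum_(i : I) (n%:R : R) by rewrite sumr_const mulr_natl.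
  apply: eq_bigr => i _.
  rewrite -(mxdot_unitary (translate_unitary (y i))) -mxdot_trmxC.
  have -> : mxdot ((stack (translate (y i)))^t*) ((stack (translate (y i)))^t*) =
     mxdot (U *m (stack (translate (y i)))^t*) (U *m (stack (translate (y i)))^t*).
    by rewrite [RHS]mxdot_mulr mulmxA (unitarymxPr Uu) mul1mx.
  by rewrite [RHS]mxdot_rows; apply: eq_bigr => k _; rewrite row_mul.
Qed.

Variable e : R.
Hypothesis e01 : 0 <= e <= 1.
Hypothesis phiM : forall g h,
  frob (phi g *m phi h - phi (g * h)%g) <= e * Num.sqrt n%:R.

Lemma overlap_close z : frob (V *m (stack (translate z))^t* - phi z) <= e * Num.sqrt n%:R.
Proof.
rewrite (stack_mul y I0) -[X in frob (_ - X)](average_cst y I0) -averageB.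
apply: frob_average => // x; rewrite /translate.
have -> : phi x *m (phi (z^-1 * x)%g)^t* - phi z =
    (phi x - phi z *m phi (z^-1 * x)%g) *m (phi (z^-1 * x)%g)^t*.
  by rewrite mulmxBl mulmxtVK.
rewrite (frob_isomr _ (unitarymx_trmxC (phiU _))) frobC.
by have := phiM z (z^-1 * x)%g; rewrite mulgA mulgV mul1g.
Qed.

Fact overlap_arith (s t u d : R) : 0 <= d -> d <= 1 -> 0 <= t -> 0 <= s ->
  s ^+ 2 = u -> s <= t + d * s -> u - 2 * d * u <= t ^+ 2.
Proof.
move=> d0 d1 t0 s0 <- h.
have a1 : 0 <= (1 - d) * s by rewrite mulr_ge0// subr_ge0.
have a2 : (1 - d) * s <= t by lra.
have : ((1 - d) * s) ^+ 2 <= t ^+ 2 by rewrite ler_sqr ?nnegrE.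
apply: le_trans; rewrite exprMn; have : 0 <= s ^+ 2 by exact: sqr_ge0.
move: (s ^+ 2) => q q0; nra.
Qed.

(** The translate by z sees phi through a matrix close to the unitary phi z, which has
squared norm n. *)
Lemma overlap_large : n%:R - 2 * e * n%:R <= mxdot (V *m M) V.
Proof.
rewrite mxdot_mean_projection; apply: raverage_ge => // z.
rewrite -[mxdot _ _]frob_sqr; case/andP: e01 => e0 e1.
apply: (overlap_arith e0 e1 (frob_ge0 _) (sqrtr_ge0 n%:R)); first by rewrite sqr_sqrtr.
rewrite -{1}(frob_unitary (phiU z)).
apply: le_trans (frob_le_add _ (V *m (stack (translate z))^t*)) _.
by rewrite lerD2l frobC overlap_close.
Qed.

End ConvolutionOperator.

(** * The spectral part of the mean projection *)

Section ApproximateDilation.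
Variables (R : realType) (Gamma : groupType).
Local Notation C := R[i].

Lemma frob_entry_scale m n (W A B : 'M[C]_(m, n)) (a b : 'I_m -> 'I_n -> R) (c : R) : 0 <= c ->
  (forall r k, A r k = (a r k)%:C%C * W r k) -> (forall r k, B r k = (b r k)%:C%C * W r k) ->
  (forall r k, `|a r k| <= c * `|b r k|) -> frob A <= c * frob B.
Proof.
move=> c0 AE BE ab; apply: frob_le; first by rewrite mulr_ge0// frob_ge0.
rewrite exprMn frob_sqr !mxdotE mulr_sumr; apply: ler_sum => r _.
rewrite mulr_sumr; apply: ler_sum => k _; rewrite AE BE.
have : a r k ^+ 2 <= c ^+ 2 * b r k ^+ 2.
  rewrite -[a r k ^+ 2]real_normK ?num_real// -[b r k ^+ 2]real_normK ?num_real//.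
  by rewrite -exprMn ler_sqr ?nnegrE ?mulr_ge0.
case: (W r k) => u v /=; rewrite !mul0r !subr0 !addr0.
move: (a r k) (b r k) (c ^+ 2) => s t q h.
have := ler_wpM2r (sqr_ge0 u) h; have := ler_wpM2r (sqr_ge0 v) h; lra.
Qed.

Variables (I : finType) (y : I -> Gamma).
Hypothesis I0 : (0 < #|I|)%N.
Variables (n : nat) (phi : Gamma -> 'M[C]_n).
Hypothesis phiU : forall g, phi g \is unitarymx.
Variable e : R.
Hypothesis e01 : 0 <= e <= 1.
Hypothesis phiM : forall g h,
  frob (phi g *m phi h - phi (g * h)%g) <= e * Num.sqrt n%:R.

Local Notation D := #|{: I * 'I_n}|.
Local Notation average := (average y).
Local Notation raverage := (raverage y).
Local Notation stack := (stack y).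
Local Notation translate := (translate phi).
Local Notation M := (mean_projection y phi).
Local Notation V := (stack phi).

(** The rows of B are the eigenvectors of the mean projection with eigenvalue above a gap
of its spectrum.  The gap, of size 1 / (9 (n + 1)), makes the last inequality
quantitative: approximate eigenvectors with eigenvalues mu lie close to the span of B. *)
Lemma spectral_part : exists (m : nat) (B : 'M[C]_(m, D)) (mu : 'I_m -> R),
  [/\ B \is unitarymx, B *m M = diag_mx (\row_r (mu r)%:C%C) *m B,
      forall r, 3^-1 <= mu r,
      n%:R - 6 * e * n%:R <= m%:R <= n%:R + 6 * e * n%:R &
      n%:R - 6 * e * n%:R <= mxdot (V *m B^t*) (V *m B^t*) /\
      forall X : 'M[C]_(m, D), frob (X - X *m B^t* *m B) <=
        9 * n.+1%:R * frob (diag_mx (\row_r (mu r)%:C%C) *m X - X *m M)].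
Proof.
have [U [lam [Uu UM lam01 lamn]]] := mean_projection_spectrum y I0 phiU.
pose c k := mxdot (row k (U *m V^t*)) (row k (U *m V^t*)).
have Vu : V \is unitarymx := stack_unitary y I0 phiU.
have cn : \sum_k c k = n%:R.
  rewrite -mxdot_rows mxdot_mulr mulmxA (unitarymxPr Uu) mul1mx mxdot_trmxC.
  exact: mxdot_unitary.
have rowU k : frob (row k U) = 1.
  rewrite frob_unitary ?sqrtr1//; apply/unitarymxP/matrixP => a b; rewrite !ord1.
  have /unitarymxP/matrixP/(_ k k) := Uu; rewrite !mxE !eqxx => <-.
  by apply: eq_bigr => j _; rewrite !mxE.
have c01 k : 0 <= c k <= 1.
  rewrite mxdot_ge0 /= -[1](expr1n _ 2) /c row_mul; apply: mxdot_frob_le.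
  rewrite -(rowU k); exact: (contraction_trmxC (contraction_unitary Vu)).
have lamc : \sum_k lam k * c k = mxdot (V *m M) V.
  rewrite -mxdot_trmxC trmxC_mul mean_projection_hermitian.
  have -> : mxdot (M *m V^t*) (V^t*) = mxdot (U *m M *m V^t*) (U *m V^t*).
    by rewrite -mulmxA [RHS]mxdot_mulr mulmxA (unitarymxPr Uu) mul1mx.
  rewrite UM -mulmxA mxdot_rows; apply: eq_bigr => k _.
  by rewrite [row k (diag_mx _ *m _)]row_mul row_diag_mx -scalemxAl -rowE mxE mxdotZl.
have [theta [th1 th2 gap]] := exists_gap (fun k => (andP (lam01 k)).1) lamn.
have lcn : n%:R - 2 * e * n%:R <= \sum_k lam k * c k.
  by rewrite lamc; exact: overlap_large.
have [outQ inQ cardQ] := spectral_counting lam01 c01 lamn cn lcn th1 th2.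
set Q := [pred k | theta <= lam k] in outQ inQ cardQ.
have six : 3 * (2 * e * n%:R) = 6 * e * n%:R :> R by ring.
rewrite six in outQ inQ cardQ.
pose B := rowsub (@enum_val _ Q) U; pose mu r := lam (@enum_val _ Q r).
have Bu : B \is unitarymx.
  apply/unitarymxP/matrixP => r s; rewrite !mxE -(inj_eq enum_val_inj).
  have /unitarymxP/matrixP/(_ (enum_val r) (enum_val s)) := Uu; rewrite !mxE => <-.
  by apply: eq_bigr => j _; rewrite !mxE.
exists #|Q|, B, mu; split => //.
- have -> : B *m M = rowsub (@enum_val _ Q) (U *m M).
    by apply/matrixP => r d; rewrite !mxE; apply: eq_bigr => j _; rewrite !mxE.
  by rewrite UM !mul_diag_mx; apply/matrixP => r d; rewrite !mxE.
- by move=> r; have := enum_valP r; rewrite inE; exact: le_trans.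
split.
  apply: le_trans inQ _; rewrite -mxdot_trmxC trmxC_mul trmxCK mxdot_rows.
  rewrite big_enum_val /=; apply: ler_sum => r _; rewrite /c /B !row_mul row_rowsub.
  exact: lexx.
move=> X; pose W := X *m U^t*.
have Ucu := unitarymx_trmxC Uu.
pose q := diag_mx (\row_k ((Q k)%:R : C)).
have BB : B^t* *m B = U^t* *m q *m U.
  have -> : B = rowsub (@enum_val _ Q) 1%:M *m U.
    by rewrite mul_rowsub_mx mul1mx.
  rewrite trmxC_mul -!mulmxA; congr (_ *m _); rewrite mulmxA; congr (_ *m _).
  apply/matrixP => k l; rewrite !mxE.
  under eq_bigr do rewrite !mxE rmorph_nat.
  rewrite -(big_enum_val (fun x => (x == k)%:R * (x == l)%:R : C)) /=.
  rewrite big_mkcond /= (bigD1 k)//= big1 ?addr0; last first.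
    by move=> x xk; rewrite (negPf xk) mul0r if_same.
  rewrite eqxx mul1r /= -[k \in _]/(theta <= lam k).
  by case: (theta <= lam k); rewrite ?mul0rn.
have -> : frob (X - X *m B^t* *m B) = frob (W - W *m q).
  rewrite -(frob_isomr _ Ucu) mulmxBl -!mulmxA [B^t* *m (B *m _)]mulmxA BB.
  by rewrite -[_ *m U *m U^t*]mulmxA (unitarymxP Uu) mulmx1 !mulmxA.
have -> : frob (diag_mx (\row_r (mu r)%:C%C) *m X - X *m M) =
    frob (diag_mx (\row_r (mu r)%:C%C) *m W - W *m diag_mx (\row_k (lam k)%:C%C)).
  rewrite -(frob_isomr _ Ucu) mulmxBl -!mulmxA.
  have -> : M *m U^t* = U^t* *m diag_mx (\row_k (lam k)%:C%C).
    rewrite -[M]mul1mx -(unitarymxPr Uu) -[U^t* *m U *m M]mulmxA UM.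
    by rewrite -!mulmxA (unitarymxP Uu) mulmx1.
  by rewrite !mulmxA.
clearbody W.
apply: (@frob_entry_scale _ _ W _ _ (fun r k => 1 - (Q k)%:R) (fun r k => mu r - lam k)).
- by rewrite mulr_ge0.
- move=> r k; rewrite mul_mx_diag !mxE rmorphB rmorph1 rmorph_nat.
  by rewrite mulrBl mul1r [_ * (W r k)]mulrC.
- move=> r k; rewrite mul_mx_diag mul_diag_mx !mxE rmorphB /= mulrBl.
  by congr (_ - _); rewrite mulrC.
- move=> r k; have mur : theta <= mu r by have := enum_valP r; rewrite inE.
  have [Qk|nQk] := boolP (Q k); first by rewrite subrr normr0 !mulr_ge0.
  have /gap lk : lam k < theta by rewrite ltNge.
  rewrite subr0 normr1 -ler_pdivrMl ?mulr_gt0// mulr1.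
  apply: le_trans (ler_norm _); have := lerB mur lk.
  by rewrite opprB addrC subrK.
Qed.

End ApproximateDilation.

(** * Approximate dilations *)

Fact compression_telescope (V : zmodType) (a p x v : V) :
  a - p = v - p - (v - x) - (x - a).
Proof. by rewrite !opprB [v - p + _]addrC [x - v + _]addrA subrK [RHS]addrC addrA subrK. Qed.

Section ApproximateRepresentation.
Variables (R : realType) (Gamma : groupType).
Local Notation C := R[i].
Variables (I : finType) (y : I -> Gamma).
Hypothesis I0 : (0 < #|I|)%N.
Variables (n : nat) (phi : Gamma -> 'M[C]_n).
Hypothesis phiU : forall g, phi g \is unitarymx.
Variable e : R.
Hypothesis e01 : 0 <= e <= 1.
Hypothesis phiM : forall g h,
  frob (phi g *m phi h - phi (g * h)%g) <= e * Num.sqrt n%:R.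

Local Notation D := #|{: I * 'I_n}|.
Local Notation average := (average y).
Local Notation stack := (stack y).
Local Notation translate := (translate phi).
Local Notation M := (mean_projection y phi).
Local Notation V := (stack phi).
Local Notation invariant := (@almost_invariant R Gamma I y).

Section Dilation.
Variables (m : nat) (B : 'M[C]_(m, D)) (mu : 'I_m -> R) (c : R).
Local Notation Lmu := (diag_mx (\row_r (mu r)%:C%C)).
Hypotheses (Bu : B \is unitarymx) (BM : B *m M = Lmu *m B) (mu13 : forall r, 3^-1 <= mu r).
Hypothesis mc : 3 * Num.sqrt m%:R <= c.

Let c0 : 0 <= c.
Proof. by apply: le_trans mc; rewrite mulr_ge0 ?sqrtr_ge0. Qed.
Let mc1 : Num.sqrt m%:R <= c.
Proof. by apply: le_trans mc; have := sqrtr_ge0 (m%:R : R); lra. Qed.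
Let mu_neq0 r : mu r != 0.
Proof. by rewrite gt_eqF// (lt_le_trans _ (mu13 r))// invr_gt0. Qed.

(** The eigenfunctions, extended from the sample points y to the whole group by the
eigenvalue equation. *)
Definition eigenfunction (x : Gamma) : 'M[C]_(m, n) :=
  diag_mx (\row_r ((mu r)^-1)%:C%C) *m
  average (fun z => B *m (stack (translate z))^t* *m translate z x).
Local Notation F := eigenfunction.
Local Notation Fsh h := (fun x => F (h * x)%g).

(** The matrix of the translation by h compressed to the span of the eigenfunctions; a
representation as soon as that span is invariant. *)
Definition dilation (h : Gamma) : 'M[C]_m := stack (Fsh h) *m B^t*.
Local Notation rho := dilation.

Lemma stack_eigenfunction : stack F = B.
Proof.
rewrite /eigenfunction stack_mull stack_average.
rewrite (eq_average _ (b := fun z => B *m (stack (translate z))^t* *m stack (translate z))).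
  rewrite -mulmx_mean_projection BM mulmxA mulmx_diag.
  rewrite (_ : \row_j _ = const_mx 1) ?diag_const_mx ?mul1mx//.
  by apply/rowP => r; rewrite !mxE -rmorphM /= mulVf.
by move=> z; rewrite stack_mull.
Qed.

Let frob_coeff z : frob (B *m (stack (translate z))^t*) <= c.
Proof.
apply: le_trans mc1; rewrite -(frob_unitary Bu).
exact: (contraction_trmxC (contraction_unitary (translate_unitary y I0 phiU z))).
Qed.

Lemma frob_eigenfunction x : frob (F x) <= c.
Proof.
apply: le_trans mc; rewrite -(frob_unitary Bu).
pose A := average (fun z => B *m (stack (translate z))^t* *m translate z x).
have fA : frob A <= frob B.
  apply: (frob_average y I0) => z; rewrite (frob_isomr _ (phiU _)).
  exact: (contraction_trmxC (contraction_unitary (translate_unitary y I0 phiU z))).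
have : frob (F x) <= 3 * frob A.
  apply: (@frob_entry_scale _ _ _ A _ _ (fun r k => (mu r)^-1) (fun r k => 1)) => //.
  - by move=> r k; rewrite /eigenfunction -/A mul_diag_mx !mxE.
  - by move=> r k; rewrite mul1r.
  - move=> r k; rewrite normr1 mulr1 normfV ger0_norm; last first.
      by apply: le_trans (mu13 r); rewrite invr_ge0.
    rewrite -[3]invrK lef_pV2// posrE ?invr_gt0//.
    by apply: lt_le_trans (mu13 r); rewrite invr_gt0.
by move/le_trans; apply; rewrite ler_wpM2l.
Qed.

Lemma translate_shift h z x : translate (h * z)%g (h * x)%g = translate z x.
Proof.
congr (phi _).
by rewrite invgM -!mulgA [(h^-1 * _)%g]mulgA mulVg mul1g.
Qed.

Section Shift.
Variables (h : Gamma) (eta : R).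
Hypothesis inv_h : invariant h eta.

(** The mean projection commutes with translations up to the defect of invariance of the
mean: translating F by h amounts to translating both the integration variable z and
the variable of the inner products. *)
Lemma shifted_eigenfunction :
  frob (Lmu *m stack (Fsh h) - stack (Fsh h) *m M) <= 2 * (c * eta).
Proof.
pose Ch z := stack (Fsh h) *m (stack (translate z))^t*.
pose a z x := B *m (stack (translate z))^t* *m translate z x.
have LF x : Lmu *m F x = average (fun z => a z x).
  rewrite /eigenfunction mulmxA mulmx_diag (_ : \row_j _ = const_mx 1) ?diag_const_mx ?mul1mx//.
  by apply/rowP => r; rewrite !mxE -rmorphM /= mulfV.
have CM : stack (Fsh h) *m M = stack (fun x => average (fun z => Ch z *m translate z x)).
  rewrite mulmx_mean_projection stack_average; apply: eq_average => z.
  by rewrite stack_mull.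
rewrite CM -stack_mull -stackB; apply: (frob_stack y I0) => x.
rewrite LF; apply: le_trans (frob_dist_trans (average (fun z => a (h * z)%g (h * x)%g)) _ _) _.
rewrite mulr_natl mulr2n; apply: lerD.
  rewrite frobC; apply: (inv_h (a := fun z => a z (h * x)%g)) => z.
  by rewrite /a (frob_isomr _ (phiU _)); exact: frob_coeff.
rewrite -averageB; apply: (frob_average y I0) => z.
rewrite /a translate_shift -mulmxBl (frob_isomr _ (phiU _)).
pose b x' := F x' *m (translate (h * z)%g x')^t*.
have -> : B *m (stack (translate (h * z)%g))^t* = average b.
  by rewrite -[X in X *m _]stack_eigenfunction (stack_mul y I0).
have -> : Ch z = average (fun x' => b (h * x')%g).
  rewrite /Ch (stack_mul y I0).
  by apply: eq_average => x'; rewrite /b translate_shift.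
rewrite frobC; apply: inv_h => x'; rewrite /b.
by rewrite (frob_isomr _ (unitarymx_trmxC (phiU _))) frob_eigenfunction.
Qed.

Hypothesis gapB : forall X : 'M[C]_(m, D), frob (X - X *m B^t* *m B) <=
  9 * n.+1%:R * frob (Lmu *m X - X *m M).

Lemma dilation_closure : frob (stack (Fsh h) - rho h *m B) <= 18 * n.+1%:R * c * eta.
Proof.
apply: le_trans (gapB _) _.
have -> : 18 * n.+1%:R * c * eta = 9 * n.+1%:R * (2 * (c * eta)) by ring.
by rewrite ler_wpM2l ?mulr_ge0// shifted_eigenfunction.
Qed.

End Shift.

Lemma frob_dilation g : frob (rho g) <= c.
Proof.
apply: le_trans (contraction_trmxC (contraction_unitary Bu) _) _.
by apply: (frob_stack y I0) => x; exact: frob_eigenfunction.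
Qed.

Lemma dilation1 : rho 1%g = 1%:M.
Proof.
rewrite /dilation (eq_stack _ (G' := F)); last by move=> x; rewrite mul1g.
by rewrite stack_eigenfunction; exact/unitarymxP.
Qed.

Lemma dilation_trmxC h eta : invariant h eta ->
  frob ((rho h)^t* - rho h^-1%g) <= c ^+ 2 * eta.
Proof.
move=> inv_h; pose a x := F (h^-1 * x)%g *m (F x)^t*.
have -> : (rho h)^t* = average (fun x => a (h * x)%g).
  rewrite /dilation trmxC_mul trmxCK -{1}stack_eigenfunction (stack_mul y I0).
  by apply: eq_average => x; rewrite /a mulgA mulVg mul1g.
have -> : rho h^-1%g = average a.
  by rewrite /dilation -{1}stack_eigenfunction (stack_mul y I0).
apply: inv_h => x; rewrite /a expr2; apply: le_trans (frobM _ _) _.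
by rewrite frob_trmxC; apply: ler_pM; rewrite ?frob_ge0 ?frob_eigenfunction.
Qed.

Hypothesis gapB : forall X : 'M[C]_(m, D), frob (X - X *m B^t* *m B) <=
  9 * n.+1%:R * frob (Lmu *m X - X *m M).

Let sqrt_ge (eta : R) : 0 <= eta -> eta <= 1 -> eta <= Num.sqrt eta.
Proof.
move=> eta0 eta1; rewrite -{1}[eta]sqr_sqrtr// expr2 ler_piMr ?sqrtr_ge0//.
by rewrite -sqrtr1 ler_wsqrtr.
Qed.

Let add_sqr_le (s t : R) (u v : R) : 0 <= u -> 0 <= v -> s <= u ^+ 2 -> t <= v ^+ 2 ->
  s + t <= (u + v) ^+ 2.
Proof. by move=> u0 v0 su tv; have := mulr_ge0 u0 v0; nra. Qed.

(** The function F (g x) - rho g F x is small in mean square by closure of the span of B,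
and so is its translate by h; its inner products with B give the defect of rho.
Invariance controls squared norms, whence the square root of eta. *)
Lemma dilation_mul g h eta : 0 <= eta -> eta <= 1 -> invariant g eta -> invariant h eta ->
  frob (rho (g * h)%g - rho g *m rho h) <=
  (18 * n.+1%:R * c + (c + c ^+ 2)) * Num.sqrt eta.
Proof.
move=> eta0 eta1 inv_g inv_h.
pose G x := F (g * x)%g - rho g *m F x.
have stG : stack (fun x => G (h * x)%g) = stack (Fsh (g * h)%g) - rho g *m stack (Fsh h).
  by rewrite -stack_mull -stackB; apply: eq_stack => x; rewrite /G mulgA.
have -> : rho (g * h)%g - rho g *m rho h = stack (fun x => G (h * x)%g) *m B^t*.
  by rewrite stG mulmxBl -[rho g *m _ *m _]mulmxA.
apply: le_trans (contraction_trmxC (contraction_unitary Bu) _) _.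
have fG x : frob (G x) <= c + c ^+ 2.
  apply: le_trans (frob_triangleB _ _) _; apply: lerD; first exact: frob_eigenfunction.
  apply: le_trans (frobM _ _) _; rewrite expr2.
  by apply: ler_pM; rewrite ?frob_ge0 ?frob_eigenfunction ?frob_dilation.
have cc0 : 0 <= c + c ^+ 2 by rewrite addr_ge0// exprn_ge0.
rewrite mulrDl; apply: frob_le.
  by rewrite addr_ge0// mulr_ge0 ?sqrtr_ge0// !mulr_ge0.
apply: le_trans (mxdot_stack_shift I0 inv_h fG) _.
apply: add_sqr_le; rewrite ?mulr_ge0 ?sqrtr_ge0//.
  apply: mxdot_frob_le; rewrite /G stackB stack_mull stack_eigenfunction.
  apply: le_trans (dilation_closure inv_g gapB) _.
  by rewrite ler_wpM2l ?sqrt_ge// !mulr_ge0.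
by rewrite exprMn sqr_sqrtr.
Qed.

Let regroup (a w v k u : R) : a + (w + v * u) + k * u = w + a + (k + v) * u.
Proof. ring. Qed.

(** Decomposing phi as X F + G with G orthogonal to the span of B and of squared norm at
most 6 e n, the translate of phi by h has inner product close to phi h with phi, while
its component in the span of B is moved by rho h. *)
Lemma dilation_compression h eta : 0 <= eta -> eta <= 1 -> invariant h eta ->
  n%:R - 6 * e * n%:R <= mxdot (V *m B^t*) (V *m B^t*) ->
  frob (V *m B^t* *m rho h *m (V *m B^t*)^t* - phi h) <=
   Num.sqrt (6 * e * n%:R) + e * Num.sqrt n%:R +
   (18 * n.+1%:R * c + (Num.sqrt n%:R + c)) * Num.sqrt eta.
Proof.
move=> eta0 eta1 inv_h VB.
have Vu : V \is unitarymx := stack_unitary y I0 phiU.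
have cB := contraction_trmxC (contraction_unitary Bu).
have cV := contraction_unitary Vu.
pose X := V *m B^t*.
have cX : contraction X by apply: contraction_mul.
have n0 : 0 <= 6 * e * n%:R by rewrite !mulr_ge0//; case/andP: e01.
pose G x := phi x - X *m F x.
have fG x : frob (G x) <= Num.sqrt n%:R + c.
  apply: le_trans (frob_triangleB _ _) _; rewrite (frob_unitary (phiU x)) lerD2l.
  by apply: le_trans (contraction_frob_mull _ cX) _; exact: frob_eigenfunction.
have GG : mxdot (stack G) (stack G) <= 6 * e * n%:R.
  rewrite /G stackB stack_mull stack_eigenfunction.
  have orth : mxdot (X *m B) (V - X *m B) = 0.
    rewrite mxdot_mull mulmxBl (mulmxtVK _ Bu) subrr.
    by rewrite mxdot0r.
  have := mxdot_pythagoras orth; rewrite [X *m B + _]addrC subrK mxdot_unitary//.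
  by rewrite mxdot_isomr// -/X => h1; rewrite -(lerD2l (mxdot X X)) -h1 -lerBlDr.
have stG : frob (stack (fun x => G (h * x)%g)) <=
    Num.sqrt (6 * e * n%:R) + (Num.sqrt n%:R + c) * Num.sqrt eta.
  have nc : 0 <= Num.sqrt n%:R + c by rewrite addr_ge0 ?sqrtr_ge0.
  apply: frob_le; first by rewrite addr_ge0 ?mulr_ge0 ?sqrtr_ge0.
  apply: le_trans (mxdot_stack_shift I0 inv_h fG) _.
  apply: add_sqr_le; rewrite ?mulr_ge0 ?sqrtr_ge0 ?sqr_sqrtr//.
  by rewrite exprMn sqr_sqrtr.
have cl : frob (stack (Fsh h) - rho h *m B) <= 18 * n.+1%:R * c * Num.sqrt eta.
  apply: le_trans (dilation_closure inv_h gapB) _.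
  by rewrite ler_wpM2l ?sqrt_ge// !mulr_ge0.
have ph : frob (stack (fun x => phi (h * x)%g) *m V^t* - phi h) <= e * Num.sqrt n%:R.
  rewrite (stack_mul y I0) -[X in frob (_ - X)](average_cst y I0) -averageB.
  apply: (frob_average y I0) => x.
  have -> : phi (h * x)%g *m (phi x)^t* - phi h = (phi (h * x)%g - phi h *m phi x) *m (phi x)^t*.
    by rewrite mulmxBl (mulmxtVK _ (phiU x)).
  by rewrite (frob_isomr _ (unitarymx_trmxC (phiU x))) frobC.
have cVt := contraction_trmxC cV.
rewrite -/X trmxC_mul trmxCK.
have -> : X *m rho h *m (B *m V^t*) - phi h =
   (stack (fun x => phi (h * x)%g) *m V^t* - phi h) - stack (fun x => G (h * x)%g) *m V^t*
    - X *m (stack (Fsh h) - rho h *m B) *m V^t*.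
  have -> : stack (fun x => G (h * x)%g) *m V^t* =
      stack (fun x => phi (h * x)%g) *m V^t* - X *m stack (Fsh h) *m V^t*.
    by rewrite /G stackB stack_mull mulmxBl.
  have -> : X *m (stack (Fsh h) - rho h *m B) *m V^t* =
      X *m stack (Fsh h) *m V^t* - X *m rho h *m (B *m V^t*).
    by rewrite mulmxBr mulmxBl !mulmxA.
  exact: compression_telescope.
apply: le_trans (frob_triangleB _ _) _.
have t2 := le_trans (cVt _ (stack (fun x => G (h * x)%g))) stG.
have t3 := le_trans (le_trans (cVt _ _) (contraction_frob_mull (stack (Fsh h) - rho h *m B) cX)) cl.
have t1 := le_trans (frob_triangleB _ _) (lerD ph t2).
apply: le_trans (lerD t1 t3) _.
by rewrite regroup.
Qed.

End Dilation.

End ApproximateRepresentation.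

(** * Passing to the limit: exact dilations *)

Section ExactDilation.
Variables (R : realType) (Gamma : groupType).
Local Notation C := R[i].

(** Amenability in the form of a Reiter sequence, with finitely supported means given by
finite families of points. *)
Definition reiter_sequence (I : nat -> finType) (y : forall N, I N -> Gamma) :=
  (forall N, (0 < #|I N|)%N) /\
  forall (h : Gamma) (eta : R), 0 < eta ->
    exists N0, forall N, (N0 <= N)%N -> almost_invariant (R := R) (y N) h eta.

Lemma frobE m n (A : 'M[C]_(m, n)) : frob A = Num.sqrt (mxdot A A).
Proof. by rewrite -frob_sqr sqrtr_sqr ger0_norm// frob_ge0. Qed.

Variables (I : nat -> finType) (y : forall N, I N -> Gamma).
Hypothesis reiter : reiter_sequence y.
Variables (n : nat) (phi : Gamma -> 'M[C]_n).
Hypothesis phiU : forall g, phi g \is unitarymx.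
Variable e : R.
Hypothesis e01 : 0 <= e <= 1.
Hypothesis phiM : forall g h,
  frob (phi g *m phi h - phi (g * h)%g) <= e * Num.sqrt n%:R.

(** A bound, uniform in N, on the eigenfunctions: the dimension is at most 7 n and the
eigenvalues that are inverted are at least 1/3. *)
Let c : R := 3 * Num.sqrt (7 * n)%:R.
Let K : R := 18 * n.+1%:R * c + c + c ^+ 2 + Num.sqrt n%:R.
Let c0 : 0 <= c. Proof. by rewrite mulr_ge0// sqrtr_ge0. Qed.
Let K0 : 0 <= K.
Proof. by rewrite /K !addr_ge0 ?mulr_ge0 ?exprn_ge0 ?sqrtr_ge0. Qed.

(** What survives at a finite stage N, for a single dimension m. *)
Let approximate N m (rX : (Gamma -> 'M[C]_m) * 'M[C]_(n, m)) : Prop :=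
  let: (rho, X) := rX in
  [/\ m%:R <= n%:R + 6 * e * n%:R, contraction X, n%:R - 6 * e * n%:R <= mxdot X X,
      rho 1%g = 1%:M /\ (forall g, frob (rho g) <= c) &
  forall g h eta, 0 <= eta -> eta <= 1 ->
    almost_invariant (R := R) (@y N) g eta -> almost_invariant (R := R) (@y N) h eta ->
  [/\ frob (rho (g * h)%g - rho g *m rho h) <= K * Num.sqrt eta,
      frob ((rho h)^t* - rho h^-1%g) <= K * Num.sqrt eta &
      frob (X *m rho h *m X^t* - phi h) <=
        Num.sqrt (6 * e * n%:R) + e * Num.sqrt n%:R + K * Num.sqrt eta]].

Let summands (a b d s : R) : 0 <= a -> 0 <= b -> 0 <= d -> 0 <= s ->
  [/\ a + (b + d) <= a + b + d + s, d <= a + b + d + s & a + (s + b) <= a + b + d + s].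
Proof. by move=> *; split; lra. Qed.

Lemma approximate_exists N : exists2 m, (m <= 7 * n)%N & exists rX, @approximate N m rX.
Proof.
have I0 := reiter.1 N.
have [m [B [mu [Bu BM mu13 /andP[mn1 mn2] [VB gapB]]]]] := spectral_part (@y N) I0 phiU e01 phiM.
have /andP[e0 e1] := e01.
have m7 : (m <= 7 * n)%N.
  rewrite -(ler_nat R); apply: le_trans mn2 _; rewrite natrM.
  by have : 0 <= n%:R :> R by []; nra.
exists m => //.
have mc : 3 * Num.sqrt m%:R <= c by rewrite ler_wpM2l// ler_wsqrtr// ler_nat.
have cV := contraction_unitary (stack_unitary (@y N) I0 phiU).
exists (dilation (@y N) phi B mu, stack (@y N) phi *m B^t*); split => //.
- by apply: contraction_mul => //; exact: (contraction_trmxC (contraction_unitary Bu)).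
- split; first exact: (dilation1 Bu BM mu13).
  by move=> g; exact: (frob_dilation (@y N) I0 phiU Bu mu13 mc).
move=> g h eta eta0 eta1 inv_g inv_h.
have s0 := sqrtr_ge0 eta; have n0 := sqrtr_ge0 (n%:R : R).
have nc0 : 0 <= 18 * n.+1%:R * c := mulr_ge0 (mulr_ge0 (ler0n _ _) (ler0n _ _)) c0.
have cc0 : 0 <= c ^+ 2 by rewrite exprn_ge0.
have [k1 k2 k3] := summands nc0 c0 cc0 n0.
split.
- apply: le_trans (dilation_mul I0 phiU Bu BM mu13 mc gapB eta0 eta1 inv_g inv_h) _.
  by rewrite ler_wpM2r.
- apply: le_trans (dilation_trmxC I0 phiU Bu BM mu13 mc inv_h) _.
  apply: ler_pM => //; rewrite -{1}[eta]sqr_sqrtr// expr2 ler_piMr//.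
  by rewrite -sqrtr1 ler_wsqrtr.
- apply: le_trans (dilation_compression I0 phiU e01 phiM Bu BM mu13 mc gapB eta0 eta1 inv_h VB) _.
  by rewrite lerD2l ler_wpM2r.
Qed.

(** The approximate dilations have dimension at most 7 n, so one dimension m occurs for
almost all stages N, and the limits along the ultrafilter satisfy the limiting
equations exactly. *)
Theorem exact_dilation : exists (m : nat) (rho : {multiplicative Gamma -> 'U[R]_m})
    (X : 'M[C]_(n, m)),
  [/\ m%:R <= n%:R + 6 * e * n%:R, contraction X, n%:R - 6 * e * n%:R <= mxdot X X &
   forall h, frob (X *m \val (rho h) *m X^t* - phi h) <=
        Num.sqrt (6 * e * n%:R) + e * Num.sqrt n%:R].
Proof.
have [U [Uu Uinf]] := exists_free_ultrafilter.
have [m Um] : exists m, U [set N | exists rX, @approximate N m rX]%classic.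
  apply: (@ultra_bounded_witness U Uu (7 * n)%N (fun m N => exists rX, @approximate N m rX)).
  by apply: filterS filterT => N _; have [m m7 Pm] := approximate_exists N; exists m.
pose w N := xget (fun=> 0, 0) [set rX | @approximate N m rX]%classic.
pose r N := (w N).1; pose Xs N := (w N).2.
have Uw : U [set N | @approximate N m (r N, Xs N)]%classic.
  apply: filterS Um => N /= [rX PX].
  have := @xgetPex _ (fun=> 0, 0) [set rX | @approximate N m rX]%classic (ex_intro _ rX PX).
  by rewrite /r /Xs /w; case: (xget _ _).
clearbody r Xs; clear w Um.
have small (h : Gamma) (d : R) : 0 < d -> exists eta, [/\ 0 <= eta, eta <= 1, K * Num.sqrt eta < d &
    U [set N | almost_invariant (R := R) (@y N) h eta]%classic].
  move=> d0; pose s := Num.min 1 (d / (K + 1)).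
  have K1 : 0 < K + 1 by rewrite ltr_wpDl.
  have s0 : 0 < s by rewrite lt_min ltr01 divr_gt0.
  have s1 : s <= 1 by rewrite ge_min lexx.
  exists (s ^+ 2); split; [exact: sqr_ge0|by rewrite expr_le1// ltW| |].
    rewrite sqrtr_sqr gtr0_norm//.
    apply: le_lt_trans (_ : K * (d / (K + 1)) < _).
      by rewrite ler_wpM2l// ge_min lexx orbT.
    by rewrite mulrA ltr_pdivrMr// mulrC ltr_pM2l// ltrDl.
  have [|N0 N0P] := reiter.2 h (s ^+ 2); first by rewrite exprn_gt0.
  by apply: filterS (Uinf N0) => N /N0P.
have small2 (g h : Gamma) (d : R) : 0 < d -> exists eta, [/\ 0 <= eta, eta <= 1, K * Num.sqrt eta < d &
    U [set N | almost_invariant (R := R) (@y N) g eta /\ almost_invariant (R := R) (@y N) h eta]%classic].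
  move=> d0; have [a [a0 a1 aK Ua]] := small g d d0; have [b [b0 b1 bK Ub]] := small h d d0.
  have mono (a' b' : R) (g' : Gamma) N : a' <= b' -> almost_invariant (R := R) (@y N) g' a' ->
      almost_invariant (R := R) (@y N) g' b'.
    move=> ab inv p q f t ft; apply: le_trans (inv _ _ _ _ ft) _; rewrite ler_wpM2l//.
    by apply: le_trans (ft 1%g); exact: frob_ge0.
  exists (Num.max a b); split; [by rewrite le_max a0|by rewrite ge_max a1| |].
    by rewrite /Num.max; case: ifP.
  apply: filterS (filterI Ua Ub) => N [/= ia ib]; split.
    by apply: mono ia; rewrite le_max lexx.
  by apply: mono ib; rewrite le_max lexx orbT.
have limr g : exists l, ultra_cvg U (r^~ g) l.
  apply: (@ultra_limit _ _ _ _ _ _ c); apply: filterS Uw => N [_ _ _ [_ rc] _].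
  exact: rc.
pose rho g := projT1 (cid (limr g)).
have rhoP g : ultra_cvg U (r^~ g) (rho g) := projT2 (cid (limr g)).
have [X XP] : exists X, ultra_cvg U Xs X.
  apply: (@ultra_limit _ _ _ _ _ _ (Num.sqrt n%:R)); apply: filterS Uw => N [_ cX _ _ _].
  by rewrite /= frobE ler_wsqrtr// contraction_frob.
have rho1 : rho 1%g = 1%:M.
  apply: (ultra_cvg_unique (rhoP 1%g)) => d d0; apply: filterS Uw => N [_ _ _ [r1 _] _] /=.
  by rewrite r1 subrr frob0.
have rhoM g h : rho (g * h)%g = rho g *m rho h.
  apply: (ultra_cvg_unique _ (ultra_cvgM (rhoP g) (rhoP h))).
  apply: ultra_cvg_near (rhoP (g * h)%g) _ => d d0.
  have [eta [eta0 eta1 etaK Ueta]] := small2 g h d d0.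
  apply: filterS (filterI Uw Ueta) => N [[_ _ _ _ /(_ g h eta eta0 eta1) P] [ig ih]] /=.
  by rewrite subr0; apply: le_lt_trans etaK; have [] := P ig ih.
have rhoV g : (rho g)^t* = rho g^-1%g.
  apply: (ultra_cvg_unique (ultra_cvg_trmxC (rhoP g))).
  apply: ultra_cvg_near (rhoP g^-1%g) _ => d d0.
  have [eta [eta0 eta1 etaK Ueta]] := small2 g g d d0.
  apply: filterS (filterI Uw Ueta) => N [[_ _ _ _ /(_ g g eta eta0 eta1) P] [ig ih]] /=.
  by rewrite subr0 frobC; apply: le_lt_trans etaK; have [] := P ig ih.
have [|pi piE] := representation_of_map _ rhoM.
  by move=> g; apply/unitarymxP; rewrite rhoV -rhoM mulgV.
exists m, pi, X; split.
- by have [N []] := filter_ex Uw.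
- move=> p A; apply: (ultra_cvg_le (ultra_cvgM (ultra_cvg_cst A) XP)) => d d0.
  apply: filterS Uw => N [_ cX _ _ _] /=; apply: le_trans (cX _ _) _.
  by rewrite lerDl ltW.
- set a := _ - _; have : Num.sqrt a <= frob X.
    apply: (ultra_cvg_ge XP); apply: filterS Uw => N [_ _ aX _ _] /=.
    by rewrite frobE ler_wsqrtr.
  have [a0|a0] := leP 0 a; last by move=> _; apply: le_trans (ltW a0) _; exact: mxdot_ge0.
  by rewrite -frob_sqr -{2}[a]sqr_sqrtr// ler_sqr ?nnegrE ?sqrtr_ge0 ?frob_ge0.
move=> h; rewrite piE.
apply: (ultra_cvg_le (ultra_cvgB (ultra_cvgM (ultra_cvgM XP (rhoP h)) (ultra_cvg_trmxC XP))
  (ultra_cvg_cst (phi h)))) => d d0.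
have [eta [eta0 eta1 etaK Ueta]] := small2 h h d d0.
apply: filterS (filterI Uw Ueta) => N [[_ _ _ _ /(_ h h eta eta0 eta1) P] [ig ih]] /=.
have [_ _ P3] := P ig ih; apply: le_trans P3 _.
by rewrite lerD2l ltW.
Qed.

End ExactDilation.

(** * Reiter sequences of virtually abelian groups *)

Section Reiter.
Variables (R : realType) (Gamma : groupType).
Local Notation C := R[i].

Lemma coset_labels (H : set Gamma) : subgroup H -> finite_index H ->
  exists (k : nat) (lab : Gamma -> 'I_k) (rep : 'I_k -> Gamma),
    (forall x z, lab x = lab z <-> H (x^-1 * z)%g) /\ forall i, lab (rep i) = i.
Proof.
move=> sH /finite_seqP[s0 sE]; pose s := undup s0.
have ins x : left_coset H x \in s.
  rewrite mem_undup.
  by have : [set` s0]%classic (left_coset H x) by rewrite -sE; exists x.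
have lt x : (index (left_coset H x) s < size s)%N by rewrite index_mem ins.
pose lab x : 'I_(size s) := Ordinal (lt x).
have labE x z : lab x = lab z <-> left_coset H x = left_coset H z.
  split=> [/(congr1 val)/= xz|xz]; last by apply/val_inj; rewrite /= xz.
  by rewrite -(nth_index set0 (ins x)) xz nth_index.
have sur i : exists x, lab x = i.
  have : [set` s0]%classic (nth set0 s i) by rewrite /= -mem_undup mem_nth.
  rewrite -sE => -[x _ xE]; exists x; apply/val_inj.
  by rewrite /= xE index_uniq// undup_uniq.
exists (size s), lab, (fun i => projT1 (cid (sur i))); split; last first.
  by move=> i; exact: (projT2 (cid (sur i))).
move=> x z; rewrite labE; split; first exact: left_cosetP.
exact: left_coset_eq.
Qed.

Lemma average_pair (I J : finType) (y : I * J -> Gamma) m n (a : Gamma -> 'M[C]_(m, n)) :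
  average y a = (#|I|%:R^-1)%:C%C *: \sum_i average (fun j => y (i, j)) a.
Proof.
rewrite /average -scaler_sumr scalerA -rmorphM /= -invfM card_prod natrM.
rewrite (pair_bigA _ (fun i j => a (y (i, j)))) /=; congr (_ *: _).
by apply: eq_bigr => -[].
Qed.

Lemma frob_mean (I : finType) m n (A : I -> 'M[C]_(m, n)) (c : R) : (0 < #|I|)%N ->
  (forall i, frob (A i) <= c) -> frob ((#|I|%:R^-1)%:C%C *: \sum_i A i) <= c.
Proof.
move=> I0 Ac; have k0 : 0 < #|I|%:R :> R by rewrite ltr0n.
have kV0 : 0 <= #|I|%:R^-1 :> R by rewrite invr_ge0 ltW.
rewrite frobZ// -[c](mulKf (lt0r_neq0 k0)) ler_wpM2l//.
apply: le_trans (frob_sum _ _ _) _; apply: le_trans (ler_sum _ (fun i _ => Ac i)) _.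
by rewrite sumr_const mulr_natl.
Qed.

(** Commuting elements: averaging along the powers of one more element a makes the mean
almost a-invariant by telescoping, and keeps the invariances already obtained. *)
Lemma reiter_commuting (s : seq Gamma) (eta : R) : 0 < eta ->
  {in s &, forall a b, commute a b} ->
  exists (I : finType) (y : I -> Gamma), (0 < #|I|)%N /\
    forall a, a \in s -> almost_invariant (R := R) y a eta.
Proof.
move=> eta0; elim: s => [|a s IH] comm.
  by exists unit, (fun=> 1%g); rewrite card_unit.
have [|I [y [I0 inv]]] := IH.
  by move=> b b' bs bs'; apply: comm; rewrite inE ?bs ?bs' orbT.
pose N := (Num.bound (2 / eta)).+1.
have N0 : 0 < N%:R :> R by rewrite ltr0n.
have N2 : 2 / N%:R <= eta.
  rewrite ler_pdivrMr// mulrC -ler_pdivrMr//; apply: ltW.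
  apply: lt_le_trans (archi_boundP _) _; first by rewrite divr_ge0// ltW.
  by rewrite ler_nat.
pose z (p : I * 'I_N) : Gamma := (a ^+ p.2 * y p.1)%g.
pose z' (p : 'I_N * I) : Gamma := z (p.2, p.1).
have swap m n (F : Gamma -> 'M[C]_(m, n)) : average z F = average z' F.
  rewrite /average !card_prod mulnC; congr (_ *: _).
  rewrite (reindex (fun p : 'I_N * I => (p.2, p.1))) //=.
  by exists (fun p => (p.2, p.1)) => -[].
exists (I * 'I_N)%type, z; split; first by rewrite card_prod card_ord muln_gt0 I0.
move=> b; rewrite inE => /orP[/eqP->|bs] m n F c Fc.
  have c0 : 0 <= c by apply: le_trans (Fc 1%g); exact: frob_ge0.
  rewrite !average_pair -scalerBr -sumrB; apply: frob_mean => // i.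
  rewrite /average -scalerBr -sumrB frobZ ?invr_ge0// card_ord.
  have -> : \sum_(j < N) (F (a * z (i, j))%g - F (z (i, j))) = F (a ^+ N * y i)%g - F (y i).
    rewrite /z /= -(big_mkord xpredT (fun j => F (a * (a ^+ j * y i))%g - F (a ^+ j * y i)%g)).
    under eq_bigr do rewrite mulgA -expgS.
    by rewrite (telescope_sumr (fun j => F (a ^+ j * y i)%g))// expg0 mul1g.
  rewrite mulrC ler_pdivrMr//; apply: le_trans (frob_triangleB _ _) _.
  apply: le_trans (lerD (Fc _) (Fc _)) _.
  have h : 1 + 1 <= eta * N%:R by rewrite -ler_pdivrMr.
  by have := ler_wpM2l c0 h; rewrite mulrDr mulr1 mulrA.
rewrite !swap !average_pair -scalerBr -sumrB; apply: frob_mean => [|e]; first by rewrite card_ord.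
have ab : commute b a by apply: comm; rewrite inE ?bs ?orbT// eqxx.
have -> : average (fun j => z' (e, j)) (fun x => F (b * x)%g) =
    average y (fun x => F (a ^+ e * (b * x))%g).
  rewrite /average; congr (_ *: _); apply: eq_bigr => j _.
  by rewrite /z' /z /= mulgA (commuteX e ab) -mulgA.
have -> : average (fun j => z' (e, j)) F = average y (fun x => F (a ^+ e * x)%g) by [].
exact: (inv b bs m n (fun x => F (a ^+ e * x)%g) c (fun x => Fc _)).
Qed.

(** An element g permutes the left cosets of H and acts on each one through an element of
H, so a mean on H that is almost invariant under these finitely many elements can be
spread evenly over the cosets. *)
Lemma virtually_abelian_invariant_mean (s : seq Gamma) (eta : R) : 0 < eta ->
  virtually_abelian Gamma ->
  exists (I : finType) (y : I -> Gamma), (0 < #|I|)%N /\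
    forall g, g \in s -> almost_invariant (R := R) y g eta.
Proof.
move=> eta0 [H [sH abH fiH]].
have [k [lab [rep [labH labrep]]]] := coset_labels sH fiH.
pose next g i := lab (g * rep i)%g.
pose h g i := ((rep (next g i))^-1 * (g * rep i))%g.
have hH g i : H (h g i) by apply/labH; rewrite labrep.
pose hs := [seq h p.1 p.2 | p <- [seq (g, i) | g <- s, i <- enum 'I_k]].
have hsH x : x \in hs -> H x by case/mapP => p _ ->.
have [|I [y [I0 inv]]] := @reiter_commuting hs eta eta0.
  by move=> a b /hsH Ha /hsH Hb; apply: abH; rewrite inE.
have next_inj g : injective (next g).
  move=> i j /labH; rewrite invgM -mulgA [(g^-1 * _)%g]mulgA mulVg mul1g => /labH.
  by rewrite !labrep.
have k0 : (0 < #|'I_k|)%N by apply/card_gt0P; exists (lab 1%g).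
pose z (p : 'I_k * I) : Gamma := (rep p.1 * y p.2)%g.
exists ('I_k * I)%type, z; split; first by rewrite card_prod muln_gt0 k0.
move=> g gs m n F c Fc.
rewrite !average_pair -scalerBr [X in _ - X](reindex_inj (@next_inj g)) /= -sumrB.
apply: frob_mean => // i.
have -> : average (fun j => z (i, j)) (fun x => F (g * x)%g) =
    average y (fun x => F (rep (next g i) * (h g i * x))%g).
  rewrite /average; congr (_ *: _); apply: eq_bigr => j _; congr (F _).
  by rewrite /z /h /= !mulgA mulgV mul1g.
have -> : average (fun j => z (next g i, j)) F =
    average y (fun x => F (rep (next g i) * x)%g) by [].
have gi : h g i \in hs.
  by apply/mapP; exists (g, i) => //; apply/allpairsP; exists (g, i); rewrite mem_enum.
exact: (inv (h g i) gi m n (fun x => F (rep (next g i) * x)%g) c (fun x => Fc _)).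
Qed.

(** The elements under which the means become invariant form a subgroup, so that it is
enough to control a finite generating set. *)
Lemma virtually_abelian_reiter : finitely_generated Gamma -> virtually_abelian Gamma ->
  exists (I : nat -> finType) (y : forall N, I N -> Gamma), reiter_sequence R y.
Proof.
move=> [S finS genS] va.
have [s sE] := (finite_seqP S).1 finS.
have stage N : exists Iy : {I : finType & I -> Gamma}, (0 < #|projT1 Iy|)%N /\
    forall g, g \in s -> almost_invariant (R := R) (projT2 Iy) g (N.+1%:R^-1).
  have [|I [y yP]] := @virtually_abelian_invariant_mean s (N.+1%:R^-1) _ va.
    by rewrite invr_gt0 ltr0n.
  by exists (existT _ I y).
pose Iy N := projT1 (cid (stage N)).
have IyP N := projT2 (cid (stage N)).
exists (fun N => projT1 (Iy N)), (fun N => projT2 (Iy N)); split.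
  by move=> N; exact: (IyP N).1.
pose inv h := forall eta : R, 0 < eta -> exists N0, forall N, (N0 <= N)%N ->
  almost_invariant (R := R) (projT2 (Iy N)) h eta.
suff : (smallest (@subgroup Gamma) S `<=` [set h | inv h])%classic.
  by rewrite genS => all h; exact: all.
apply: smallest_sub.
  apply/subgroupP; split=> [eta eta0|g h /= invg invh eta eta0].
    exists 0%N => N _ m n F c Fc.
    have -> : average (projT2 (Iy N)) (fun x => F (1 * x)%g) = average (projT2 (Iy N)) F.
      by apply: eq_average => x; rewrite mul1g.
    rewrite subrr frob0 mulr_ge0 ?(ltW eta0)//.
    by apply: le_trans (Fc 1%g); exact: frob_ge0.
  have eta2 : 0 < eta / 2 by rewrite divr_gt0.
  have [N1 P1] := invg _ eta2; have [N2 P2] := invh _ eta2.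
  exists (maxn N1 N2) => N; rewrite geq_max => /andP[N1N N2N] m n F c Fc.
  have e1 : average (projT2 (Iy N)) (fun x => F (g * x)%g) =
      average (projT2 (Iy N)) (fun x => F (g * h^-1 * (h * x))%g).
    by apply: eq_average => x; rewrite -!mulgA mulKg.
  have q1 := P1 N N1N m n F c Fc.
  have q2 := P2 N N2N m n (fun x => F (g * h^-1 * x)%g) c (fun x => Fc _).
  rewrite -e1 frobC in q2.
  apply: le_trans (frob_dist_trans (average (projT2 (Iy N)) (fun x => F (g * x)%g)) _ _) _.
  have -> : c * eta = c * (eta / 2) + c * (eta / 2) by rewrite -mulrDr -splitr.
  exact: lerD q2 q1.
move=> g Sg eta eta0.
have gs : g \in s by rewrite sE in Sg.
exists (Num.bound eta^-1) => N NN m n F c Fc.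
have c0 : 0 <= c by apply: le_trans (Fc 1%g); exact: frob_ge0.
apply: le_trans ((IyP N).2 g gs m n F c Fc) _; rewrite ler_wpM2l//.
rewrite -[eta]invrK lef_pV2 ?posrE ?invr_gt0 ?ltr0n//.
apply: le_trans (ltW (archi_boundP _)) _; first by rewrite invr_ge0 ltW.
by rewrite ler_nat leqW.
Qed.

End Reiter.

(** * Stability of virtually abelian groups *)

Section Stability.
Variables (R : realType) (Gamma : groupType).
Local Notation C := R[i].

(** If the dilation is too large then 6 e n >= 1, so that the bounded dimensional error
made in cutting out a subrepresentation is itself of order e n. *)
Lemma subrepresentation_of_right_dim (H : set Gamma) (T : seq Gamma) n m
    (rho : {multiplicative Gamma -> 'U[R]_m}) (k : R) :
  {in [in H] &, forall x z, commute x z} ->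
  (forall g, exists2 t, t \in T & H (g * t^-1)%g) -> 0 <= k ->
  n%:R - k <= m%:R -> m%:R <= n%:R + k ->
  exists (r : nat) (E : 'M[C]_(r, m)), [/\ E \is unitarymx,
    forall g, stablemx E (\val (rho g)), (r <= n)%N,
    n%:R <= r%:R + (1 + (size T)%:R) * k & m%:R <= r%:R + (1 + (size T)%:R) * k].
Proof.
move=> abH HT k0 nm mn; have D0 : 0 <= (size T)%:R :> R by [].
have Dk : 0 <= (size T)%:R * k by rewrite mulr_ge0.
have [le_mn|lt_nm] := leqP m n.
  exists m, 1%:M; split => //.
  - by apply/unitarymxP; rewrite mul1mx trmxC1.
  - by move=> g; exact: submx1.
  - by rewrite mulrDl mul1r; lra.
  - by rewrite lerDl mulr_ge0// addr_ge0.
have [V [Vn nV Vst]] := stable_subspace_near_dim abH HT rho (ltnW lt_nm).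
have [E Eu EV] := orthonormal_basis V.
exists (\rank V), E; split => //.
- by move=> g; rewrite (eqmxMr _ EV) (submx_trans (Vst g))// EV submx_refl.
all: have k1 : 1 <= k by move: lt_nm; rewrite -(ler_nat R) -(natr1 n); lra.
all: have : n%:R <= (\rank V)%:R + (size T)%:R :> R by rewrite -natrD ler_nat ltnW.
all: have : (size T)%:R <= (size T)%:R * k by rewrite ler_peMr.
all: by rewrite mulrDl mul1r; lra.
Qed.

Fact stability_arith (s q e x1 x2 x3 : R) : e * q <= s * q ->
  x1 * s * q + e * q + 2 * (x2 * s * q) + 2 * (x3 * s * q) <=
  s * (x1 + 1 + 2 * x2 + 2 * x3) * q.
Proof. move=> h; rewrite !(mulrDr, mulrDl); lra. Qed.

(** All errors are at most a constant times the square root of e n, where the constant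
depends only on the number of cosets; e is chosen to be a square. *)
Lemma stable_of_virtually_abelian : finitely_generated Gamma ->
  virtually_abelian Gamma -> uniformly_HS_stable R Gamma.
Proof.
move=> fg va delta delta0.
have [I [y reiter]] := virtually_abelian_reiter R fg va.
have [H [sH abH fiH]] := va.
have [T HT] := right_transversal sH fiH.
pose b : R := 1 + (size T)%:R.
have b0 : 0 <= b by rewrite addr_ge0.
pose W := Num.sqrt 6 + 1 + 2 * Num.sqrt (b * 6) + 2 * Num.sqrt (6 + b * 6).
have W1 : 1 <= W.
  have := sqrtr_ge0 (6 : R); have := sqrtr_ge0 (b * 6); have := sqrtr_ge0 (6 + b * 6).
  by rewrite /W; lra.
have W0 : 0 < W by apply: lt_le_trans W1.
pose s := Num.min 1 (delta / (2 * W)).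
have s0 : 0 < s by rewrite lt_min ltr01 divr_gt0// mulr_gt0.
have s1 : s <= 1 by rewrite ge_min lexx.
have sW : s * W < delta.
  apply: le_lt_trans (_ : delta / (2 * W) * W < _).
    by rewrite ler_pM2r// ge_min lexx orbT.
  by rewrite invfM mulrA divfK ?gt_eqF//; lra.
exists (s ^+ 2); first by rewrite exprn_gt0.
move=> n n0 phi0 phi0M; pose phi g : 'M[C]_n := \val (phi0 g).
pose e := s ^+ 2.
have e0 : 0 <= e := sqr_ge0 s.
have e01 : 0 <= e <= 1 by rewrite e0 /= /e expr_le1 ?(ltW s0).
have phiU g : phi g \is unitarymx by exact: unitaryP.
have phiM g h : frob (phi g *m phi h - phi (g * h)%g) <= e * Num.sqrt n%:R.
  by have := phi0M g h; rewrite HSdist_lt// => /ltW.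
have [m [rho [X [mn cX XX Xc]]]] := exact_dilation reiter phiU e01 phiM.
have n00 : 0 <= n%:R :> R by [].
have k0 : 0 <= 6 * e * n%:R := mulr_ge0 (mulr_ge0 (ler0n _ _) e0) n00.
have nm : n%:R - 6 * e * n%:R <= m%:R.
  apply: le_trans XX _; rewrite -mxdot_trmxC.
  exact: contraction_frob (contraction_trmxC cX).
have [r [E [Eu Est rn nr mr]]] := subrepresentation_of_right_dim rho abH HT k0 nm mn.
have bk0 : 0 <= b * (6 * e * n%:R) by rewrite mulr_ge0.
have [pi piE] := representation_of_right_dim cX XX Eu Est rn nr mr bk0 k0 Xc.
exists pi => g; rewrite HSdist_lt//; apply: le_lt_trans (piE g) _.
have sq (a : R) : 0 <= a -> Num.sqrt (a * e * n%:R) = Num.sqrt a * s * Num.sqrt n%:R.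
  have se : Num.sqrt e = s by rewrite /e sqrtr_sqr gtr0_norm.
  by move=> a0; rewrite (sqrtrM _ (mulr_ge0 a0 e0)) (sqrtrM _ a0) se.
have -> : b * (6 * e * n%:R) = b * 6 * e * n%:R by rewrite !mulrA.
have -> : 6 * e * n%:R + b * 6 * e * n%:R = (6 + b * 6) * e * n%:R by rewrite !mulrDl.
rewrite !sq ?addr_ge0 ?mulr_ge0//.
have q0 : 0 < Num.sqrt n%:R :> R by rewrite sqrtr_gt0 ltr0n.
apply: le_lt_trans (_ : s * W * Num.sqrt n%:R < _); last by rewrite ltr_pM2r.
have : e * Num.sqrt n%:R <= s * Num.sqrt n%:R.
  by rewrite ler_pM2r// /e expr2 ler_piMr// ltW.
rewrite /W; move: (Num.sqrt 6) (Num.sqrt (b * 6)) (Num.sqrt (6 + _)) => x1 x2 x3.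
exact: stability_arith.
Qed.

End Stability.

Theorem theorem1p4 (R : realType) (Gamma : groupType) :
  finitely_generated Gamma -> residually_finite Gamma ->
  (uniformly_HS_stable R Gamma <-> virtually_abelian Gamma).
Proof.
move=> fg rf; split; first exact: virtually_abelian_of_stable.
exact: stable_of_virtually_abelian.
Qed.
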